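(* Let $\mu$ be a positive Radon measure on $\mathbb{R}^n$, let $\Omega\subset\mathbb{R}^n$ be an open set with $\mu(\Omega)<\infty$, and let $f\colon\Omega\to\mathbb{R}^n$ be a Borel map such that $f(x)\in V(\mu,x)^\perp$ for $\mu$-a.e. $x\in\Omega$. Then for every $\varepsilon>0$ there exist a compact set $K\subset\Omega$ and a function $g\colon\Omega\to\mathbb{R}$ of class $C^1$ such that \begin{gather*} \mu(\Omega\setminus K)<\varepsilon,\qquad Dg(x)=f(x)\ \text{ for all } x\in K,\\ \|Dg\|_{L^p(\mu)}\le (1+\varepsilon)\|f\|_{L^p(\mu)}\quad\text{for every } p\in[1,\infty]. \end{gather*}
   Context: All $L^p(\mu)$ norms are taken over $\Omega$ with respect to $\mu$. The decomposability bundle of a positive Radon measure $\mu$ on $\mathbb{R}^n$ is a Borel map $x\mapsto V(\mu,x)$ with values in the set of linear subspaces of $\mathbb{R}^n$ (of any dimension) with the property that, for $\mu$-a.e. $x$, a vector $v\in\mathbb{R}^n$ belongs to $V(\mu,x)$ if and only if there exists an $\mathbb{R}^n$-valued (finite) measure $T$ with $\operatorname{div}T=0$ in the sense of distributions such that $\lim_{r\to0}\frac{\mathbb{M}((T-v\mu)\llcorner B(x,r))}{\mu(B(x,r))}=0$, where $\mathbb{M}(\nu)=|\nu|(\mathbb{R}^n)$ is the total variation mass and $\nu\llcorner E$ is the restriction of $\nu$ to $E$. (Such a map exists and is unique up to $\mu$-null sets.) *)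

(* Defs.v *)
From HB Require Import structures.
From mathcomp Require Import all_boot all_order all_algebra.
From mathcomp Require Import all_classical all_reals all_analysis.
Set Implicit Arguments. Unset Strict Implicit. Unset Printing Implicit Defensive.
Import Order.TTheory GRing.Theory Num.Theory.
Import numFieldNormedType.Exports.
Local Open Scope classical_set_scope.
Local Open Scope ring_scope.

Section Defs.
Context {R : realType} {n : nat}.
Local Notation V := 'rV[R]_n.

Definition Borel : Type := g_sigma_algebraType (@open V).

Definition enorm (v : V) : R := Num.sqrt (\sum_i v 0 i ^+ 2).
Definition dotp (u v : V) : R := \sum_i u 0 i * v 0 i.
Definition eball (x : V) (r : R) : set V := [set y | enorm (y - x) < r].

Definition unitv (i : 'I_n) : V := delta_mx 0 i.
Definition partial (i : 'I_n) (g : V -> R) : V -> R := fun x => 'D_(unitv i) g x.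
Definition grad (g : V -> R) (x : V) : V := \row_i partial i g x.

Definition iter_partial (l : seq 'I_n) (g : V -> R) : V -> R := foldr partial g l.
Definition smooth (g : V -> R) : Prop :=
  forall l : seq 'I_n, continuous (iter_partial l g) /\
    forall (i : 'I_n) (x : V), derivable (iter_partial l g) x (unitv i).
Definition test_fun (phi : V -> R) : Prop :=
  smooth phi /\ exists K : set V, compact K /\ forall x, ~ K x -> phi x = 0.

Definition C1_on (O : set V) (g : V -> R) : Prop :=
  (forall x, O x -> differentiable g x) /\
  (forall (i : 'I_n) x, O x -> partial i g @ x --> partial i g x).

Definition radon (mu : {measure set Borel -> \bar R}) : Prop :=
  forall K : set V, compact K -> (mu K < +oo)%E.

(* R^n-valued finite measure T = tau * nu, given by a finite positive measure nu
   and a nu-integrable Borel density tau; T(E) = \int_E tau dnu. *)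
Definition vmeasure (nu : {measure set Borel -> \bar R}) (tau : Borel -> V)
  (E : set Borel) : V := \row_i Rintegral nu E (fun x => tau x 0 i).

Definition finite_vmeasure (nu : {measure set Borel -> \bar R}) (tau : Borel -> V) :=
  (nu setT < +oo)%E /\ measurable_fun setT (tau : Borel -> Borel) /\
  nu.-integrable setT (fun x => (enorm (tau x))%:E).

Definition divfree (nu : {measure set Borel -> \bar R}) (tau : Borel -> V) : Prop :=
  forall phi : V -> R, test_fun phi ->
    Rintegral nu setT (fun x => dotp (grad phi x) (tau x)) = 0.

Definition mass (sigma : set Borel -> V) : \bar R :=
  ereal_sup [set (\sum_(k <oo) (enorm (sigma (F k)))%:E)%E |
    F in [set F : nat -> set Borel |
      (forall k, measurable (F k)) /\ trivIset setT F /\ \bigcup_k F k = setT]].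

Definition restr_diff (nu mu : {measure set Borel -> \bar R}) (tau : Borel -> V)
  (v x : V) (r : R) : set Borel -> V :=
  fun E => vmeasure nu tau (E `&` eball x r) - fine (mu (E `&` eball x r)) *: v.

Definition in_decomp (mu : {measure set Borel -> \bar R}) (x v : V) : Prop :=
  exists (nu : {measure set Borel -> \bar R}) (tau : Borel -> V),
    finite_vmeasure nu tau /\ divfree nu tau /\
    (fun r => fine (mass (restr_diff nu mu tau v x r)) / fine (mu (eball x r)))
      @ (0 : R)^'+ --> (0 : R).

End Defs.

(* Main.v *)
(* A field [f] with [|f| <= phi], orthogonal to the decomposability bundle of [mu], is an L^1-limit of
   gradients of test functions bounded by [(1 + d) phi].  Otherwise the Mazur-Orlicz form of
   Hahn-Banach and the Riesz theorem yield a divergence-free vector measure [T] that pairs too well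
   with [f].  By differentiation of measures the density of [T] with respect to [mu] takes its values
   in the bundle, so the pairing only sees the part of [T] singular to [mu], which is bounded by [phi].
   Hence [f] equals a gradient up to a uniformly small residual off a set of small measure.  Alberti's
   theorem turns the residual, on a slightly smaller compact set, into the gradient of a C^1 function
   with uniformly small gradient: finely oscillating sawtooth functions multiplied by a smooth
   approximation of the field reproduce it up to a fixed fraction, and the procedure is iterated.
   For the norms, [phi] is [|f|] on a large compact set, at most [M] on a tiny neighbourhood of it and
   small elsewhere, up to a small constant.  [M] is chosen so that [|f| > (1 - t) M] on a set of positive
   measure: this makes the error terms negligible against [|f|] for all exponents simultaneously. *)

Require Import Defs.
From HB Require Import structures.
From mathcomp Require Import all_boot all_order all_algebra finmap.
From mathcomp Require Import all_classical all_reals all_analysis.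
From mathcomp Require Import measurable_realfun zify ring lra.
Set Implicit Arguments. Unset Strict Implicit. Unset Printing Implicit Defensive.
Import Order.TTheory GRing.Theory Num.Theory.
Import numFieldNormedType.Exports.
Local Open Scope classical_set_scope.
Local Open Scope ring_scope.

(** * Euclidean norm and inner product *)

(** Alberti's theorem bounds the gradient only up to a constant that grows as the exceptional set
    shrinks, so applied to [f] itself it cannot give the factor [1 + eps]. Orthogonality to the
    bundle allows it to be applied to a residual below any threshold, fixed once that constant is
    known. The smooth gradient is close to [f] only in L^1, so its size away from the good set has
    to be controlled pointwise; the separation argument therefore handles a weighted sup norm and
    the L^1 norm at once, and its functional splits into a part [S] continuous for the first and a
    part [H] continuous for the second. The divergence-free measure represents [S + H], whereas only
    [H] can be evaluated at the discontinuous [f]; a continuous field that is good for all measures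
    involved mediates between them. The bundle enters only through the pointwise predicate
    [in_decomp], so its measurability never has to be discussed. Since [mu] need not be doubling,
    differentiation with respect to it rests on a covering argument of Besicovitch type. *)

Section Euclidean.
Context {R : realType} {n : nat}.
Local Notation V := 'rV[R]_n.
Implicit Types (u v w x y : V) (a : R).

Lemma dotpC u v : dotp u v = dotp v u.
Proof. by apply: eq_bigr => i _; rewrite mulrC. Qed.

Lemma dotpDl u v w : dotp (u + v) w = dotp u w + dotp v w.
Proof. by rewrite /dotp -big_split/=; apply: eq_bigr => i _; rewrite mxE mulrDl. Qed.

Lemma dotpZl a u v : dotp (a *: u) v = a * dotp u v.
Proof. by rewrite /dotp mulr_sumr; apply: eq_bigr => i _; rewrite mxE mulrA. Qed.

Lemma dotpDr u v w : dotp w (u + v) = dotp w u + dotp w v.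
Proof. by rewrite dotpC dotpDl !(dotpC w). Qed.

Lemma dotpZr a u v : dotp v (a *: u) = a * dotp v u.
Proof. by rewrite dotpC dotpZl dotpC. Qed.

Lemma dotpNl u v : dotp (- u) v = - dotp u v.
Proof. by rewrite -scaleN1r dotpZl mulN1r. Qed.

Lemma dotpBl u v w : dotp (u - v) w = dotp u w - dotp v w.
Proof. by rewrite dotpDl dotpNl. Qed.

Lemma dotp0l u : dotp 0 u = 0.
Proof. by rewrite -(scale0r u) dotpZl mul0r. Qed.

Lemma enorm_ge0 v : 0 <= enorm v. Proof. exact: sqrtr_ge0. Qed.

Lemma sumsq_ge0 v : 0 <= \sum_i v 0 i ^+ 2.
Proof. by apply: sumr_ge0 => i _; exact: sqr_ge0. Qed.

Lemma dotpvv v : dotp v v = enorm v ^+ 2.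
Proof. by rewrite sqr_sqrtr ?sumsq_ge0//; apply: eq_bigr => i _; rewrite expr2. Qed.

Lemma enorm0 : enorm (0 : V) = 0.
Proof. by rewrite /enorm big1 ?sqrtr0// => i _; rewrite mxE expr0n. Qed.

Lemma enorm_eq0 v : enorm v = 0 -> v = 0.
Proof.
move=> /eqP; rewrite sqrtr_eq0 => v0.
have /eqP : \sum_i v 0 i ^+ 2 = 0 by apply/eqP; rewrite eq_le v0 sumsq_ge0.
rewrite psumr_eq0 => [/allP h|i _]; last exact: sqr_ge0.
apply/rowP => i; rewrite mxE; apply/eqP; rewrite -sqrf_eq0.
by apply: h; rewrite mem_index_enum.
Qed.

Lemma enorm_gt0 v : v != 0 -> 0 < enorm v.
Proof. by move=> v0; rewrite lt_def enorm_ge0 andbT; apply: contraNneq v0 => /enorm_eq0 ->. Qed.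

Lemma enormZ a v : enorm (a *: v) = `|a| * enorm v.
Proof.
rewrite /enorm (eq_bigr (fun i => a ^+ 2 * v 0 i ^+ 2)) => [|i _]; last by rewrite mxE exprMn.
by rewrite -mulr_sumr sqrtrM ?sqr_ge0// sqrtr_sqr.
Qed.

Lemma enormN v : enorm (- v) = enorm v.
Proof. by rewrite -scaleN1r enormZ normrN1 mul1r. Qed.

Lemma enormB x y : enorm (x - y) = enorm (y - x).
Proof. by rewrite -enormN opprB. Qed.

Lemma dotp_le u v : dotp u v <= enorm u * enorm v.
Proof.
have [->|u0] := eqVneq u 0; first by rewrite dotp0l enorm0 mul0r.
have [->|v0] := eqVneq v 0; first by rewrite dotpC dotp0l enorm0 mulr0.
have su := enorm_gt0 u0; have sv := enorm_gt0 v0.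
(* With [p = |u|], [q = |v|] and [d] the inner product, this square is [2 p q (p q - d)]. *)
have : 0 <= dotp (enorm v *: u - enorm u *: v) (enorm v *: u - enorm u *: v).
  by rewrite dotpvv sqr_ge0.
rewrite dotpBl !dotpZl !(dotpC _ (_ - _)) !dotpBl !dotpZl !dotpvv (dotpC v u).
set d := dotp u v; set p := enorm u; set q := enorm v => h.
have pq : 0 < p * q by rewrite mulr_gt0.
rewrite -(ler_pM2l pq) -subr_ge0.
nra.
Qed.

Lemma dotp_abs_le u v : `|dotp u v| <= enorm u * enorm v.
Proof. by rewrite ler_norml dotp_le andbT lerNl -dotpNl -(enormN u) dotp_le. Qed.

Lemma enormD u v : enorm (u + v) <= enorm u + enorm v.
Proof.
rewrite -(@ler_sqr _ (enorm (u + v))) ?nnegrE ?addr_ge0 ?enorm_ge0//.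
rewrite -dotpvv dotpDl !dotpDr !dotpvv (dotpC v u).
by have := dotp_le u v; lra.
Qed.

Lemma enorm_triangle y x z : enorm (x - z) <= enorm (x - y) + enorm (y - z).
Proof. by rewrite -[x - z](subrKA y) enormD. Qed.

Lemma enorm_coord v i : `|v 0 i| <= enorm v.
Proof.
rewrite -sqrtr_sqr /enorm ler_sqrt ?sumsq_ge0// (bigD1 i)//= lerDl.
by apply: sumr_ge0 => j _; exact: sqr_ge0.
Qed.

(** The norm carried by the type of row vectors is the sup norm. Comparing it with [enorm] transfers
    topology and compactness to Euclidean balls. *)
Lemma norm_coord v i : `|v 0 i| <= `|v|.
Proof.
rewrite [leRHS]/Num.norm /= mx_normrE; apply/bigmax_geP; right => /=.
by exists (0, i).
Qed.

Lemma norm_le v a : 0 <= a -> (forall i, `|v 0 i| <= a) -> `|v| <= a.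
Proof.
move=> a0 h; rewrite [leLHS]/Num.norm /= mx_normrE; apply/bigmax_leP; split => //= -[j i] _ /=.
by rewrite ord1.
Qed.

Lemma norm_le_enorm v : `|v| <= enorm v.
Proof. by apply: norm_le => [|i]; rewrite ?enorm_ge0 ?enorm_coord. Qed.

Lemma enorm_le_sum v : enorm v <= \sum_i `|v 0 i|.
Proof.
have s0 : 0 <= \sum_i `|v 0 i| by apply: sumr_ge0.
rewrite -(@ler_sqr _ (enorm v)) ?nnegrE ?enorm_ge0//.
rewrite sqr_sqrtr ?sumsq_ge0// expr2 mulr_suml; apply: ler_sum => i _.
rewrite -normr_id -real_normK ?num_real// expr2 normr_id ler_wpM2l//.
by rewrite (bigD1 i)//= lerDl sumr_ge0.
Qed.

Lemma enorm_le_norm v : enorm v <= n%:R * `|v|.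
Proof.
apply: le_trans (enorm_le_sum v) _.
apply: (@le_trans _ _ (\sum_(i < n) `|v|)); first by apply: ler_sum => i _; exact: norm_coord.
by rewrite sumr_const card_ord mulr_natl.
Qed.

Lemma unitvE (i j : 'I_n) : (unitv i : V) 0 j = (j == i)%:R.
Proof. by rewrite mxE eqxx/=. Qed.

Lemma row_unitv v : v = \sum_i v 0 i *: unitv i.
Proof. exact: row_sum_delta. Qed.

Lemma dotp_unitv v i : dotp v (unitv i) = v 0 i.
Proof.
rewrite /dotp (bigD1 i)//= unitvE eqxx mulr1 big1 ?addr0// => j ji.
by rewrite unitvE (negbTE ji) mulr0.
Qed.

Lemma enorm_lip x y : `|enorm x - enorm y| <= n%:R * `|x - y|.
Proof.
apply: le_trans (enorm_le_norm _).
have := enormD (x - y) y; have := enormD (y - x) x; rewrite !subrK (enormB y) => h1 h2.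
by rewrite ler_norml; apply/andP; split; lra.
Qed.

Lemma continuous_lip (T : normedModType R) (h : T -> R) (k : R) :
  (forall s t : T, `|h s - h t| <= k * `|s - t|) -> continuous h.
Proof.
move=> hk s; apply/cvgrPdist_le => e e0.
have k1 : 0 < `|k| + 1 by rewrite ltr_pwDr.
near=> t; apply: le_trans (hk _ _) _.
apply: (@le_trans _ _ ((`|k| + 1) * `|s - t|)).
  by rewrite ler_wpM2r// (le_trans (ler_norm _))// lerDl.
rewrite -ler_pdivlMl// mulrC; near: t.
by apply: cvgr_dist_le => //; rewrite divr_gt0.
Unshelve. all: by end_near. Qed.

Lemma enorm_continuous : continuous (@enorm R n).
Proof. exact: continuous_lip enorm_lip. Qed.

Lemma edist_from_continuous x : continuous (fun y => enorm (y - x)).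
Proof.
apply: (@continuous_lip _ _ n%:R) => y z; apply: le_trans (enorm_lip _ _) _.
by rewrite opprB addrA subrK.
Qed.

Lemma eball_open x (r : R) : open (eball x r).
Proof.
have -> : eball x r = (fun y => enorm (y - x)) @^-1` [set t | t < r] by [].
by apply: open_comp; [move=> y _; exact: edist_from_continuous|exact: open_lt].
Qed.

Lemma closed_eball_closed x (r : R) : closed [set y | enorm (y - x) <= r].
Proof.
have -> : [set y | enorm (y - x) <= r] = (fun y => enorm (y - x)) @^-1` [set t | t <= r] by [].
by apply: closed_comp; [move=> y _; exact: edist_from_continuous|exact: closed_le].
Qed.

Lemma closed_eball_compact x (r : R) : compact [set y | enorm (y - x) <= r].
Proof.
apply: bounded_closed_compact; last exact: closed_eball_closed.
exists (r + `|x|); split; first exact: num_real.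
move=> M rM y /= yr; apply: le_trans (ltW rM).
rewrite -[y](subrK x); apply: le_trans (ler_normD _ _) _.
by rewrite lerD2r (le_trans (norm_le_enorm _)).
Qed.

Lemma nbhs_eballP x (A : set V) : nbhs x A <-> exists2 r : R, 0 < r & eball x r `<=` A.
Proof.
split.
  move=> /nbhs_ballP[r /= r0 rA]; exists r => // y; rewrite /eball /= => yr.
  apply: rA; rewrite -ball_normE /ball_ /=.
  by rewrite (le_lt_trans (norm_le_enorm _))// enormB.
move=> [r r0 rA]; apply: filterS rA _; apply: open_nbhs_nbhs; split; first exact: eball_open.
by rewrite /eball /= subrr enorm0.
Qed.

End Euclidean.

(** * The Mazur-Orlicz theorem on cones *)

Section MazurOrlicz.
Context {R : realType} {E : lmodType R}.
Implicit Types (D G : set E) (p q c : E -> R).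

Definition linear_subspace D := D 0 /\ forall a x y, D x -> D y -> D (a *: x + y).

Definition sublinear_on D p :=
  (forall x y, D x -> D y -> p (x + y) <= p x + p y) /\
  (forall a x, 0 <= a -> D x -> p (a *: x) = a * p x).

Definition linear_on D p := forall a x y, D x -> D y -> p (a *: x + y) = a * p x + p y.

Definition cone G :=
  [/\ G 0, forall x y, G x -> G y -> G (x + y) & forall a x, 0 <= a -> G x -> G (a *: x)].

Definition cone_linear G c :=
  (forall x y, G x -> G y -> c (x + y) = c x + c y) /\
  (forall a x, 0 <= a -> G x -> c (a *: x) = a * c x).

Lemma subspaceD D x y : linear_subspace D -> D x -> D y -> D (x + y).
Proof. by move=> [_ h] Dx Dy; rewrite -[x]scale1r; exact: h. Qed.

Lemma subspaceZ D a x : linear_subspace D -> D x -> D (a *: x).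
Proof. by move=> [D0 h] Dx; rewrite -[_ *: x]addr0; exact: h. Qed.

Lemma subspaceN D x : linear_subspace D -> D x -> D (- x).
Proof. by move=> sD Dx; rewrite -scaleN1r; exact: subspaceZ. Qed.

Lemma sublinear_on0 D p : linear_subspace D -> sublinear_on D p -> p 0 = 0.
Proof. by move=> [D0 _] [_ /(_ 0 0 (lexx _) D0)]; rewrite scale0r mul0r. Qed.

Lemma sublinear_onN D p x : linear_subspace D -> sublinear_on D p -> D x -> - p (- x) <= p x.
Proof.
move=> sD sp Dx; have := sp.1 x (- x) Dx (subspaceN sD Dx).
by rewrite subrr (sublinear_on0 sD sp); lra.
Qed.

Section ConeShift.
Variables (D G : set E) (p c : E -> R).
Hypotheses (sD : linear_subspace D) (sp : sublinear_on D p) (GD : G `<=` D)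
  (cG : cone G) (lc : cone_linear G c) (cp : forall x, G x -> c x <= p x).

(** This is the largest sublinear functional [r <= p] with [r (- g) <= - c g] on [G], because
    [r x <= r (x + g) + r (- g)]. A linear functional below it therefore dominates [c] on the
    cone. *)
Definition cone_shift x := inf [set p (x + g) - c g | g in G].

Let lb x : D x -> lbound [set p (x + g) - c g | g in G] (- p (- x)).
Proof.
move=> Dx _ [g Gg <-]; have Dg := GD Gg.
have := sp.1 (x + g) (- x) (subspaceD sD Dx Dg) (subspaceN sD Dx).
by rewrite addrAC subrr add0r; have := cp Gg; lra.
Qed.

Let inh x : [set p (x + g) - c g | g in G] !=set0.
Proof. by have [G0 _ _] := cG; exists (p (x + 0) - c 0), 0. Qed.

Lemma cone_shift_le x g : D x -> G g -> cone_shift x <= p (x + g) - c g.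
Proof. by move=> Dx Gg; apply: ge_inf; [exists (- p (- x)); exact: lb|exists g]. Qed.

Lemma le_cone_shift x a : (forall g, G g -> a <= p (x + g) - c g) -> a <= cone_shift x.
Proof. by move=> h; apply: lb_le_inf => // _ [g Gg <-]; exact: h. Qed.

Let c0 : c 0 = 0.
Proof. by have [G0 _ _] := cG; have := lc.2 0 0 (lexx _) G0; rewrite scale0r mul0r. Qed.

Lemma cone_shift_le_id x : D x -> cone_shift x <= p x.
Proof.
move=> Dx; have [G0 _ _] := cG.
by have := cone_shift_le Dx G0; rewrite addr0 c0 subr0.
Qed.

Lemma cone_shift_oppr g : G g -> cone_shift (- g) <= - c g.
Proof.
move=> Gg; have := cone_shift_le (subspaceN sD (GD Gg)) Gg.
by rewrite addNr (sublinear_on0 sD sp) sub0r.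
Qed.

Lemma cone_shift_sublinear : sublinear_on D cone_shift.
Proof.
have [G0 GA GZ] := cG; split.
  move=> x y Dx Dy; rewrite -lerBlDl; apply: le_cone_shift => h Gh.
  rewrite lerBlDr -lerBlDl; apply: le_cone_shift => g Gg.
  have Dg := GD Gg; have Dh := GD Gh.
  have := cone_shift_le (subspaceD sD Dx Dy) (GA _ _ Gg Gh).
  have := sp.1 (x + g) (y + h) (subspaceD sD Dx Dg) (subspaceD sD Dy Dh).
  by rewrite lc.1// addrACA; lra.
have pos a x : 0 < a -> D x -> cone_shift (a *: x) <= a * cone_shift x.
  move=> a0 Dx; rewrite -ler_pdivrMl//; apply: le_cone_shift => g Gg.
  rewrite ler_pdivrMl//; have Dg := GD Gg.
  have := cone_shift_le (subspaceZ a sD Dx) (GZ _ _ (ltW a0) Gg).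
  have Dxg := subspaceD sD Dx Dg.
  by rewrite -scalerDr (sp.2 _ _ (ltW a0) Dxg) (lc.2 _ _ (ltW a0) Gg) mulrBr.
move=> a x; rewrite le_eqVlt => /predU1P[<- Dx|a0 Dx].
  rewrite scale0r mul0r; apply/eqP; rewrite eq_le; apply/andP; split.
    by have := cone_shift_le_id sD.1; rewrite (sublinear_on0 sD sp).
  by apply: le_cone_shift => g Gg; rewrite add0r subr_ge0 cp.
apply/eqP; rewrite eq_le pos//= mulrC -ler_pdivlMr// mulrC.
have := pos a^-1 (a *: x); rewrite scalerA mulVf ?gt_eqF// scale1r invr_gt0.
by apply => //; exact: subspaceZ.
Qed.

End ConeShift.

(** Shifting [q] along the ray of [y], with [c = q], gives a sublinear functional below [q]. By
    minimality it equals [q], and the competitor [g = y] in the infimum yields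
    [q x + q y <= q (x + y)]. *)
Lemma minimal_sublinear_linear D q : linear_subspace D -> sublinear_on D q ->
  (forall r, sublinear_on D r -> (forall x, D x -> r x <= q x) ->
    forall x, D x -> r x = q x) ->
  linear_on D q.
Proof.
move=> sD sq min.
have add x y : D x -> D y -> q (x + y) = q x + q y.
  move=> Dx Dy; apply/eqP; rewrite eq_le sq.1//=.
  pose G : set E := [set a *: y | a in [set a : R | 0 <= a]].
  have G1 : G y by exists 1; rewrite /= ?scale1r.
  have GD : G `<=` D by move=> _ [a _ <-]; exact: subspaceZ.
  have cG : cone G.
    split; first by exists 0; rewrite /= ?scale0r.
      move=> _ _ [a /= a0 <-] [b /= b0 <-]; exists (a + b) => /=; first exact: addr_ge0.
      by rewrite scalerDl.
    move=> b _ b0 [a /= a0 <-]; exists (b * a) => /=; first exact: mulr_ge0.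
    by rewrite scalerA.
  have lq : cone_linear G q.
    split; last by move=> a z a0 Gz; apply: sq.2 => //; exact: GD.
    move=> _ _ [a /= a0 <-] [b /= b0 <-].
    by rewrite -scalerDl !sq.2 ?addr_ge0// mulrDl.
  have cp z : G z -> q z <= q z by [].
  have := min _ (cone_shift_sublinear sD sq GD cG lq cp)
    (fun z => cone_shift_le_id sD sq GD cG lq cp (x := z)) x Dx.
  by have := cone_shift_le sD sq GD cp Dx G1; lra.
have opp x : D x -> q (- x) = - q x.
  move=> Dx; have := add x (- x) Dx (subspaceN sD Dx).
  by rewrite subrr (sublinear_on0 sD sq); lra.
move=> a x y Dx Dy; rewrite add//; last exact: subspaceZ.
congr (_ + _); have [a0|a0] := leP 0 a; first exact: sq.2.
have na : 0 <= - a by rewrite oppr_ge0 ltW.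
have Dnx := subspaceZ (- a) sD Dx.
by rewrite -[in LHS](opprK a) scaleNr opp// (sq.2 _ _ na Dx) mulNr opprK.
Qed.

Lemma exists_minimal_sublinear D p : linear_subspace D -> sublinear_on D p ->
  exists q, [/\ sublinear_on D q, forall x, D x -> q x <= p x &
    forall r, sublinear_on D r -> (forall x, D x -> r x <= q x) ->
    forall x, D x -> r x = q x].
Proof.
move=> sD sp.
(* Prescribing the value 0 off [D] turns comparison on [D] into the pointwise order on all of [E],
   which is antisymmetric as Zorn's lemma requires. *)
pose P q := [/\ sublinear_on D q, forall x, D x -> q x <= p x & forall x, ~ D x -> q x = 0].
pose T := {q : E -> R | P q}.
pose cut q x := if pselect (D x) then q x else 0.
have cutE q x : D x -> cut q x = q x by rewrite /cut; case: pselect.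
have cutP q : sublinear_on D q -> (forall x, D x -> q x <= p x) -> P (cut q).
  move=> sq qp; split.
  - split=> [x y Dx Dy|a x a0 Dx]; rewrite !cutE//; [exact: sq.1| |exact: sq.2|].
      exact: subspaceD.
    exact: subspaceZ.
  - by move=> x Dx; rewrite cutE// qp.
  - by move=> x Dx; rewrite /cut; case: pselect.
pose S (u v : T) := `[< forall x, sval v x <= sval u x >].
have [||||q qmax] := @Zorn T S.
- by move=> q; apply/asboolP => x; exact: lexx.
- by move=> r s t /asboolP rs /asboolP st; apply/asboolP => x; exact: le_trans (st x) (rs x).
- move=> [s Ps] [t Pt] /asboolP/= st /asboolP/= ts.
  have E' : s = t by apply/funext => x; apply/eqP; rewrite eq_le st ts.
  by subst t; congr exist; exact: Prop_irrelevance.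
- move=> A Atot.
  have [[a Aa]|A0] := pselect (A !=set0); last first.
    have Pp : P (cut p) by exact: cutP.
    by exists (exist _ _ Pp) => s As; case: A0; exists s.
  (* The pointwise infimum of a chain is subadditive because of any two members one lies below the
     other. *)
  pose q x := inf [set sval s x | s in A].
  have lbA x : D x -> has_lbound [set sval s x | s in A].
    move=> Dx; exists (- p (- x)) => _ [s As <-]; have [ss sle _] := svalP s.
    have := sublinear_onN sD ss Dx; apply: le_trans; rewrite lerN2 sle//.
    exact: subspaceN.
  have q_le x s : D x -> A s -> q x <= sval s x.
    by move=> Dx As; apply: ge_inf; [exact: lbA|exists s].
  have le_q x b : (forall s, A s -> b <= sval s x) -> b <= q x.
    move=> h; apply: lb_le_inf; first by exists (sval a x); exists a.
    by move=> _ [s As <-]; exact: h.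
  have sq : sublinear_on D q.
    have pos b x : 0 <= b -> D x -> q (b *: x) <= b * q x.
      rewrite le_eqVlt => /predU1P[<- Dx|b0 Dx].
        rewrite mul0r scale0r; have := q_le 0 a sD.1 Aa.
        by have [sa _ _] := svalP a; rewrite (sublinear_on0 sD sa).
      rewrite -ler_pdivrMl//; apply: (le_q) => s As; rewrite ler_pdivrMl//.
      have [ss _ _] := svalP s; rewrite -(ss.2 _ _ (ltW b0) Dx).
      by apply: (q_le) => //; exact: subspaceZ.
    split.
      move=> x y Dx Dy; rewrite -lerBlDl; apply: (le_q) => s As.
      rewrite lerBlDr -lerBlDl; apply: (le_q) => t At; rewrite lerBlDl.
      have [[ss _ _] [st _ _]] := (svalP s, svalP t).
      have Dxy := subspaceD sD Dx Dy.
      have [/asboolP ts|/asboolP ts] := Atot s t As At.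
        rewrite (le_trans (q_le _ _ Dxy At))// (le_trans (st.1 _ _ Dx Dy))//.
        by rewrite addrC lerD2r ts.
      rewrite (le_trans (q_le _ _ Dxy As))// (le_trans (ss.1 _ _ Dx Dy))//.
      by rewrite addrC lerD2l ts.
    move=> b x; rewrite le_eqVlt => /predU1P[<- Dx|b0 Dx].
      apply/eqP; rewrite eq_le pos//= mul0r scale0r; apply: (le_q) => s As.
      by have [ss _ _] := svalP s; rewrite (sublinear_on0 sD ss).
    apply/eqP; rewrite eq_le (pos _ _ (ltW b0) Dx)/= mulrC -ler_pdivlMr// mulrC.
    have := pos b^-1 (b *: x); rewrite scalerA mulVf ?gt_eqF// scale1r invr_ge0.
    by apply; [exact: ltW|exact: subspaceZ].
  have qp x : D x -> q x <= p x.
    move=> Dx; apply: le_trans (q_le _ _ Dx Aa) _; have [_ h _] := svalP a; exact: h.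
  exists (exist _ _ (cutP _ sq qp)) => s As; apply/asboolP => x /=.
  have [Dx|Dx] := pselect (D x); first by rewrite cutE// q_le.
  by have [_ _ ->//] := svalP s; rewrite /cut; case: pselect.
have [sq qp q0] := svalP q.
exists (sval q); split=> // r sr rq x Dx.
have rp y : D y -> r y <= p y by move=> Dy; rewrite (le_trans (rq _ Dy))// qp.
have /qmax : S q (exist _ _ (cutP _ sr rp)).
  apply/asboolP => y /=; have [Dy|Dy] := pselect (D y); first by rewrite cutE// rq.
  by rewrite q0// /cut; case: pselect.
by move=> <- /=; rewrite cutE.
Qed.

(** A minimal sublinear functional below [cone_shift] is linear, and
    [l (- x) <= cone_shift (- x) <= - c x] is the lower bound on the cone. *)
Theorem mazur_orlicz D p G c : linear_subspace D -> sublinear_on D p -> G `<=` D ->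
  cone G -> cone_linear G c -> (forall x, G x -> c x <= p x) ->
  exists l, [/\ linear_on D l, forall x, D x -> l x <= p x & forall x, G x -> c x <= l x].
Proof.
move=> sD sp GD cG lc cp.
have [l [sl lp lmin]] := exists_minimal_sublinear sD (cone_shift_sublinear sD sp GD cG lc cp).
have ll := minimal_sublinear_linear sD sl lmin.
exists l; split=> // [x Dx|x Gx].
  exact: le_trans (lp _ Dx) (cone_shift_le_id sD sp GD cG lc cp Dx).
have Dx := GD _ Gx; have := lp _ (subspaceN sD Dx).
have := cone_shift_oppr sD sp GD cp Gx.
have := ll (-1) x 0 Dx sD.1; rewrite addr0 scaleN1r (sublinear_on0 sD sl); lra.
Qed.

End MazurOrlicz.

(** * Borel sets and regularity of finite measures *)

Section BorelSets.
Context {R : realType} {n : nat}.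
Local Notation V := 'rV[R]_n.
Local Notation B := (@Borel R n).
Implicit Types (A C U : set V).

Definition rat_ball (c : 'rV[rat]_n * nat) : set V :=
  ball (map_mx (@ratr R) c.1) (c.2.+1%:R^-1 : R).

(** A countable base indexed by [nat] through [unpickle]; numbers that encode no ball give the empty
    set. *)
Definition open_base (k : nat) : set V :=
  if choice.unpickle k is Some c then rat_ball c else set0.

Lemma open_base_open k : open (open_base k).
Proof.
rewrite /open_base; case: choice.unpickle => [c|]; last exact: open0.
by apply: ball_open; rewrite invr_gt0.
Qed.

Lemma open_baseP U x : open U -> U x -> exists k, open_base k x /\ open_base k `<=` U.
Proof.
move=> oU Ux; have /nbhs_ballP[e /= e0 eU] : nbhs x U by exact: open_nbhs_nbhs.
have [k ke] : exists k : nat, (k.+1%:R^-1 : R) < e / 2.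
  have /ltr_add_invr[k] : 0 < e / 2 by rewrite divr_gt0.
  by rewrite add0r => ?; exists k.
have k0 : 0 < (k.+1%:R^-1 : R) by rewrite invr_gt0.
have /choice[q qP] : forall i, exists q : rat, `|ratr q - x 0 i| < k.+1%:R^-1.
  move=> i.
  have xk : x 0 i < x 0 i + k.+1%:R^-1 by rewrite ltrDl.
  have [q] := rat_in_itvoo xk.
  rewrite in_itv/= => /andP[h1 h2]; exists q.
  by rewrite ltr_distl h2 andbT ltrBlDr (lt_trans h1)// ltrDl.
exists (choice.pickle (\row_i q i, k)); rewrite /open_base choice.pickleK /rat_ball /=.
split; first by split => // i j; rewrite !mxE ord1; exact: qP.
move=> y [_ yq]; apply: eU; split => // i j.
rewrite ord1; have := yq 0 j; have := qP j.
rewrite !mxE distrC -!ball_normE /= => h h'.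
rewrite -(subrKA (ratr (q j))); apply: le_lt_trans (ler_normD _ _) _.
by apply: lt_trans (ltrD h h') _; rewrite [ltRHS](splitr e) ltrD.
Qed.

Lemma open_bigcup_base U : open U -> U = \bigcup_(k in [set k | open_base k `<=` U]) open_base k.
Proof.
move=> oU; rewrite eqEsubset; split=> [x Ux|x [k /= kU /kU]//].
by have [k [kx kU]] := open_baseP oU Ux; exists k.
Qed.

Lemma borel_open U : open U -> measurable (U : set B).
Proof. by move=> oU; apply: sub_sigma_algebra. Qed.

Lemma borel_closed C : closed C -> measurable (C : set B).
Proof.
move=> cC; rewrite -[C]setCK; apply: measurableC; apply: borel_open.
exact: closed_openC.
Qed.

Lemma borel_compact C : compact C -> measurable (C : set B).
Proof. by move=> cC; apply: borel_closed; exact: (compact_closed (@norm_hausdorff _ _) cC). Qed.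

Lemma borel_eball x (r : R) : measurable (eball x r : set B).
Proof. by apply: borel_open; exact: eball_open. Qed.

Lemma borel_measurable_fun d (T : measurableType d) (D : set T) (h : T -> B) :
  (forall U, open U -> measurable (D `&` h @^-1` U)) -> measurable_fun D h.
Proof.
move=> hU; apply: (@measurability _ _ T B D h (@open V : set (set B))) => //.
by move=> _ [U oU <-]; exact: hU.
Qed.

Lemma continuous_borel (h : V -> R) : continuous h -> measurable_fun setT (h : B -> R).
Proof.
move=> ch; apply: (measurability _ (RGenOpens.measurableE R)).
move=> _ [_ [a [b ->] <-]]; rewrite setTI; apply: borel_open.
by apply: open_comp; [move=> x _; exact: ch|exact: interval_open].
Qed.

Lemma measurable_coord d (T : measurableType d) (D : set T) (f : T -> B) i :
  measurable_fun D f -> measurable_fun D (fun x => (f x : V) 0 i : R).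
Proof.
move=> mf; apply: (@measurableT_comp _ _ _ _ _ _ (fun v : B => (v : V) 0 i)) => //.
by apply: continuous_borel; exact: coord_continuous.
Qed.

Lemma measurable_enorm d (T : measurableType d) (D : set T) (f : T -> B) :
  measurable_fun D f -> measurable_fun D (fun x => enorm (f x : V) : R).
Proof.
move=> mf; apply: (@measurableT_comp _ _ _ _ _ _ (fun v : B => enorm (v : V))) => //.
by apply: continuous_borel; exact: enorm_continuous.
Qed.

(** Balls of the sup norm are products of intervals, so the preimage of a member of the base is a
    finite intersection of coordinate preimages; open sets follow by countable union. *)
Lemma measurable_row d (T : measurableType d) (D : set T) (f : T -> B) :
  (forall i, measurable_fun D (fun x => (f x : V) 0 i : R)) -> measurable_fun D f.
Proof.
move=> mf mD; apply: borel_measurable_fun => // U oU.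
rewrite (open_bigcup_base oU) preimage_bigcup setI_bigcupr.
apply: bigcup_measurable => k _; rewrite /open_base; case: choice.unpickle => [[q m]|]; last first.
  by rewrite preimage_set0 setI0.
rewrite /rat_ball /=.
set e := (m.+1%:R^-1 : R); set a := map_mx _ _.
have -> : D `&` f @^-1` (ball a e) =
    D `&` \bigcap_(i in [set: 'I_n]) (D `&` (fun x => (f x : V) 0 i) @^-1` (ball (a 0 i) e)).
  rewrite eqEsubset; split=> x [Dx h]; split=> //.
    by move=> i _; split => //; exact: h.2.
  by split; [rewrite /e|move=> i j; rewrite ord1; case: (h j I)].
apply: measurableI => //; apply: fin_bigcap_measurable => // i _.
by apply: mf => //; apply: open_measurable; apply: ball_open; rewrite /e.
Qed.

Lemma measurable_dotp d (T : measurableType d) (D : set T) (f g : T -> B) :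
  measurable_fun D f -> measurable_fun D g ->
  measurable_fun D (fun x => dotp (f x : V) (g x : V) : R).
Proof.
move=> mf mg; apply: measurable_sum => i; apply: measurable_funM; exact: measurable_coord.
Qed.

End BorelSets.

Section SmallSets.
Context d (T : measurableType d) (R : realType).
Variable nu : {measure set T -> \bar R}.
Implicit Types (F : nat -> set T).

Lemma nonincreasing_small F (e : R) : (nu setT < +oo)%E -> 0 < e ->
  (forall k, measurable (F k)) -> nonincreasing_seq F -> \bigcap_k F k = set0 ->
  exists k, (nu (F k) < e%:E)%E.
Proof.
move=> nuT e0 mF niF F0; apply: contrapT => /forallNP h.
have F0oo : (nu (F 0%N) < +oo)%E.
  by apply: le_lt_trans nuT; apply: le_measure; rewrite ?inE.
have mcap : measurable (\bigcap_k F k) by rewrite F0.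
have := nonincreasing_cvg_mu F0oo mF mcap niF; rewrite F0 measure0 => c0.
have : (e%:E <= lim (nu \o F @ \oo))%E.
  apply: lime_ge; first by apply/cvg_ex; exists 0%E.
  by apply: nearW => k /=; rewrite leNgt; apply/negP; exact: h.
by rewrite (cvg_lim _ c0)// lee_fin leNgt e0.
Qed.

Lemma bigcup_small F (e : R) : 0 <= e -> (forall k, measurable (F k)) ->
  (forall k, (nu (F k) <= (e / (2 ^ k.+1)%:R)%:E)%E) -> (nu (\bigcup_k F k) <= e%:E)%E.
Proof.
move=> e0 mF h; apply: le_trans (epsilon_trick0 xpredT e0).
apply: (@le_trans _ _ (\sum_(k <oo) nu (F k))%E); last exact: lee_nneseries.
by apply: measure_sigma_subadditive => //; exact: bigcup_measurable.
Qed.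

Lemma measure_setDU (A B C : set T) (a b : R) : measurable A -> measurable B ->
  measurable C -> (nu (A `\` B) < a%:E)%E -> (nu (B `\` C) < b%:E)%E ->
  (nu (A `\` C) < (a + b)%:E)%E.
Proof.
move=> mA mB mC ha hb.
apply: (@le_lt_trans _ _ (nu (A `\` B `|` B `\` C))).
  apply: le_measure; rewrite ?inE; try by apply: measurableU; exact: measurableD.
    exact: measurableD.
  by move=> x [Ax Cx]; have [Bx|Bx] := pselect (B x); [right|left].
apply: (@le_lt_trans _ _ (nu (A `\` B) + nu (B `\` C))%E).
  by apply: measureU2; exact: measurableD.
by rewrite EFinD lteD.
Qed.

End SmallSets.

Section ClosedIn.
Context {R : realType} {n : nat}.
Local Notation V := 'rV[R]_n.
Implicit Types U : set V.

(** The points whose sup-norm distance to the complement of [U] is at least [1 / (k + 1)]: closed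
    sets that increase to [U] when [U] is open. *)
Definition closed_in U (k : nat) : set V := ~` \bigcup_(y in ~` U) ball y (k.+1%:R^-1 : R).

Lemma closed_in_closed U k : closed (closed_in U k).
Proof. by apply: open_closedC; apply: bigcup_open => y _; apply: ball_open; rewrite invr_gt0. Qed.

Lemma closed_in_sub U k : closed_in U k `<=` U.
Proof.
move=> x /= h; apply: contrapT => Ux; apply: h; exists x => //.
by apply: ballxx; rewrite invr_gt0.
Qed.

Lemma closed_in_nd U k l : (k <= l)%N -> closed_in U k `<=` closed_in U l.
Proof.
move=> kl x h [y Uy yx]; apply: h; exists y => //.
by apply: le_ball yx; rewrite lef_pV2 ?posrE// ler_nat ltnS.
Qed.

Lemma closed_in_ex U x : open U -> U x -> exists k, closed_in U k x.
Proof.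
move=> oU Ux; have /nbhs_ballP[r /= r0 rU] : nbhs x U by exact: open_nbhs_nbhs.
have [k kr] : exists k : nat, (k.+1%:R^-1 : R) < r.
  by have /ltr_add_invr[k] := r0; rewrite add0r => ?; exists k.
exists k => -[y Uy yx]; apply: Uy; apply: rU.
by apply: ball_sym; apply: le_ball yx; exact: ltW.
Qed.

End ClosedIn.

Section Regularity.
Context {R : realType} {n : nat}.
Local Notation V := 'rV[R]_n.
Local Notation B := (@Borel R n).
Variable nu : {measure set B -> \bar R}.
Hypothesis nuT : (nu setT < +oo)%E.

Definition regular (A : set V) := forall e : R, 0 < e -> exists C U : set V,
  [/\ closed C, open U, C `<=` A, A `<=` U & (nu (U `\` C) < e%:E)%E].

Lemma open_regular U : open U -> regular U.
Proof.
move=> oU e e0.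
have [|||k] := @nonincreasing_small _ _ _ nu (fun k => U `\` closed_in U k) _ nuT e0.
- by move=> k; apply: measurableD; [exact: borel_open|apply: borel_closed; exact: closed_in_closed].
- by apply/nonincreasing_seqP => k; apply/subsetPset => x [Ux h]; split => // h'; apply: h; exact: (closed_in_nd (leqnSn k) h').
- rewrite -subset0 => x h.
  have Ux : U x by case: (h 0%N I).
  by have [k Ck] := closed_in_ex oU Ux; have [_] := h k I.
by exists (closed_in U k), U; split => //; [exact: closed_in_closed|exact: closed_in_sub].
Qed.

(** The sets squeezed between closed and open sets up to small measure form a sigma-algebra, and it
    contains the open sets by exhaustion with [closed_in]. *)
Lemma borel_regular A : measurable (A : set B) -> regular A.
Proof.
suff : (measurable : set (set B)) `<=` regular by apply.
apply: smallest_sub; last exact: open_regular.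
split.
- by move=> e e0; exists set0, set0; split; [exact: closed0|exact: open0|by []|by []|rewrite setD0 measure0 lte_fin].
- move=> C rC e e0; have [D [U [cD oU DC CU nUD]]] := rC e e0.
  exists (~` U), (~` D); split.
  + exact: open_closedC.
  + exact: closed_openC.
  + by rewrite setTD; exact: subsetC.
  + by rewrite setTD; exact: subsetC.
  + by rewrite setDE setCK setIC -setDE.
- move=> F rF e e0.
  have e4 k : 0 < e / 4 / (2 ^ k.+1)%:R by rewrite !divr_gt0// ltr0n expn_gt0.
  have /choice[D /choice[U DU]] : forall k, exists C, exists U : set V,
     [/\ closed C, open U, C `<=` F k, F k `<=` U & (nu (U `\` C) < (e / 4 / (2 ^ k.+1)%:R)%:E)%E].
    by move=> k; have [C [U ?]] := rF k _ (e4 k); exists C, U.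
  have mD k : measurable (D k : set B) by case: (DU k) => c _ _ _ _; exact: borel_closed.
  have mU k : measurable (U k : set B) by case: (DU k) => _ o _ _ _; exact: borel_open.
  (* An infinite union of closed sets need not be closed, so the inner set is a finite union, at a
     cost below [e / 2] by continuity from above. *)
  pose DN N := \bigcup_(k < N) D k.
  have mDN N : measurable (DN N : set B) by apply: bigcup_measurable.
  have mDoo : measurable (\bigcup_k D k : set B) by apply: bigcup_measurable.
  have [||||N nN] := @nonincreasing_small _ _ _ nu (fun N => (\bigcup_k D k) `\` DN N) (e / 2) nuT.
  + by rewrite divr_gt0.
  + by move=> N; apply: measurableD.
  + apply/nonincreasing_seqP => N; apply/subsetPset => x [Dx h]; split => // -[k kN Dk].
    by apply: h; exists k => //=; exact: ltnW.
  + rewrite -subset0 => x h; have [[k _ Dk] _] := h 0%N I.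
    by have [_] := h k.+1 I; apply; exists k => /=.
  exists (DN N), (\bigcup_k U k); split.
  + rewrite /DN bigcup_mkord; apply: closed_bigsetU => k _; by case: (DU k).
  + by apply: bigcup_open => k _; case: (DU k).
  + by move=> x [k _ Dk]; exists k => //; case: (DU k) => _ _ + _ _; apply.
  + by move=> x [k _ Fk]; exists k => //; case: (DU k) => _ _ _ + _; apply.
  rewrite (splitr e); apply: (@measure_setDU _ _ _ nu _ (\bigcup_k D k)) => //.
    by apply: bigcup_measurable.
  apply: (@le_lt_trans _ _ (e / 4)%:E); last by rewrite lte_fin; lra.
  apply: (@le_trans _ _ (nu (\bigcup_k (U k `\` D k)))).
    apply: le_measure; rewrite ?inE.
    - by apply: measurableD => //; exact: bigcup_measurable.
    - by apply: bigcup_measurable => k _; exact: measurableD.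
    - by move=> x [[k _ Uk] Dx]; exists k => //; split => // Dk; apply: Dx; exists k.
  apply: bigcup_small; first by rewrite divr_ge0// ltW.
    by move=> k; exact: measurableD.
  by move=> k; apply: ltW; case: (DU k).
Qed.

End Regularity.

(** * Compactly supported functions and the Lusin property *)

Section CompactSupport.
Context {R : realType} {n : nat}.
Local Notation V := 'rV[R]_n.
Local Notation B := (@Borel R n).
Implicit Types (w h : V -> R) (x : V).

Definition Cc (w : V -> R) := continuous w /\ exists K, compact K /\ forall x, ~ K x -> w x = 0.

Definition Ccv (v : V -> V) := forall i, Cc (fun x => v x 0 i).

Lemma Cc_measurable w : Cc w -> measurable_fun setT (w : B -> R).
Proof. by move=> [cw _]; exact: continuous_borel. Qed.

Lemma Ccv_measurable v : Ccv v -> measurable_fun setT (v : B -> B).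
Proof. by move=> cv; apply: measurable_row => i; exact: (Cc_measurable (cv i)). Qed.

Lemma Cc_comb a b w1 w2 : Cc w1 -> Cc w2 -> Cc (fun x => a * w1 x + b * w2 x).
Proof.
move=> [c1 [K1 [cK1 K10]]] [c2 [K2 [cK2 K20]]]; split.
  move=> x; apply: (@continuousD R R^o V); apply: continuousM; try exact: cst_continuous.
    exact: c1.
  exact: c2.
exists (K1 `|` K2); split; first exact: compactU.
by move=> x /not_orP[h1 h2]; rewrite K10// K20// !mulr0 addr0.
Qed.

Lemma Cc_mul w h : Cc w -> continuous h -> Cc (fun x => w x * h x).
Proof.
move=> [cw [K [cK K0]]] ch; split.
  by move=> x; apply: continuousM; [exact: cw|exact: ch].
by exists K; split => // x Kx; rewrite K0// mul0r.
Qed.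

Lemma Cc_scale a w : Cc w -> Cc (fun x => a * w x).
Proof.
move=> cw; have := Cc_comb a 0 cw cw.
by under eq_fun do rewrite mul0r addr0.
Qed.

Lemma Cc_add w1 w2 : Cc w1 -> Cc w2 -> Cc (fun x => w1 x + w2 x).
Proof.
move=> c1 c2; have := Cc_comb 1 1 c1 c2.
by under eq_fun do rewrite !mul1r.
Qed.

Lemma Cc_sub w1 w2 : Cc w1 -> Cc w2 -> Cc (fun x => w1 x - w2 x).
Proof.
move=> c1 c2; have := Cc_comb 1 (-1) c1 c2.
by under eq_fun do rewrite mul1r mulN1r.
Qed.

Lemma Cc0 : Cc (fun=> 0).
Proof. by split; [exact: cst_continuous|exists set0; split => //; exact: compact0]. Qed.

Lemma Cc_sum (I : Type) (r : seq I) (w : I -> V -> R) :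
  (forall i, Cc (w i)) -> Cc (fun x => \sum_(i <- r) w i x).
Proof.
move=> cw; elim: r => [|i r IH].
  by under eq_fun do rewrite big_nil; exact: Cc0.
by under eq_fun do rewrite big_cons; exact: Cc_add.
Qed.

Lemma continuous_bigsum (I : Type) (r : seq I) (w : I -> V -> R) :
  (forall i, continuous (w i)) -> continuous (fun x => \sum_(i <- r) w i x).
Proof.
move=> cw; elim: r => [|i r IH].
  by rewrite (_ : (fun x => _) = fun=> 0); [exact: cst_continuous|apply/funext => x; rewrite big_nil].
rewrite (_ : (fun x => _) = fun x => w i x + \sum_(i <- r) w i x); last first.
  by apply/funext => x; rewrite big_cons.
by move=> x; apply: (@continuousD R R^o V); [exact: cw|exact: IH].
Qed.

Lemma Cc_min w1 w2 : Cc w1 -> continuous w2 -> (forall x, 0 <= w1 x) -> (forall x, 0 <= w2 x) ->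
  Cc (fun x => Num.min (w1 x) (w2 x)).
Proof.
move=> [c1 [K [cK K0]]] c2 p1 p2; split.
  by move=> x; apply: continuous_min; [exact: c1|exact: c2].
by exists K; split => // x Kx; rewrite K0//; apply/min_idPl.
Qed.

Lemma Cc_bounded w : Cc w -> exists M, 0 < M /\ forall x, `|w x| <= M.
Proof.
move=> [cw [K [cK K0]]].
have /compact_bounded[M [_ hM]] : compact (w @` K).
  by apply: continuous_compact => //; exact: continuous_subspaceT.
exists (`|M| + 1); split; first by rewrite ltr_wpDl.
have h : M < `|M| + 1 by rewrite (le_lt_trans (ler_norm _))// ltrDl.
move=> x; have [Kx|Kx] := pselect (K x); first by apply: hM => //; exists x.
by rewrite K0// normr0 addr_ge0.
Qed.

Lemma cutoff (K U : set V) : compact K -> open U -> K `<=` U ->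
  exists c : V -> R, [/\ Cc c, forall x, 0 <= c x <= 1, forall x, K x -> c x = 1 &
    forall x, ~ U x -> c x = 0].
Proof.
move=> cK oU KU.
have [r rK] : exists r : R, forall x, K x -> enorm (x - 0) < r.
  have [M [_ hM]] := compact_bounded cK.
  exists (n%:R * (`|M| + 1) + 1) => x Kx; rewrite subr0.
  apply: (@le_lt_trans _ _ (n%:R * (`|M| + 1))); last by rewrite ltrDl.
  apply: le_trans (enorm_le_norm _) _; rewrite ler_wpM2l// hM//.
  by rewrite (le_lt_trans (ler_norm _))// ltrDl.
(* Cutting [U] with a ball around [K] makes the support of the Urysohn function compact. *)
pose W := U `&` eball 0 r.
have oW : open W by apply: openI => //; exact: eball_open.
have KW : K `<=` W by move=> x Kx; split; [exact: KU|exact: rK].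
have [||||c [cc c0 c1 c01]] := @urysohn_ext_itv V R (@pseudometric_normal R V) (~` W) K 0 1.
- exact: open_closedC.
- by apply: compact_closed => //; exact: norm_hausdorff.
- by rewrite -subset0 => x [Wx /KW].
- exact: ltr01.
have c0' x : ~ W x -> c x = 0 by move=> Wx; apply: c0; exists x.
exists c; split.
- split => //; exists [set y | enorm (y - 0) <= r]; split; first exact: closed_eball_compact.
  by move=> x /= xr; apply: c0' => -[_]; rewrite /eball/= => /ltW.
- by move=> x; have : `[0, 1]%classic (c x) by apply: c01; exists x.
- by move=> x Kx; apply: c1; exists x.
- by move=> x Ux; apply: c0' => -[].
Qed.

Lemma extend_Cc (K : set V) (f : V -> R) M : compact K -> 0 < M ->
  {within K, continuous f} -> (forall x, K x -> `|f x| <= M) ->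
  exists w, [/\ Cc w, forall x, K x -> w x = f x & forall x, `|w x| <= M].
Proof.
move=> cK M0 cf fM.
have clK : closed K by apply: compact_closed => //; exact: norm_hausdorff.
have [g [gf cg gM]] := continuous_bounded_extension (@pseudometric_normal R V) clK M0 cf fM.
have [c [cc c01 c1 _]] := cutoff cK openT (subsetT K).
exists (fun x => c x * g x); split.
- exact: Cc_mul.
- by move=> x Kx; rewrite c1// mul1r -gf// inE.
- move=> x; rewrite normrM; have /andP[h0 h1] := c01 x.
  by rewrite (ger0_norm h0) -[leRHS]mul1r ler_pM.
Qed.

End CompactSupport.

Section Lusin.
Context {R : realType} {n : nat}.
Local Notation V := 'rV[R]_n.
Local Notation B := (@Borel R n).
Variable nu : {measure set B -> \bar R}.
Hypothesis nuT : (nu setT < +oo)%E.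

Lemma inner_compact (A : set V) (e : R) : measurable (A : set B) -> 0 < e ->
  exists K : set V, [/\ compact K, K `<=` A & (nu (A `\` K) < e%:E)%E].
Proof.
move=> mA e0; have e2 : 0 < e / 2 by rewrite divr_gt0.
have [C [U [cC oU CA AU nUC]]] := borel_regular nuT mA e2.
pose D k := [set y : V | enorm (y - 0) <= k%:R].
have mD k : measurable (D k : set B) by apply: borel_closed; exact: closed_eball_closed.
have [|||k nk] := @nonincreasing_small _ _ _ nu (fun k => ~` D k) _ nuT e2.
- by move=> k; exact: measurableC.
- apply/nonincreasing_seqP => k; apply/subsetPset => x h Dk; apply: h.
  by rewrite /D/= in Dk *; rewrite (le_trans Dk)// ler_nat.
- rewrite -subset0 => x h; apply: (h (Num.truncn (enorm (x - 0))).+1 I).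
  by rewrite /D/=; apply/ltW/truncnS_gt.
exists (C `&` D k); split.
- by rewrite setIC; apply: compact_closedI => //; exact: closed_eball_compact.
- by move=> x [/CA].
- rewrite (splitr e); have mC := borel_closed cC.
  apply: (@measure_setDU _ _ _ nu _ C) => //; first exact: measurableI.
    apply: le_lt_trans nUC; apply: le_measure; rewrite ?inE.
    + exact: measurableD.
    + by apply: measurableD => //; exact: borel_open.
    + by move=> x [/AU].
  apply: le_lt_trans nk; apply: le_measure; rewrite ?inE.
  + by apply: measurableD => //; exact: measurableI.
  + exact: measurableC.
  + by move=> x [Cx h] Dx; apply: h.
Qed.

(** Each preimage of a base set is squeezed as [C k <= A k <= U k]. Once all differences [U k - C k]
    are removed, [A k] and the open set [U k] have the same trace on the rest, so preimages of base
    sets are relatively open there. *)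
Lemma lusin_borel (D : set V) (f : V -> V) (e : R) : measurable (D : set B) ->
  measurable_fun (D : set B) (f : B -> B) -> 0 < e ->
  exists K : set V, [/\ compact K, K `<=` D, (nu (D `\` K) < e%:E)%E & {within K, continuous f}].
Proof.
move=> mD mf e0.
have e4 k : 0 < e / 4 / (2 ^ k.+1)%:R by rewrite !divr_gt0// ltr0n expn_gt0.
pose A k : set V := D `&` f @^-1` (open_base k).
have mA k : measurable (A k : set B) by apply: mf => //; apply: borel_open; exact: open_base_open.
have /choice[C /choice[U CU]] : forall k, exists C, exists U : set V,
     [/\ closed C, open U, C `<=` A k, A k `<=` U & (nu (U `\` C) < (e / 4 / (2 ^ k.+1)%:R)%:E)%E].
  by move=> k; have [C [U ?]] := borel_regular nuT (mA k) (e4 k); exists C, U.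
have mUC k : measurable (U k `\` C k : set B).
  by case: (CU k) => c o _ _ _; apply: measurableD; [exact: borel_open|exact: borel_closed].
pose G := \bigcup_k (U k `\` C k).
have mG : measurable (G : set B) by apply: bigcup_measurable.
have nG : (nu G <= (e / 4)%:E)%E.
  apply: bigcup_small => //; first by rewrite divr_ge0// ltW.
  by move=> k; apply: ltW; case: (CU k).
have e2 : 0 < e / 2 by rewrite divr_gt0.
have mDG : measurable (D `\` G : set B) by exact: measurableD.
have [K [cK KDG nK]] := inner_compact mDG e2.
exists K; split => //; first by move=> x /KDG[].
  rewrite (splitr e); apply: (@measure_setDU _ _ _ nu _ (D `\` G)) => //.
    exact: borel_compact.
  apply: (@le_lt_trans _ _ (e / 4)%:E); last by rewrite lte_fin; lra.
  apply: le_trans nG; apply: le_measure; rewrite ?inE//; first exact: measurableD.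
  by move=> x [Dx h]; apply: contrapT => Gx; apply: h.
apply/subspace_continuousP => x Kx W /nbhs_interior; rewrite nbhsE => -[W' [oO Ox] OW].
have [k [kx kO]] := open_baseP oO Ox.
have [cC oU CA AU _] := CU k; have [Dx Gx] := KDG _ Kx.
have Ux : U k x by apply: AU.
change (nbhs x (fun y => K y -> W (f y))).
apply: filterS (open_nbhs_nbhs (conj oU Ux)) => y Uy Ky.
have [Dy Gy] := KDG _ Ky.
have Cy : C k y by apply: contrapT => Cy; apply: Gy; exists k.
by apply: interior_subset; apply: OW; apply: kO; have [] := CA _ Cy.
Qed.

(** The extension is done one coordinate at a time, hence the bound that survives is the one on
    coordinates. *)
Lemma lusin_Ccv (D : set V) (f : V -> V) (M e : R) : measurable (D : set B) ->
  measurable_fun (D : set B) (f : B -> B) -> 0 < M -> 0 < e ->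
  (forall x i, D x -> `|f x 0 i| <= M) ->
  exists K v, [/\ compact K /\ K `<=` D, (nu (D `\` K) < e%:E)%E, Ccv v,
    forall x, K x -> v x = f x & forall x i, `|v x 0 i| <= M].
Proof.
move=> mD mf M0 e0 fM.
have [K [cK KD nK cf]] := lusin_borel mD mf e0.
have /choice[w wP] : forall i, exists w : V -> R,
    [/\ Cc w, forall x, K x -> w x = f x 0 i & forall x, `|w x| <= M].
  move=> i; apply: extend_Cc => //; last by move=> x /KD Dx; exact: fM.
  apply/subspace_continuousP => x Kx; move/subspace_continuousP : cf => /(_ x Kx) cf.
  by apply: (cvg_comp _ (fun v : V => v 0 i) cf); exact: coord_continuous.
exists K, (fun x => \row_i w i x); split => //.
- by move=> i; under eq_fun do rewrite mxE; case: (wP i).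
- by move=> x Kx; apply/rowP => i; rewrite mxE; case: (wP i) => _ -> //.
- by move=> x i; rewrite mxE; case: (wP i).
Qed.

End Lusin.

(** * The Riesz representation theorem for scalar functionals *)

Section FiniteMeasure.
Context d (T : measurableType d) (R : realType).
Variable nu : {measure set T -> \bar R}.
Hypothesis nuT : (nu setT < +oo)%E.

Lemma finite_measure_lty (A : set T) : measurable A -> (nu A < +oo)%E.
Proof. by move=> mA; apply: le_lt_trans nuT; apply: le_measure; rewrite ?inE. Qed.

Lemma finite_measure_fin (A : set T) : measurable A -> nu A \is a fin_num.
Proof. by move=> mA; rewrite ge0_fin_numE// finite_measure_lty. Qed.

Lemma bounded_integrable (D : set T) (f : T -> R) M : measurable D -> measurable_fun D f ->
  (forall x, D x -> `|f x| <= M) -> nu.-integrable D (EFin \o f).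
Proof.
move=> mD mf fM; apply: measurable_bounded_integrable => //.
  exact: finite_measure_lty.
exists M; split; first exact: num_real.
by move=> a Ma x Dx; apply: le_trans (ltW Ma); exact: fM.
Qed.

End FiniteMeasure.

Section Riesz.
Context {R : realType} {n : nat}.
Local Notation V := 'rV[R]_n.
Local Notation B := (@Borel R n).
Variable L : (V -> R) -> R.
Hypothesis L_lin : forall a b w1 w2, Cc w1 -> Cc w2 ->
  L (fun x => a * w1 x + b * w2 x) = a * L w1 + b * L w2.
Hypothesis L_pos : forall w, Cc w -> (forall x, 0 <= w x) -> 0 <= L w.
Variable c : R.
Hypothesis L_mass : forall w, Cc w -> (forall x, w x <= 1) -> L w <= c.
Implicit Types (w v : V -> R) (h : nat -> V -> R) (A : set V).

Lemma functionalD w1 w2 : Cc w1 -> Cc w2 -> L (fun x => w1 x + w2 x) = L w1 + L w2.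
Proof.
move=> c1 c2; have := L_lin 1 1 c1 c2; rewrite !mul1r => <-.
by congr L; apply/funext => x; rewrite !mul1r.
Qed.

Lemma functionalB w1 w2 : Cc w1 -> Cc w2 -> L (fun x => w1 x - w2 x) = L w1 - L w2.
Proof.
move=> c1 c2; have := L_lin 1 (-1) c1 c2; rewrite mul1r mulN1r => <-.
by congr L; apply/funext => x; rewrite mul1r mulN1r.
Qed.

Lemma functionalZ a w : Cc w -> L (fun x => a * w x) = a * L w.
Proof.
move=> cw; have := L_lin a 0 cw cw; rewrite mul0r addr0 => <-.
by congr L; apply/funext => x; rewrite mul0r addr0.
Qed.

Lemma functional0 : L (fun=> 0) = 0.
Proof.
rewrite -[RHS](mul0r (L (fun=> 0))) -functionalZ; last exact: Cc0.
by congr L; apply/funext => x; rewrite mul0r.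
Qed.

Lemma functional_le w1 w2 : Cc w1 -> Cc w2 -> (forall x, w1 x <= w2 x) -> L w1 <= L w2.
Proof.
move=> c1 c2 h; rewrite -subr_ge0 -functionalB//; apply: L_pos; first exact: Cc_sub.
by move=> x; rewrite subr_ge0.
Qed.

Lemma functional_sum (I : Type) (r : seq I) (w : I -> V -> R) : (forall i, Cc (w i)) ->
  L (fun x => \sum_(i <- r) w i x) = \sum_(i <- r) L (w i).
Proof.
move=> cw; elim: r => [|i r IH].
  by rewrite [RHS]big_nil -[RHS]functional0; congr L; apply/funext => x; rewrite big_nil.
rewrite big_cons -IH -functionalD//; last exact: Cc_sum.
by congr L; apply/funext => x; rewrite big_cons.
Qed.

(** An increasing sequence stands for its lower semicontinuous supremum, which majorizes the
    indicator of [A]; [riesz_cost] is then Daniell's upper integral of that supremum. Working with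
    sequences avoids separate definitions for open and for general sets. *)
Definition riesz_cover A : set (nat -> V -> R) := [set h | [/\ forall k, Cc (h k),
  forall k x, 0 <= h k x, forall k x, h k x <= h k.+1 x & forall x, A x -> exists k, 1 <= h k x]].

Definition riesz_cost h : \bar R := ereal_sup (range (fun k => (L (h k))%:E)).

Definition riesz_outer A : \bar R := ereal_inf (riesz_cost @` riesz_cover A).

Lemma riesz_cover_nd A h k l x : riesz_cover A h -> (k <= l)%N -> h k x <= h l x.
Proof.
move=> [_ _ nd _]; elim: l => [|l IH]; first by rewrite leqn0 => /eqP ->.
by rewrite leq_eqVlt => /predU1P[->//|/IH]; move/le_trans; apply.
Qed.

Lemma riesz_cost_ge0 A h : riesz_cover A h -> (0 <= riesz_cost h)%E.
Proof.
move=> [ch h0 _ _]; apply: (@le_trans _ _ (L (h 0%N))%:E).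
  by rewrite lee_fin L_pos.
by apply: ereal_sup_ubound; exists 0%N.
Qed.

Lemma riesz_outer_ge0 A : (0 <= riesz_outer A)%E.
Proof. by apply: le_ereal_inf_tmp => _ [h Ah <-]; exact: riesz_cost_ge0 Ah. Qed.

Lemma riesz_outer_le A h : riesz_cover A h -> (riesz_outer A <= riesz_cost h)%E.
Proof. by move=> Ah; apply: ereal_inf_lbound; exists h. Qed.

Lemma riesz_outer_le1 A w : Cc w -> (forall x, 0 <= w x) -> (forall x, A x -> 1 <= w x) ->
  (riesz_outer A <= (L w)%:E)%E.
Proof.
move=> cw w0 w1; apply: (@le_trans _ _ (riesz_cost (fun=> w))).
  by apply: riesz_outer_le; split => // x Ax; exists 0%N; exact: w1.
by apply: ge_ereal_sup => _ [k _ <-].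
Qed.

Lemma riesz_outer0 : riesz_outer set0 = 0%E.
Proof.
apply/eqP; rewrite eq_le riesz_outer_ge0 andbT.
by have := @riesz_outer_le1 set0 (fun=> 0) Cc0; rewrite functional0; apply.
Qed.

Lemma riesz_outer_mono : {homo riesz_outer : X Y / X `<=` Y >-> (X <= Y)%E}.
Proof.
move=> X Y XY; apply/ereal_inf_le_tmp => _ [h [ch h0 hn h1] <-].
by exists h => //; split => // x /XY; exact: h1.
Qed.

Lemma riesz_adherent A (e : R) : (riesz_outer A < +oo)%E -> 0 < e ->
  exists h, riesz_cover A h /\ (riesz_cost h <= riesz_outer A + e%:E)%E.
Proof.
move=> Aoo e0; have fA : riesz_outer A \is a fin_num.
  by rewrite ge0_fin_numE// riesz_outer_ge0.
have [_ [h Ah <-] /ltW hA] := lb_ereal_inf_adherent e0 fA.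
by exists h.
Qed.

Lemma riesz_outer_sub : sigma_subadditive riesz_outer.
Proof.
move=> F; have [[i ioo]|] := pselect (exists i, riesz_outer (F i) = +oo%E).
  rewrite (eseries_pinfty _ _ ioo) ?leey// => k _.
  by rewrite gt_eqF// (lt_le_trans _ (riesz_outer_ge0 _)).
rewrite -forallNE => Foo; apply/lee_addgt0Pr => e e0.
have e2 k : 0 < e / (2 ^ k.+1)%:R by rewrite divr_gt0// ltr0n expn_gt0.
have /choice[H HP] : forall i, exists h, riesz_cover (F i) h /\
    (riesz_cost h <= riesz_outer (F i) + (e / (2 ^ i.+1)%:R)%:E)%E.
  by move=> i; apply: riesz_adherent => //; rewrite ltey; apply/eqP.
apply: le_trans (epsilon_trick xpredT (fun i => riesz_outer_ge0 (F i)) (ltW e0)).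
(* Diagonal sum: the [k]-th term uses the first [k + 1] covers at stage [k], so it stays a finite
   sum and increases with [k]. *)
pose h k x := \sum_(i < k.+1) H i k x.
have Hc i k : Cc (H i k) by case: (HP i) => -[].
have H0 i k x : 0 <= H i k x by case: (HP i) => -[].
have ch : riesz_cover (\bigcup_k F k) h.
  split.
  - by move=> k; exact: Cc_sum.
  - by move=> k x; exact: sumr_ge0.
  - move=> k x; rewrite /h [leRHS]big_ord_recr/= -[leLHS]addr0 lerD//.
    by apply: ler_sum => i _; case: (HP i) => -[].
  - move=> x [i _ Fx]; have [hi _] := HP i; have [_ _ _ /(_ x Fx)[k k1]] := hi.
    exists (maxn i k); rewrite /h.
    have im : (i < (maxn i k).+1)%N by rewrite ltnS leq_maxl.
    rewrite (bigD1 (Ordinal im))//= -[leLHS]addr0 lerD ?sumr_ge0//.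
    by rewrite (le_trans k1)// (riesz_cover_nd _ hi)// leq_maxr.
apply: (le_trans (riesz_outer_le ch)); apply: ge_ereal_sup => _ [k _ <-].
rewrite functional_sum// -sumEFin.
apply: (@le_trans _ _ (\sum_(i < k.+1) (riesz_outer (F i) + (e / (2 ^ i.+1)%:R)%:E))%E).
  apply: lee_sum => i _; apply: le_trans (HP i).2.
  by apply: ereal_sup_ubound; exists k.
rewrite -(big_mkord xpredT (fun i => riesz_outer (F i) + (e / (2 ^ i.+1)%:R)%:E)%E).
by apply: nneseries_lim_ge => i _; rewrite adde_ge0 ?riesz_outer_ge0// lee_fin ltW.
Qed.

HB.instance Definition _ := isOuterMeasure.Build R V riesz_outer riesz_outer0
  riesz_outer_ge0 riesz_outer_mono riesz_outer_sub.

(** Increasing continuous approximations of the indicator of [U]; multiplication by [v k] and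
    [1 - v k] splits a cover along [U]. *)
Lemma open_exhaust (U : set V) : open U -> exists v : nat -> V -> R,
  [/\ forall k, continuous (v k), forall k x, 0 <= v k x <= 1, forall k x, v k x <= v k.+1 x,
    forall k x, ~ U x -> v k x = 0 & forall x, U x -> exists k, v k x = 1].
Proof.
move=> oU.
have /choice[u uP] : forall k, exists u : V -> R, [/\ continuous u, forall x, 0 <= u x <= 1,
    forall x, closed_in U k x -> u x = 1 & forall x, ~ U x -> u x = 0].
  move=> k; have [||||u [cu u0 u1 u01]] :=
    @urysohn_ext_itv V R (@pseudometric_normal R V) (~` U) (closed_in U k) 0 1.
  - exact: open_closedC.
  - exact: closed_in_closed.
  - by rewrite -subset0 => x [Ux /closed_in_sub].
  - exact: ltr01.
  exists u; split => //.
  - by move=> x; have : `[0, 1]%classic (u x) by apply: u01; exists x.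
  - by move=> x Kx; apply: u1; exists x.
  - by move=> x Ux; apply: u0; exists x.
have u0 i x : 0 <= u i x by case: (uP i) => _ /(_ x)/andP[].
pose s k x := \sum_(i < k) u i x.
have s0 k x : 0 <= s k x by exact: sumr_ge0.
exists (fun k x => Num.min 1 (s k x)); split.
- move=> k x; apply: continuous_min; first exact: cst_continuous.
  by apply: continuous_bigsum => i; case: (uP i).
- by move=> k x; rewrite le_min ler01 s0 ge_min lexx.
- move=> k x; rewrite le_min !ge_min lexx/=; apply/orP; right.
  by rewrite /s big_ord_recr/= lerDl.
- move=> k x Ux; rewrite /s big1 => [|i _]; last by case: (uP i) => _ _ _; apply.
  by apply/min_idPr.
- move=> x Ux; have [k Ck] := closed_in_ex oU Ux; exists k.+1.
  apply/min_idPl; rewrite /s big_ord_recr/=; case: (uP k) => _ _ -> // _.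
  by rewrite lerDr sumr_ge0.
Qed.

(** Given a cover [h] of [A], the products [h k * v k] cover the part in [U], and for each fixed [j]
    the products [h k * (1 - v j)] cover the part outside. Choosing [j = k] makes two such products
    sum to at most a single [h], so the two costs add up to at most the cost of [h]. *)
Lemma riesz_outer_open (U : set V) : open U -> riesz_outer.-caratheodory U.
Proof.
move=> oU; apply: le_caratheodory_measurable => A.
have [Aoo|] := eqVneq (riesz_outer A) +oo%E.
  by apply: (@le_trans _ _ +oo%E); rewrite ?leey// -Aoo.
rewrite -ltey => Aoo; apply/lee_addgt0Pr => e e0.
have [h [hA]] := riesz_adherent Aoo e0; apply: le_trans.
have [v [cv v01 vn v0 v1]] := open_exhaust oU.
have v_nd k l x : (k <= l)%N -> v k x <= v l x.
  elim: l => [|l IH]; first by rewrite leqn0 => /eqP ->.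
  by rewrite leq_eqVlt => /predU1P[->//|/IH]; move/le_trans; apply.
have [ch h0 hn h1] := hA.
have vpos k x : 0 <= v k x by case/andP: (v01 k x).
have vpos' k x : 0 <= 1 - v k x by rewrite subr_ge0; case/andP: (v01 k x).
have cv' k : continuous (fun x => 1 - v k x).
  by move=> x; apply: (@continuousB R R^o V); [exact: cst_continuous|exact: cv].
have C1 : riesz_cover (A `&` U) (fun k x => h k x * v k x).
  split.
  - by move=> k; exact: Cc_mul.
  - by move=> k x; exact: mulr_ge0.
  - by move=> k x; rewrite ler_pM.
  - move=> x [Ax Ux]; have [k hk] := h1 x Ax; have [l vl] := v1 x Ux.
    exists (maxn k l); rewrite -[leLHS]mul1r ler_pM//.
      by rewrite (le_trans hk)// (riesz_cover_nd _ hA)// leq_maxl.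
    by rewrite -vl v_nd// leq_maxr.
have C2 j : riesz_cover (A `&` ~` U) (fun k x => h k x * (1 - v j x)).
  split.
  - by move=> k; exact: Cc_mul.
  - by move=> k x; exact: mulr_ge0.
  - by move=> k x; rewrite ler_wpM2r.
  - move=> x [Ax Ux]; have [k hk] := h1 x Ax; exists k.
    by rewrite v0// subr0 mulr1.
apply: (@le_trans _ _ (riesz_cost (fun k x => (h k x * v k x)%R) + riesz_outer (A `&` ~` U))%E).
  by rewrite leeD2r// riesz_outer_le.
have [I0 I0'] := (riesz_outer_ge0 (A `&` ~` U), riesz_cost_ge0 C1).
have Uoo : riesz_outer (A `&` ~` U) \is a fin_num.
  by rewrite ge0_fin_numE// (le_lt_trans _ Aoo)//; exact: riesz_outer_mono.
rewrite -leeBrDr//; apply: ge_ereal_sup => _ [k _ <-].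
rewrite leeBrDr// addeC -leeBrDr//; apply: (le_trans (riesz_outer_le (C2 k))).
apply: ge_ereal_sup => _ [l _ <-]; rewrite leeBrDr// -EFinD.
apply: (@le_trans _ _ (L (h (maxn l k)))%:E); last first.
  by apply: ereal_sup_ubound; exists (maxn l k).
rewrite lee_fin -functionalD; [|exact: Cc_mul|exact: Cc_mul].
apply: functional_le => //; first by apply: Cc_add; exact: Cc_mul.
move=> x; set H := h (maxn l k) x.
have hl : h l x <= H by apply: (riesz_cover_nd _ hA); rewrite leq_maxl.
have hk : h k x <= H by apply: (riesz_cover_nd _ hA); rewrite leq_maxr.
apply: (@le_trans _ _ (H * (1 - v k x) + H * v k x)); last by rewrite -mulrDr subrK mulr1.
by rewrite lerD// ler_wpM2r.
Qed.

Lemma riesz_outer_borel (A : set B) : measurable A -> riesz_outer.-caratheodory A.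
Proof.
suff : (measurable : set (set B)) `<=` riesz_outer.-caratheodory by apply.
apply: smallest_sub; last exact: riesz_outer_open.
split.
- exact: caratheodory_measurable_set0.
- by move=> D mD; rewrite setTD; exact: caratheodory_measurable_setC.
- by move=> F mF; exact: caratheodory_measurable_bigcup.
Qed.

Definition riesz_measure (A : set B) : \bar R := riesz_outer A.

Lemma riesz_measure_additive : semi_sigma_additive riesz_measure.
Proof.
move=> F mF tF mU.
by apply: (@caratheodory_measure_sigma_additive R V riesz_outer F) => // [i|]; exact: riesz_outer_borel.
Qed.

HB.instance Definition _ := isMeasure.Build _ B R riesz_measure riesz_outer0
  riesz_outer_ge0 riesz_measure_additive.

Let nu : {measure set B -> \bar R} := riesz_measure.

Lemma riesz_mass_lty : (nu setT < +oo)%E.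
Proof.
have /choice[u uP] : forall k : nat, exists u : V -> R, [/\ Cc u, forall x, 0 <= u x <= 1,
    forall x, [set y | enorm (y - 0) <= k%:R] x -> u x = 1 & forall x, ~ [set: V] x -> u x = 0].
  by move=> k; apply: cutoff => //; [exact: closed_eball_compact|exact: openT].
have u0 i x : 0 <= u i x by case: (uP i) => _ /(_ x)/andP[].
have s0 k x : 0 <= \sum_(i < k) u i x by exact: sumr_ge0.
pose h k x := Num.min (\sum_(i < k) u i x) 1.
have hc k : Cc (h k).
  by apply: Cc_min => //; [apply: Cc_sum => i; case: (uP i)|exact: cst_continuous].
apply: (@le_lt_trans _ _ c%:E); last exact: ltry.
apply: (@le_trans _ _ (riesz_cost h)).
  apply: riesz_outer_le; split => //.
  - by move=> k x; rewrite le_min s0 ler01.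
  - by move=> k x; rewrite le_min !ge_min lexx orbT andbT big_ord_recr/= lerDl u0.
  (* The ball of radius [truncn |x| + 1] contains [x], and the sum over [i < k] includes this index
     from [k = truncn |x| + 2] on. *)
  - move=> x _; exists (Num.truncn (enorm (x - 0))).+2.
    rewrite le_min lexx andbT big_ord_recr/=; case: (uP (Num.truncn (enorm (x - 0))).+1) => _ _ -> //=.
      by rewrite lerDr sumr_ge0.
    exact/ltW/truncnS_gt.
apply: ge_ereal_sup => _ [k _ <-]; rewrite lee_fin; apply: L_mass => // x.
by rewrite ge_min lexx orbT.
Qed.

(** A Dini argument: any cover of the whole space exceeds [1 - a] on the compact support of [w] from
    one index on, so its cost is at least [(1 - a) * L w]. The choice of [a] makes the loss at most
    [e]. *)
Lemma riesz_mass_ge w : Cc w -> (forall x, 0 <= w x <= 1) -> ((L w)%:E <= nu setT)%E.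
Proof.
move=> cw w01; have [_ [K [cK wK]]] := cw.
apply: le_ereal_inf_tmp => _ [h [ch h0 hn h1] <-].
have Lw0 : 0 <= L w by apply: L_pos => // x; case/andP: (w01 x).
apply/lee_addgt0Pr => e e0.
pose a := Num.min (e / (L w + 1)) 1.
have Lw1 : 0 < L w + 1 by rewrite ltr_wpDl.
have a0 : 0 < a by rewrite lt_min ltr01 divr_gt0.
have a1 : a <= 1 by rewrite ge_min lexx orbT.
have [k kP] : exists k, forall x, K x -> 1 - a < h k x.
  have := cK; rewrite compact_cover => /(_ nat setT (fun k => h k @^-1` [set t | 1 - a < t])).
  case.
  - move=> k _; apply: open_comp; last exact: open_gt.
    by move=> x _; have [hc _] := ch k; exact: hc.
  - by move=> x Kx; have [k hk] := h1 x I; exists k => //=; apply: lt_le_trans hk; lra.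
  - move=> D _ KD; exists (\max_(i <- enum_fset D) i)%N => x Kx.
    have [i /= iD hi] := KD x Kx; apply: lt_le_trans hi _.
    have ch' : riesz_cover setT h by split.
    by apply: (riesz_cover_nd x ch'); apply: leq_bigmax_seq.
apply: (@le_trans _ _ ((L (h k))%:E + e%:E)%E); last first.
  by rewrite leeD2r//; apply: ereal_sup_ubound; exists k.
rewrite -EFinD lee_fin.
have : (1 - a) * L w <= L (h k).
  rewrite -functionalZ//; apply: functional_le => //; first exact: Cc_scale.
  move=> x; have [Kx|Kx] := pselect (K x); last by rewrite wK// mulr0.
  have /andP[w0 w1] := w01 x.
  by rewrite (le_trans _ (ltW (kP x Kx)))// ler_piMr// subr_ge0.
have : a * L w <= e.
  apply: (@le_trans _ _ (e / (L w + 1) * (L w + 1))); last by rewrite divfK// gt_eqF.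
  by rewrite ler_pM ?(ltW a0)//; [rewrite ge_min lexx|rewrite lerDl].
lra.
Qed.

Lemma Cc_nu_integrable w : Cc w -> nu.-integrable setT (EFin \o (w : B -> R)).
Proof.
move=> cw; have [M [_ wM]] := Cc_bounded cw.
by apply: (bounded_integrable riesz_mass_lty (M := M)) => //; exact: Cc_measurable.
Qed.

(** Cut [w] into layers of height [dl]. The layer [W i.+1 - W i] equals [dl] wherever the next layer
    is nonzero, so divided by [dl] it is admissible for the measure of that set. Hence the integral
    of each layer is at most [L] of the previous one, and only the bottom layer, of integral at most
    [dl * mT], is left over. *)
Lemma riesz_int_le w : Cc w -> (forall x, 0 <= w x) -> \int[nu]_x w x <= L w.
Proof.
move=> cw w0; have [M [M0 wM]] := Cc_bounded cw.
pose mT := fine (nu setT).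
have mT0 : 0 <= mT by exact: fine_ge0.
suff h (dl : R) : 0 < dl -> \int[nu]_x w x <= dl * mT + L w.
  apply/ler_addgt0Pr => e e0; have := h (e / (mT + 1)).
  have mT1 : 0 < mT + 1 by rewrite ltr_wpDl.
  rewrite divr_gt0// => /(_ isT)/le_trans; apply; rewrite addrC lerD2l.
  by rewrite mulrAC ler_pdivrMr// ler_wpM2l ?ltW// ltrDl.
move=> d0; pose W (i : nat) x := Num.min (w x) (i%:R * dl).
have cW i : Cc (W i).
  apply: Cc_min => //; first exact: cst_continuous.
  by move=> _; rewrite mulr_ge0// ltW.
have mW i : measurable_fun setT (W i : B -> R) by exact: Cc_measurable.
have iW i := Cc_nu_integrable (cW i).
have W0 x : W 0%N x = 0 by rewrite /W mul0r; apply/min_idPr.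
have Wd i x : W i x <= W i.+1 x.
  rewrite /W le_min !ge_min lexx/=; apply/orP; right.
  by rewrite ler_wpM2r ?ler_nat// ltW.
have Wdd i x : W i.+1 x <= W i x + dl.
  rewrite /W -natr1 mulrDl mul1r.
  case: (leP (w x) (i%:R * dl)) => h; first by rewrite ge_min lerDl ltW.
  by rewrite ge_min lexx orbT.
have key i : \int[nu]_x W i.+1 x <= dl * mT + L (W i).
  elim: i => [|i IH].
    rewrite (_ : L (W 0%N) = 0) ?addr0; last first.
      by rewrite -functional0; congr L; apply/funext.
    apply: (@le_trans _ _ (\int[nu]_(x in setT) dl)); last by rewrite Rintegral_cst.
    apply: le_Rintegral => //.
      by apply: (bounded_integrable riesz_mass_lty (M := dl)) => // x _; rewrite gtr0_norm.
    by move=> x _; have := Wdd 0%N x; rewrite W0 add0r.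
  have iB := integrableB measurableT (iW i.+2) (iW i.+1).
  have -> : \int[nu]_x W i.+2 x =
      \int[nu]_x W i.+1 x + \int[nu]_x (W i.+2 x - W i.+1 x).
    rewrite -RintegralD//; apply: eq_Rintegral => x _; ring.
  have -> : L (W i.+1) = L (W i) + L (fun x => W i.+1 x - W i x).
    by rewrite functionalB//; ring.
  rewrite addrA lerD//.
  pose E : set V := [set x | i.+1%:R * dl <= w x].
  have mE : measurable (E : set B).
    have -> : E = setT `&` w @^-1` `[i.+1%:R * dl, +oo[%classic.
      by apply/seteqP; split=> x /=; rewrite in_itv/= andbT => // -[].
    exact: (Cc_measurable cw measurableT (measurable_itv _)).
  have EW x : E x -> W i.+1 x - W i x = dl.
    rewrite /E/= => Ex; rewrite /W (min_r Ex) min_r; last first.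
      by apply: le_trans Ex; rewrite ler_wpM2r ?ler_nat// ltW.
    by rewrite -natr1; ring.
  have Wpos j x : 0 <= W j.+1 x - W j x by rewrite subr_ge0.
  have nE : ((nu E) <= (dl^-1 * L (fun x => W i.+1 x - W i x))%:E)%E.
    rewrite -functionalZ; last exact: Cc_sub.
    apply: riesz_outer_le1; first by apply: Cc_scale; exact: Cc_sub.
      by move=> x; rewrite mulr_ge0// invr_ge0 ltW.
    by move=> x /EW ->; rewrite mulVf// gt_eqF.
  apply: (@le_trans _ _ (dl * fine (nu E))); last first.
    rewrite -ler_pdivlMl// -lee_fin fineK//; exact: (finite_measure_fin riesz_mass_lty).
  rewrite (_ : \int[nu]_x _ = \int[nu]_(x in E) (W i.+2 x - W i.+1 x)); last first.
    rewrite [RHS]Rintegral_mkcond; apply: eq_Rintegral => x _.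
    rewrite /patch; case: ifPn => //; rewrite notin_setE /E/= => /negP; rewrite -ltNge => h.
    by rewrite /W !min_l ?subrr// ltW// (lt_le_trans h)// ler_wpM2r ?ler_nat// ltW.
  rewrite -Rintegral_cst//; apply: le_Rintegral => //.
  - exact: (integrableS measurableT mE (@subsetT _ _) iB).
  - apply: (bounded_integrable riesz_mass_lty (M := dl)) => // x _; by rewrite gtr0_norm.
  - by move=> x _; rewrite lerBlDl Wdd.
have [m mM] : exists m : nat, M <= m%:R * dl.
  exists (Num.truncn (M / dl)).+1; rewrite -ler_pdivrMr//; exact/ltW/truncnS_gt.
have Wm x : W m x = w x.
  by apply/min_idPl; apply: le_trans mM; rewrite (le_trans _ (wM x))// ler_norm.
have iw := Cc_nu_integrable cw.
apply: (@le_trans _ _ (\int[nu]_x W m.+1 x)).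
  by apply: le_Rintegral => // x _; rewrite -Wm.
apply: (le_trans (key m)); rewrite lerD2l; apply: functional_le => // x.
by rewrite Wm.
Qed.

(** The missing inequality follows from [riesz_int_le] applied to [M * u - v], where [u] is a cutoff
    equal to 1 on the support of [v] and on almost all of the mass, so that [L u] and its integral
    nearly agree. *)
Lemma riesz_int w : Cc w -> \int[nu]_x w x = L w.
Proof.
move=> cw.
suff pos v : Cc v -> (forall x, 0 <= v x) -> \int[nu]_x v x = L v.
  have [M [M0 wM]] := Cc_bounded cw; have [_ [K [cK wK]]] := cw.
  have [u [cu u01 u1 _]] := cutoff cK openT (@subsetT _ K).
  have := pos (fun x => w x + M * u x); rewrite functionalD ?functionalZ//; last exact: Cc_scale.
  have iu := Cc_nu_integrable cu.
  rewrite RintegralD ?RintegralZl//; [|exact: Cc_nu_integrable|by apply: Cc_nu_integrable; exact: Cc_scale].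
  rewrite (pos u)//; last by move=> x; case/andP: (u01 x).
  move=> h; apply: (addIr (M * L u)); apply: h; first by apply: Cc_add => //; exact: Cc_scale.
  move=> x; have [Kx|Kx] := pselect (K x).
    by rewrite u1// mulr1; have := wM x; rewrite ler_norml => /andP[+ _]; lra.
  by rewrite wK// add0r mulr_ge0 ?(ltW M0)//; case/andP: (u01 x).
move=> cv v0; apply/eqP; rewrite eq_le riesz_int_le//=.
have [M [M0 vM]] := Cc_bounded cv; have [_ [K [cK vK]]] := cv.
apply/ler_addgt0Pr => e e0.
have eM : 0 < e / M by rewrite divr_gt0.
have [C [cC _ nC]] := inner_compact riesz_mass_lty (@measurableT _ B) eM.
have cKC : compact (K `|` C) by exact: compactU.
have [u [cu u01 u1 _]] := cutoff cKC openT (@subsetT _ (K `|` C)).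
have mC := borel_compact cC.
have iu := Cc_nu_integrable cu; have iv := Cc_nu_integrable cv.
have Lu : L u <= \int[nu]_x u x + e / M.
  have h1 : fine (nu C) <= \int[nu]_x u x.
    rewrite -[leLHS]mul1r -Rintegral_cst// [leLHS]Rintegral_mkcond; apply: le_Rintegral => //.
      apply: (bounded_integrable riesz_mass_lty (M := 1)) => //.
        by apply/measurable_restrict => //; exact: measurable_cst.
      by move=> x _; rewrite /patch; case: ifP; rewrite ?normr0 ?normr1.
    move=> x _; rewrite /patch; case: ifPn => [|_]; last by case/andP: (u01 x).
    by rewrite inE => Cx; rewrite u1//; right.
  have h2 : L u <= fine (nu C) + e / M.
    rewrite -lee_fin; apply: (le_trans (riesz_mass_ge cu u01)).
    rewrite EFinD fineK; last exact: (finite_measure_fin riesz_mass_lty).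
    rewrite -[setT](setDUK (@subsetT _ C)).
    apply: (le_trans (measureU2 _ _ _)) => //; first exact: measurableD.
    by rewrite leeD2l// ltW.
  lra.
have cZ := Cc_scale M cu.
have := riesz_int_le (Cc_sub cZ cv); rewrite functionalB// functionalZ//.
rewrite RintegralB//; last exact: (Cc_nu_integrable cZ).
rewrite RintegralZl// => h.
have {}h : M * \int[nu]_x u x - \int[nu]_x v x <= M * L u - L v.
  apply: h => x; rewrite subr_ge0; have [Kx|Kx] := pselect (K x).
    by rewrite u1 ?mulr1; [exact: le_trans (ler_norm _) (vM x)|left].
  by rewrite vK// mulr_ge0 ?(ltW M0)//; case/andP: (u01 x).
have : M * L u <= M * \int[nu]_x u x + e.
  rewrite -[X in _ + X](divfK (lt0r_neq0 M0)) [X in _ + X]mulrC -mulrDr.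
  by rewrite ler_wpM2l// ltW.
lra.
Qed.

Theorem riesz_representation : exists la : {measure set B -> \bar R},
  (la setT < +oo)%E /\ forall w, Cc w -> \int[la]_x w x = L w.
Proof. by exists nu; split; [exact: riesz_mass_lty|exact: riesz_int]. Qed.

End Riesz.

(** * Radon-Nikodym densities *)

Section Density.
Context d (T : measurableType d) (R : realType).
Variables (al la : {measure set T -> \bar R}).
Hypotheses (alT : (al setT < +oo)%E) (laT : (la setT < +oo)%E).

Lemma radon_nikodym_real : (forall A, measurable A -> la A = 0%E -> al A = 0%E) ->
  exists a : T -> R, [/\ measurable_fun setT a, la.-integrable setT (EFin \o a),
    forall A, measurable A -> al A = (\int[la]_(x in A) (a x)%:E)%E &
    forall (w : T -> R) M, measurable_fun setT w -> (forall x, `|w x| <= M) ->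
      \int[la]_x (w x * a x) = \int[al]_x w x].
Proof.
move=> ac.
(* Restriction to the whole space changes no value but provides the finite-measure structure. *)
pose al' : {finite_measure set T -> \bar R} := mfrestr measurableT alT.
pose la' : {finite_measure set T -> \bar R} := mfrestr measurableT laT.
have alE A : al' A = al A by rewrite /al'/= /mfrestr /mrestr setIT.
have laE A : la' A = la A by rewrite /la'/= /mfrestr /mrestr setIT.
have dom : al' `<< la'.
  by apply/null_content_dominatesP => A mA; have := ac A mA; rewrite -alE -laE.
have intla D (f : T -> \bar R) : (\int[la']_(x in D) f x = \int[la]_(x in D) f x)%E.
  by apply: eq_measure_integral => A _ _; exact: laE.
have intal D (f : T -> \bar R) : (\int[al']_(x in D) f x = \int[al]_(x in D) f x)%E.
  by apply: eq_measure_integral => A _ _; exact: alE.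
pose g := Radon_Nikodym (charge_of_finite_measure al') la'.
have gfin x : g x \is a fin_num by exact: Radon_Nikodym_fin_num.
have ig : la'.-integrable setT g by exact: Radon_Nikodym_integrable.
have gE : EFin \o (fine \o g) = g by apply/funext => x /=; rewrite fineK.
exists (fine \o g); split.
- by apply/measurable_EFinP; rewrite gE; exact: measurable_int ig.
- rewrite gE; apply/integrableP; split; first exact: measurable_int ig.
  by rewrite -intla; case/integrableP : ig.
- move=> A mA; rewrite -alE -intla.
  have -> : al' A = charge_of_finite_measure al' A by [].
  rewrite (@Radon_Nikodym_integral _ _ _ (charge_of_finite_measure al') la' A dom mA); apply: eq_integral => x _.
  by rewrite /= fineK.
- move=> w M mw wM; rewrite /Rintegral -intla -intal; congr fine.
  have iw : al'.-integrable setT (EFin \o w).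
    apply: (@bounded_integrable _ _ _ al' _ _ _ M) => //; by have := alT; rewrite -(alE setT).
  rewrite -(Radon_Nikodym_change_of_variables dom measurableT iw).
  by apply: eq_integral => x _; rewrite EFinM /= fineK.
Qed.

(** The density exceeds [C] or is negative only on null sets, so it can be clipped to [[0, C]] at
    every point. *)
Lemma radon_nikodym_bounded C : 0 <= C ->
  (forall A, measurable A -> al A <= C%:E * la A)%E ->
  exists a : T -> R, [/\ measurable_fun setT a, forall x, 0 <= a x <= C &
    forall (w : T -> R) M, measurable_fun setT w -> (forall x, `|w x| <= M) ->
      \int[la]_x (w x * a x) = \int[al]_x w x].
Proof.
move=> C0 alC.
have [|a [ma ia aE aI]] := radon_nikodym_real.
  by move=> A mA lA; apply/eqP; rewrite eq_le measure_ge0 andbT (le_trans (alC A mA))// lA mule0.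
pose E := [set x | C < a x]; pose N := [set x | a x < 0].
have mE : measurable E.
  have -> : E = setT `&` a @^-1` `]C, +oo[%classic.
    by apply/seteqP; split=> x /=; rewrite in_itv/= andbT => // -[].
  exact: (ma measurableT _ (measurable_itv _)).
have mN : measurable N.
  have -> : N = setT `&` a @^-1` `]-oo, 0[%classic.
    by apply/seteqP; split=> x /=; rewrite in_itv/= => // -[].
  exact: (ma measurableT _ (measurable_itv _)).
have fin A : measurable A -> la A \is a fin_num by exact: finite_measure_fin.
have iaA A : measurable A -> la.-integrable A (EFin \o a).
  by move=> mA; exact: (integrableS measurableT mA (@subsetT _ _) ia).
have maA A : measurable A -> measurable_fun A (EFin \o a).
  by move=> mA; exact: measurable_int (iaA A mA).
have E0 : {ae la, forall x, E x -> (a x - C)%:E = 0%E}.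
  apply/(ae_eq_integral_abs la mE).
    apply/measurable_EFinP; apply: measurable_funB; last exact: measurable_cst.
    exact: measurable_funTS.
  under eq_integral => x xE.
    rewrite gee0_abs; last by rewrite lee_fin subr_ge0; rewrite inE /E/= in xE; exact: ltW.
    rewrite EFinB; over.
  have ic : la.-integrable E (cst C%:E).
    by apply: (bounded_integrable laT (M := C) (f := cst C)) => // x _; rewrite ger0_norm.
  rewrite integralB//; last exact: iaA.
  rewrite -aE// integral_cst//; apply/eqP; rewrite eq_le; apply/andP; split.
    by rewrite leeBlDr ?fin_numM ?fin// add0e alC.
  rewrite -integral_cst// aE// -integralB//; last exact: iaA.
  apply: integral_ge0 => x; rewrite /E/= => Cx.
  by rewrite -EFinB lee_fin subr_ge0 ltW.
have N0 : {ae la, forall x, N x -> (a x)%:E = 0%E}.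
  apply/(ae_eq_integral_abs la mN); first exact: maA.
  apply/eqP; rewrite eq_le; apply/andP; split; last by apply: integral_ge0.
  under eq_integral => x xN.
    rewrite lte0_abs; last by rewrite inE /N/= in xN; rewrite lte_fin.
    over.
  by rewrite integralN -?aE ?oppe_le0//; exact: (integrable_add_def mN (iaA N mN)).
pose b x := Num.max 0 (Num.min (a x) C).
have mb : measurable_fun setT b.
  apply: measurable_maxr; first exact: measurable_cst.
  by apply: measurable_minr => //; exact: measurable_cst.
exists b; split => //.
  by move=> x; rewrite /b le_max lexx/= ge_max C0/= ge_min lexx orbT.
move=> w M mw wM; rewrite -(aI w M)// /Rintegral; congr fine.
apply: ae_eq_integral => //.
- by apply/measurable_EFinP; exact: measurable_funM.
- by apply/measurable_EFinP; exact: measurable_funM.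
- apply: filterS2 E0 N0 => x Ex Nx _ /=; congr (_ * _)%:E; rewrite /b.
  case: (boolP (C < a x)) => [ax|]; last rewrite -leNgt => ax.
    have [] := Ex ax; move/eqP; rewrite subr_eq0 => /eqP ->.
    by rewrite minxx; apply/max_idPr.
  rewrite (min_l ax); case: (boolP (a x < 0)) => [a0|]; last by rewrite -leNgt => a0; apply/max_idPr.
  by have [->] := Nx a0; rewrite maxxx.
Qed.

End Density.

(** * Riesz representation of vector measures *)

Section CcIntegrals.
Context {R : realType} {n : nat}.
Local Notation V := 'rV[R]_n.
Local Notation B := (@Borel R n).
Implicit Types (w : V -> R) (nu : {measure set B -> \bar R}).

Lemma Cc_integrable nu w : (nu setT < +oo)%E -> Cc w -> nu.-integrable setT (EFin \o (w : B -> R)).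
Proof.
move=> nuT cw; have [M [_ wM]] := Cc_bounded cw.
by apply: (bounded_integrable nuT (M := M)) => //; exact: Cc_measurable.
Qed.

(** A cutoff between an inner compact set for [nu1] and an outer open set for [nu2] carries the
    inequality from integrals to sets. *)
Lemma measure_le_Cc nu1 nu2 : (nu1 setT < +oo)%E -> (nu2 setT < +oo)%E ->
  (forall w, Cc w -> (forall x, 0 <= w x) -> \int[nu1]_x w x <= \int[nu2]_x w x) ->
  forall A : set B, measurable A -> (nu1 A <= nu2 A)%E.
Proof.
move=> n1 n2 h A mA; apply/lee_addgt0Pr => e e0.
have e2 : 0 < e / 2 by rewrite divr_gt0.
have [K [cK KA nK]] := inner_compact n1 mA e2.
have [C [U [cC oU CA AU nU]]] := borel_regular n2 mA e2.
have [u [cu u01 u1 u0]] := cutoff cK oU (subset_trans KA AU).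
have mK := borel_compact cK; have mU := borel_open oU; have mC := borel_closed cC.
have i1 := Cc_integrable n1 cu; have i2 := Cc_integrable n2 cu.
have uu x : 0 <= u x by case/andP: (u01 x).
have h1 : (nu1 K <= (\int[nu1]_x u x)%:E)%E.
  rewrite -[leLHS]fineK ?lee_fin; last exact: finite_measure_fin.
  rewrite -[leLHS]mul1r -Rintegral_cst// [leLHS]Rintegral_mkcond; apply: le_Rintegral => //.
    apply: (bounded_integrable n1 (M := 1)) => //.
      by apply/measurable_restrict => //; exact: measurable_cst.
    by move=> x _; rewrite /patch; case: ifP; rewrite ?normr0 ?normr1.
  move=> x _; rewrite /patch; case: ifPn => [|_]; last by case/andP: (u01 x).
  by rewrite inE => Kx; rewrite u1.
have h2 : ((\int[nu2]_x u x)%:E <= nu2 U)%E.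
  rewrite -[leRHS]fineK ?lee_fin; last exact: finite_measure_fin.
  rewrite -[leRHS]mul1r -Rintegral_cst// [leRHS]Rintegral_mkcond; apply: le_Rintegral => //.
    apply: (bounded_integrable n2 (M := 1)) => //.
      by apply/measurable_restrict => //; exact: measurable_cst.
    by move=> x _; rewrite /patch; case: ifP; rewrite ?normr0 ?normr1.
  move=> x _; rewrite /patch; case: ifPn => [_|]; first by case/andP: (u01 x).
  by rewrite notin_setE => Ux; rewrite u0.
have h3 : (nu1 A <= nu1 K + (e / 2)%:E)%E.
  rewrite -[X in (nu1 X <= _)%E](setDUK KA); apply: (le_trans (measureU2 _ _ _)) => //.
    exact: measurableD.
  by rewrite leeD2l// ltW.
have h4 : (nu2 U <= nu2 A + (e / 2)%:E)%E.
  rewrite -[X in (nu2 X <= _)%E](setDUK AU); apply: (le_trans (measureU2 _ _ _)) => //.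
    exact: measurableD.
  rewrite leeD2l//; apply: ltW; apply: le_lt_trans nU; apply: le_measure; rewrite ?inE.
  - exact: measurableD.
  - exact: measurableD.
  - by move=> x [Ux Ax]; split => // /CA.
apply: (le_trans h3); rewrite [e in leRHS]splitr EFinD addeA leeD2r//.
apply: le_trans h4; apply: (le_trans h1); apply: le_trans h2.
by rewrite lee_fin h.
Qed.

End CcIntegrals.

(** * Linear extension of functionals that are additive on nonnegative functions *)

Section ConeExtension.
Context {R : realType} {n : nat}.
Local Notation V := 'rV[R]_n.
Variable P : (V -> R) -> R.
Hypothesis P_add : forall w1 w2, Cc w1 -> Cc w2 -> (forall x, 0 <= w1 x) ->
  (forall x, 0 <= w2 x) -> P (fun x => w1 x + w2 x) = P w1 + P w2.
Hypothesis P_scale : forall a w, 0 <= a -> Cc w -> (forall x, 0 <= w x) ->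
  P (fun x => a * w x) = a * P w.
Implicit Types (w : V -> R).

Definition cone_ext w := P (fun x => Num.max (w x) 0) - P (fun x => Num.max (- w x) 0).

Lemma Cc_max0 w : Cc w -> Cc (fun x => Num.max (w x) 0).
Proof.
move=> [cw [K [cK K0]]]; split.
  by move=> x; apply: continuous_max; [exact: cw|exact: cst_continuous].
by exists K; split => // x Kx; rewrite K0// maxxx.
Qed.

Lemma Cc_opp w : Cc w -> Cc (fun x => - w x).
Proof. by move=> cw; have := Cc_scale (-1) cw; under eq_fun do rewrite mulN1r. Qed.

(** Every representation of [w] as a difference of nonnegative functions gives the same value;
    linearity of the extension is then a matter of choosing convenient representations. *)
Lemma cone_extB u v w : Cc u -> Cc v -> (forall x, 0 <= u x) -> (forall x, 0 <= v x) ->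
  Cc w -> (forall x, w x = u x - v x) -> cone_ext w = P u - P v.
Proof.
move=> cu cv u0 v0 cw E.
have cp := Cc_max0 cw; have cm := Cc_max0 (Cc_opp cw).
have p0 x : 0 <= Num.max (w x) 0 by rewrite le_max lexx orbT.
have m0 x : 0 <= Num.max (- w x) 0 by rewrite le_max lexx orbT.
have : P (fun x => Num.max (w x) 0 + v x) = P (fun x => Num.max (- w x) 0 + u x).
  congr P; apply/funext => x; rewrite E; move: (u x) (v x) => a b.
  by rewrite opprB; case: (leP (a - b) 0) => h1; case: (leP (b - a) 0) => h2; lra.
by rewrite !P_add// /cone_ext; lra.
Qed.

Lemma cone_ext_ge0 w : Cc w -> (forall x, 0 <= w x) -> cone_ext w = P w.
Proof.
move=> cw w0.
have P0 : P (fun=> 0) = 0.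
  rewrite -[RHS](mul0r (P w)) -P_scale//.
  by congr P; apply/funext => x; rewrite mul0r.
rewrite (@cone_extB w (fun=> 0))// ?P0 ?subr0//; first exact: Cc0.
by move=> x; rewrite subr0.
Qed.

Lemma cone_ext_linear a b w1 w2 : Cc w1 -> Cc w2 ->
  cone_ext (fun x => a * w1 x + b * w2 x) = a * cone_ext w1 + b * cone_ext w2.
Proof.
have add u v : Cc u -> Cc v -> cone_ext (fun x => u x + v x) = cone_ext u + cone_ext v.
  move=> cu cv; pose p w x := Num.max (w x) (0 : R); pose m w x := Num.max (- w x) (0 : R).
  have cp w : Cc w -> Cc (p w) by exact: Cc_max0.
  have cm w : Cc w -> Cc (m w) by move=> cw; exact: (Cc_max0 (Cc_opp cw)).
  have p0 w x : 0 <= p w x by rewrite le_max lexx orbT.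
  have m0 w x : 0 <= m w x by rewrite le_max lexx orbT.
  rewrite (@cone_extB (fun x => p u x + p v x) (fun x => m u x + m v x)).
  - by rewrite !P_add//; try exact: cp; try exact: cm; rewrite /cone_ext -/(p u) -/(p v) -/(m u) -/(m v); ring.
  - by apply: Cc_add; exact: cp.
  - by apply: Cc_add; exact: cm.
  - by move=> x; rewrite addr_ge0.
  - by move=> x; rewrite addr_ge0.
  - exact: Cc_add.
  - move=> x; rewrite /p /m; move: (u x) (v x) => s t.
    by case: (leP s 0) => ?; case: (leP (- s) 0) => ?; case: (leP t 0) => ?; case: (leP (- t) 0) => ?; lra.
have scale c w : Cc w -> cone_ext (fun x => c * w x) = c * cone_ext w.
  move=> cw; have cp := Cc_max0 cw; have cm := Cc_max0 (Cc_opp cw).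
  have p0 x : 0 <= Num.max (w x) 0 by rewrite le_max lexx orbT.
  have m0 x : 0 <= Num.max (- w x) 0 by rewrite le_max lexx orbT.
  have E x : w x = Num.max (w x) 0 - Num.max (- w x) 0.
    by case: (leP (w x) 0) => ?; case: (leP (- w x) 0) => ?; lra.
  have [c0|c0] := leP 0 c.
    rewrite (@cone_extB (fun x => c * Num.max (w x) 0) (fun x => c * Num.max (- w x) 0)).
    - by rewrite !P_scale// -mulrBr.
    - exact: Cc_scale.
    - exact: Cc_scale.
    - by move=> x; rewrite mulr_ge0.
    - by move=> x; rewrite mulr_ge0.
    - exact: Cc_scale.
    - by move=> x; rewrite {1}E mulrBr.
  have nc : 0 <= - c by rewrite oppr_ge0 ltW.
  rewrite (@cone_extB (fun x => - c * Num.max (- w x) 0) (fun x => - c * Num.max (w x) 0)).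
  - by rewrite !P_scale// /cone_ext; ring.
  - exact: Cc_scale.
  - exact: Cc_scale.
  - by move=> x; rewrite mulr_ge0.
  - by move=> x; rewrite mulr_ge0.
  - exact: Cc_scale.
  - by move=> x; rewrite {1}E; ring.
move=> c1 c2; rewrite add ?scale//; exact: Cc_scale.
Qed.

End ConeExtension.

Section VectorFields.
Context {R : realType} {n : nat}.
Local Notation V := 'rV[R]_n.
Local Notation B := (@Borel R n).
Implicit Types (w : V -> R) (v : V -> V).

Lemma continuous_row (T : topologicalType) (v : T -> V) :
  (forall i, continuous (fun x => v x 0 i)) -> continuous v.
Proof.
move=> cv x; apply/cvgrPdist_le => e e0.
have : \forall y \near x, forall i, `|v x 0 i - v y 0 i| <= e.
  by apply: filter_forall => i; have /cvgrPdist_le := cv i x; exact.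
apply: filterS => y h; apply: norm_le; first exact: ltW.
by move=> i; rewrite !mxE; exact: h.
Qed.

Lemma continuous_prod (f g : V -> R) : continuous f -> continuous g -> continuous (fun x => f x * g x).
Proof. by move=> cf cg x; apply: continuousM; [exact: cf|exact: cg]. Qed.

Lemma Ccv_continuous v : Ccv v -> continuous v.
Proof. by move=> cv; apply: continuous_row => i; case: (cv i). Qed.

Lemma Ccv_enorm v : Ccv v -> Cc (fun x => enorm (v x)).
Proof.
move=> cv; split.
  move=> x; apply: (@continuous_comp V V R v (@enorm R n)); last exact: enorm_continuous.
  exact: Ccv_continuous.
have /choice[K KP] : forall i, exists K : set V, compact K /\ forall x, ~ K x -> v x 0 i = 0.
  by move=> i; case: (cv i).
exists (\big[setU/set0]_(i < n) K i); split.
  by apply: bigsetU_compact; move=> i *; case: (KP i).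
move=> x Kx; rewrite (_ : v x = 0) ?enorm0//; apply/rowP => i; rewrite mxE.
by apply: (KP i).2 => Ki; apply: Kx; rewrite (bigD1 i)//=; left.
Qed.

Lemma Ccv_scale a v : Ccv v -> Ccv (fun x => a *: v x).
Proof. by move=> cv i; under eq_fun do rewrite !mxE; exact: Cc_scale. Qed.

Lemma Ccv_add v1 v2 : Ccv v1 -> Ccv v2 -> Ccv (fun x => v1 x + v2 x).
Proof. by move=> c1 c2 i; under eq_fun do rewrite !mxE; exact: Cc_add. Qed.

Lemma Ccv_cmul v (h : V -> R) : Ccv v -> continuous h -> Ccv (fun x => h x *: v x).
Proof.
move=> cv ch i; under eq_fun do rewrite !mxE mulrC.
exact: Cc_mul.
Qed.

Lemma Ccv_unit w (j : 'I_n) : Cc w -> Ccv (fun x => w x *: unitv j).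
Proof.
move=> cw i; under eq_fun do rewrite mxE mulrC.
exact: Cc_scale.
Qed.

Lemma Ccv0 : Ccv (fun _ : V => 0 : V).
Proof. by move=> i; under eq_fun do rewrite mxE; exact: Cc0. Qed.

Lemma Ccv_sum (I : Type) (r : seq I) (F : I -> V -> V) : (forall i, Ccv (F i)) ->
  Ccv (fun x => \sum_(i <- r) F i x).
Proof.
move=> cF; elim: r => [|i r IH].
  by rewrite (_ : (fun x => _) = fun=> 0); [exact: Ccv0|apply/funext => x; rewrite big_nil].
rewrite (_ : (fun x => _) = fun x => F i x + \sum_(i <- r) F i x).
  exact: Ccv_add.
by apply/funext => x; rewrite big_cons.
Qed.

Lemma enorm_unitv (j : 'I_n) : enorm (unitv j : V) = 1.
Proof.
rewrite /enorm (bigD1 j)//= big1 => [|i ij]; last by rewrite unitvE (negbTE ij) expr0n.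
by rewrite unitvE eqxx expr1n addr0 sqrtr1.
Qed.

End VectorFields.

Section VectorRiesz.
Context {R : realType} {n : nat}.
Local Notation V := 'rV[R]_n.
Local Notation B := (@Borel R n).
Variable S : (V -> V) -> R.
Hypothesis S_lin : forall a b v1 v2, Ccv v1 -> Ccv v2 ->
  S (fun x => a *: v1 x + b *: v2 x) = a * S v1 + b * S v2.
Variable c : R.
Hypothesis S_bound : forall v a, 0 <= a -> Ccv v -> (forall x, enorm (v x) <= a) -> S v <= c * a.
Implicit Types (w : V -> R) (v : V -> V).

Let S_add v1 v2 : Ccv v1 -> Ccv v2 -> S (fun x => v1 x + v2 x) = S v1 + S v2.
Proof.
move=> c1 c2; have := S_lin 1 1 c1 c2; rewrite !mul1r => <-.
by congr S; apply/funext => x; rewrite !scale1r.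
Qed.

Let S_scale a v : Ccv v -> S (fun x => a *: v x) = a * S v.
Proof.
move=> cv; have := S_lin a 0 cv cv; rewrite mul0r addr0 => <-.
by congr S; apply/funext => x; rewrite scale0r addr0.
Qed.

Let S0 : S (fun=> 0) = 0.
Proof.
by rewrite -[RHS](mul0r (S (fun=> 0))) -S_scale; [congr S; apply/funext => x; rewrite scale0r|exact: Ccv0].
Qed.

Let S_sum (I : Type) (r : seq I) (F : I -> V -> V) : (forall i, Ccv (F i)) ->
  S (fun x => \sum_(i <- r) F i x) = \sum_(i <- r) S (F i).
Proof.
move=> cF; elim: r => [|i r IH].
  by rewrite big_nil -[RHS]S0; congr S; apply/funext => x; rewrite big_nil.
rewrite big_cons -IH -S_add//; last exact: Ccv_sum.
by congr S; apply/funext => x; rewrite big_cons.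
Qed.

(** On nonnegative [w] this is the integral of [w] against the total variation of the vector measure
    that will represent [S]. *)
Definition variation_fun w := sup [set S v | v in [set v | Ccv v /\ forall x, enorm (v x) <= w x]].

Let has_sup_variation w : Cc w -> (forall x, 0 <= w x) ->
  has_sup [set S v | v in [set v | Ccv v /\ forall x, enorm (v x) <= w x]].
Proof.
move=> cw w0; split.
  exists (S (fun=> 0)); exists (fun=> 0) => //; split; first exact: Ccv0.
  by move=> x; rewrite enorm0.
have [M [M0 wM]] := Cc_bounded cw.
exists (c * M) => _ [v [cv vw] <-]; apply: S_bound => //; first exact: ltW.
by move=> x; rewrite (le_trans (vw x))// (le_trans (ler_norm _)).
Qed.

Lemma variation_ge w v : Cc w -> Ccv v -> (forall x, enorm (v x) <= w x) -> S v <= variation_fun w.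
Proof.
move=> cw cv vw; have w0 x : 0 <= w x by rewrite (le_trans _ (vw x))// enorm_ge0.
by apply: (sup_upper_bound (has_sup_variation cw w0)); exists v.
Qed.

Lemma variation_le w a : Cc w -> (forall x, 0 <= w x) ->
  (forall v, Ccv v -> (forall x, enorm (v x) <= w x) -> S v <= a) -> variation_fun w <= a.
Proof.
move=> cw w0 h; apply: ge_sup; first by case: (has_sup_variation cw w0).
by move=> _ [v [cv vw] <-]; exact: h.
Qed.

Lemma variation_adherent w e : Cc w -> (forall x, 0 <= w x) -> 0 < e ->
  exists v, [/\ Ccv v, forall x, enorm (v x) <= w x & variation_fun w - e <= S v].
Proof.
move=> cw w0 e0; have [_ [v [cv vw] <-] /ltW h] := sup_adherent e0 (has_sup_variation cw w0).
by exists v.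
Qed.

Lemma variation_ge0 w : Cc w -> (forall x, 0 <= w x) -> 0 <= variation_fun w.
Proof.
move=> cw w0; rewrite -S0; apply: variation_ge => //; first exact: Ccv0.
by move=> x; rewrite enorm0.
Qed.

Let c0 : 0 <= c.
Proof.
have := S_bound (ler01) Ccv0; rewrite S0 mulr1; apply => x.
by rewrite enorm0 ler01.
Qed.

(* The error term [eta] keeps the splitting [v = v w1 / (w1 + w2) + v w2 / (w1 + w2)] continuous
   at the zeros of [w1 + w2]. *)
Lemma variationD w1 w2 : Cc w1 -> Cc w2 -> (forall x, 0 <= w1 x) -> (forall x, 0 <= w2 x) ->
  variation_fun (fun x => w1 x + w2 x) = variation_fun w1 + variation_fun w2.
Proof.
move=> c1 c2 p1 p2; have c12 := Cc_add c1 c2.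
have p12 x : 0 <= w1 x + w2 x by rewrite addr_ge0.
apply/eqP; rewrite eq_le; apply/andP; split; last first.
  apply/ler_addgt0Pr => e e0; have e2 : 0 < e / 2 by rewrite divr_gt0.
  have [v1 [cv1 vw1 h1]] := variation_adherent c1 p1 e2.
  have [v2 [cv2 vw2 h2]] := variation_adherent c2 p2 e2.
  have : S (fun x => v1 x + v2 x) <= variation_fun (fun x => w1 x + w2 x).
    apply: variation_ge => //; first exact: Ccv_add.
    by move=> x; rewrite (le_trans (enormD _ _))// lerD.
  by rewrite S_add//; lra.
apply: variation_le => // v cv vw; apply/ler_addgt0Pr => e e0.
pose eta := e / (c + 1).
have c10 : 0 < c + 1 by rewrite ltr_wpDl.
have eta0 : 0 < eta by rewrite divr_gt0.
have den x : 0 < w1 x + w2 x + eta by rewrite ltr_wpDl.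
have cden : continuous (fun x => (w1 x + w2 x + eta)^-1).
  move=> x; apply: (@continuous_comp V R R (fun x => w1 x + w2 x + eta) (@GRing.inv R)); last first.
    by apply: inv_continuous; rewrite gt_eqF.
  apply: (@continuousD R R^o V); last exact: cst_continuous.
  by case: c12 => + _; exact.
have cq w : Cc w -> Ccv (fun x => (w x / (w1 x + w2 x + eta)) *: v x).
  move=> [cw _]; apply: Ccv_cmul => //; exact: continuous_prod.
pose q w x := (w x / (w1 x + w2 x + eta)) *: v x.
have qle w x : 0 <= w x -> enorm (q w x) <= w x.
  move=> w0; rewrite /q enormZ ger0_norm ?divr_ge0 ?(ltW (den x))//.
  rewrite mulrAC ler_pdivrMr// ler_wpM2l// (le_trans (vw x))// lerDl ltW//.
have cr : Ccv (fun x => (eta / (w1 x + w2 x + eta)) *: v x).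
  apply: Ccv_cmul => //; apply: (continuous_prod (f := fun=> eta)) => //; exact: cst_continuous.
have -> : S v = S (q w1) + S (q w2) + S (fun x => (eta / (w1 x + w2 x + eta)) *: v x).
  rewrite -S_add; [|exact: cq|exact: cq]; rewrite -S_add//; last by apply: Ccv_add; exact: cq.
  congr S; apply/funext => x; rewrite /q -[LHS]scale1r.
  by rewrite -[X in X *: _ = _](mulfV (lt0r_neq0 (den x))) !mulrDl !scalerDl.
apply: lerD; first apply: lerD.
- by apply: variation_ge => // [|x]; [exact: cq|exact: qle].
- by apply: variation_ge => // [|x]; [exact: cq|exact: qle].
apply: (@le_trans _ _ (c * eta)).
  apply: S_bound => //; first exact: ltW.
  move=> x; rewrite enormZ (ger0_norm (divr_ge0 (ltW eta0) (ltW (den x)))).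
  rewrite mulrAC ler_pdivrMr// ler_wpM2l ?(ltW eta0)// (le_trans (vw x))// lerDl ltW//.
by rewrite /eta mulrCA ler_piMr ?(ltW e0)// ler_pdivrMr// mul1r lerDl.
Qed.

Lemma variationZ a w : 0 <= a -> Cc w -> (forall x, 0 <= w x) ->
  variation_fun (fun x => a * w x) = a * variation_fun w.
Proof.
move=> a0 cw w0.
have le b u : 0 < b -> Cc u -> (forall x, 0 <= u x) ->
    variation_fun (fun x => b * u x) <= b * variation_fun u.
  move=> b0 cu u0; apply: variation_le; first exact: Cc_scale.
    by move=> x; exact: mulr_ge0 (ltW b0) (u0 x).
  move=> v cv vu; rewrite -ler_pdivrMl// -S_scale//; apply: variation_ge => //.
    exact: Ccv_scale.
  by move=> x; rewrite enormZ ger0_norm ?invr_ge0 ?(ltW b0)// ler_pdivrMl.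
move: a0; rewrite le_eqVlt => /predU1P[<-|a0].
  rewrite mul0r; apply/eqP; rewrite eq_le; apply/andP; split; last first.
    by apply: variation_ge0 => [|x]; [exact: Cc_scale|rewrite mul0r].
  apply: variation_le; [exact: Cc_scale|by move=> x; rewrite mul0r|].
  move=> v cv v0; rewrite (_ : v = fun=> 0) ?S0//; apply/funext => x.
  by apply: enorm_eq0; apply/eqP; rewrite eq_le enorm_ge0 andbT (le_trans (v0 x))// mul0r.
apply/eqP; rewrite eq_le le//= mulrC -ler_pdivlMr// mulrC.
have := @le a^-1 (fun x => a * w x); rewrite invr_gt0 a0.
move=> /(_ isT (Cc_scale a cw)); under eq_fun do rewrite mulrA mulVf ?gt_eqF// mul1r.
by apply => x; exact: mulr_ge0 (ltW a0) (w0 x).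
Qed.

(** The scalar Riesz theorem applied to the variation functional gives [la]. On each coordinate [S]
    is dominated by the variation, so [Lam + S] is positive and at most [2 * Lam]; it has a density
    with values in [[0, 2]], and subtracting 1 gives the coordinate of [tau]. Signed measures are
    thus avoided. *)
Theorem vector_riesz : exists (la : {measure set B -> \bar R}) (tau : V -> V),
  [/\ (la setT < +oo)%E /\ measurable_fun setT (tau : B -> B),
    forall x i, `|tau x 0 i| <= 1,
    forall v, Ccv v -> \int[la]_x dotp (v x) (tau x) = S v,
    forall v, Ccv v -> S v <= \int[la]_x enorm (v x) &
    forall w e, Cc w -> (forall x, 0 <= w x) -> 0 < e ->
      exists v, [/\ Ccv v, forall x, enorm (v x) <= w x & \int[la]_x w x - e <= S v]].
Proof.
pose Lam := cone_ext variation_fun.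
have LamE w : Cc w -> (forall x, 0 <= w x) -> Lam w = variation_fun w.
  by move=> cw w0; apply: cone_ext_ge0 => //; [exact: variationD|exact: variationZ].
have Lam_lin a b w1 w2 : Cc w1 -> Cc w2 ->
    Lam (fun x => a * w1 x + b * w2 x) = a * Lam w1 + b * Lam w2.
  by move=> c1 c2; apply: cone_ext_linear => //; [exact: variationD|exact: variationZ].
have Lam_pos w : Cc w -> (forall x, 0 <= w x) -> 0 <= Lam w.
  by move=> cw w0; rewrite LamE//; exact: variation_ge0.
have Lam_mass w : Cc w -> (forall x, w x <= 1) -> Lam w <= c.
  move=> cw w1; have cm := Cc_max0 cw.
  have m0 x : 0 <= Num.max (w x) 0 by rewrite le_max lexx orbT.
  apply: (@le_trans _ _ (Lam (fun x => Num.max (w x) 0))).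
    by apply: (functional_le Lam_lin Lam_pos) => // x; rewrite le_max lexx.
  rewrite LamE//; apply: variation_le => // v cv vw; rewrite -[leRHS]mulr1.
  apply: S_bound => // x; rewrite (le_trans (vw x))// ge_max ler01 w1//.
have [la [laT laE]] := riesz_representation Lam_lin Lam_pos Lam_mass.
have SLam (i : 'I_n) w : Cc w -> (forall x, 0 <= w x) -> `|S (fun x => w x *: unitv i)| <= Lam w.
  move=> cw w0; have cu := Ccv_unit i cw.
  have eu x : enorm (w x *: unitv i) <= w x by rewrite enormZ enorm_unitv mulr1 ger0_norm.
  rewrite LamE// ler_norml variation_ge// andbT lerNl -mulN1r -S_scale//.
  by apply: variation_ge => //; [exact: Ccv_scale|move=> x; rewrite scaleN1r enormN].
have /choice[a aP] : forall i : 'I_n, exists a : V -> R, [/\ measurable_fun setT (a : B -> R),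
    forall x, 0 <= a x <= 2 & forall w, Cc w -> \int[la]_x (w x * a x) = Lam w + S (fun x => w x *: unitv i)].
  move=> i; pose L w := Lam w + S (fun x => w x *: unitv i).
  have L_lin a b w1 w2 : Cc w1 -> Cc w2 -> L (fun x => a * w1 x + b * w2 x) = a * L w1 + b * L w2.
    move=> c1 c2; rewrite /L Lam_lin//.
    rewrite (_ : (fun x => (a * w1 x + b * w2 x) *: unitv i) =
      fun x => a *: (w1 x *: unitv i) + b *: (w2 x *: unitv i)).
      by rewrite S_lin//; [ring|exact: Ccv_unit|exact: Ccv_unit].
    by apply/funext => x; rewrite scalerDl !scalerA.
  have L_pos w : Cc w -> (forall x, 0 <= w x) -> 0 <= L w.
    by move=> cw w0; have := SLam i w cw w0; rewrite /L ler_norml => /andP[+ _]; lra.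
  have L_le w : Cc w -> (forall x, 0 <= w x) -> L w <= 2 * Lam w.
    by move=> cw w0; have := SLam i w cw w0; rewrite /L ler_norml => /andP[_ +]; lra.
  have L_mass w : Cc w -> (forall x, w x <= 1) -> L w <= 2 * c.
    move=> cw w1; have cm := Cc_max0 cw.
    have m0 x : 0 <= Num.max (w x) 0 by rewrite le_max lexx orbT.
    apply: (@le_trans _ _ (L (fun x => Num.max (w x) 0))).
      by apply: (functional_le L_lin L_pos) => // x; rewrite le_max lexx.
    apply: (le_trans (L_le _ cm m0)); rewrite ler_pM2l//; apply: Lam_mass => // x.
    by rewrite ge_max w1 ler01.
  have [al [alT alE]] := riesz_representation L_lin L_pos L_mass.
  have two0 : 0 <= 2 :> R by [].
  pose la2 : {measure set B -> \bar R} := mscale (NngNum two0) la.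
  have la2T : (la2 setT < +oo)%E.
    by rewrite /la2/= /mscale/= lte_mul_pinfty.
  have [|a [ma a2 aE]] := @radon_nikodym_bounded _ _ _ al la alT laT 2 two0.
    have := @measure_le_Cc _ _ al la2 alT la2T; apply => w cw w0.
    rewrite alE// [leRHS]/Rintegral ge0_integral_mscale//.
    + rewrite fineM//; last by apply: integrable_fin_num => //; exact: Cc_integrable.
      by rewrite -/(Rintegral _ _ _) laE// L_le.
    + by apply/measurable_EFinP; exact: Cc_measurable.
    + by move=> x _; rewrite lee_fin.
  exists a; split => // w cw; have [M [_ wM]] := Cc_bounded cw.
  by rewrite (aE w M)// ?alE//; exact: Cc_measurable.
pose tau x : V := \row_i (a i x - 1).
have tau1 x i : `|tau x 0 i| <= 1.
  have [_ /(_ x)/andP[h1 h2] _] := aP i.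
  by rewrite mxE ler_norml; apply/andP; split; lra.
have mtau : measurable_fun setT (tau : B -> B).
  apply: measurable_row => i.
  rewrite (_ : (fun x => _) = fun x => a i x - 1); last by apply/funext => x; rewrite mxE.
  by case: (aP i) => h _ _; exact: measurable_funB.
exists la, tau; split => //.
- move=> v cv.
  have ic i : la.-integrable setT (EFin \o (fun x => v x 0 i * a i x)).
    have [M [M0 vM]] := Cc_bounded (cv i).
    apply: (bounded_integrable laT (M := M * 2)) => //.
      by apply: measurable_funM; [exact: (Cc_measurable (cv i))|case: (aP i)].
    move=> x _; have [_ /(_ x)/andP[h1 h2] _] := aP i.
    by rewrite normrM ler_pM// ger0_norm.
  have iv i := Cc_integrable laT (cv i).
  have id i : la.-integrable setT (EFin \o (fun x => v x 0 i * tau x 0 i)).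
    rewrite (_ : EFin \o _ = (EFin \o (fun x => (v x 0 i * a i x)%R)) \- (EFin \o (fun x => (v x 0 i)%R)))%E.
      exact: integrableB.
    by apply/funext => x /=; rewrite mxE mulrBr mulr1 EFinB.
  have -> : \int[la]_x dotp (v x) (tau x) = \sum_i \int[la]_x (v x 0 i * tau x 0 i).
    rewrite /Rintegral/dotp; under eq_integral do rewrite -sumEFin.
    rewrite integral_sum//; rewrite sum_fine//.
    by move=> i _; apply: integrable_fin_num => //; exact: (id i).
  have -> : S v = \sum_i S (fun x => v x 0 i *: unitv i).
    rewrite {1}(_ : v = fun x => \sum_i v x 0 i *: unitv i); last by apply/funext => x; exact: row_unitv.
    by apply: S_sum => i; exact: Ccv_unit.
  apply: eq_bigr => i _; have [_ _ /(_ _ (cv i)) h] := aP i.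
  under eq_Rintegral do rewrite mxE mulrBr mulr1.
  by rewrite RintegralB// h laE; [ring|exact: cv].
- move=> v cv; have ce := Ccv_enorm cv; rewrite laE// LamE//; last by move=> x; exact: enorm_ge0.
  exact: variation_ge.
- by move=> w e cw w0 e0; rewrite laE// LamE//; exact: variation_adherent.
Qed.

End VectorRiesz.

(** * Differentiation of measures on Euclidean balls *)

Section Covering.
Context {R : realType} {n : nat}.
Local Notation V := 'rV[R]_n.
Implicit Types (x y a b : V) (s : seq V) (rho : V -> R).

(** The cell of the direction [a / |a|] in a cubic grid of mesh [1 / (2 n + 1)]. Shifted coordinates
    lie in [[0, 2]], so the indices run from 0 to [4 n + 2]. *)
Definition dir_class a : {ffun 'I_n -> 'I_(4 * n).+3} :=
  [ffun i => inord (Num.truncn ((a 0 i / enorm a + 1) * (2 * n).+1%:R))].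

(** Directions in the same cell are at distance below 1, hence enclose an angle below 60 degrees; in
    a triangle the side opposite such an angle is shorter than the longest of the other two. *)
Lemma dir_classP a b : a != 0 -> b != 0 -> dir_class a = dir_class b ->
  enorm (a - b) < Num.max (enorm a) (enorm b).
Proof.
wlog ab : a b / enorm b <= enorm a.
  move=> h a0 b0 ab; case/orP : (le_total (enorm b) (enorm a)) => [/h|/h]; first exact.
  by move=> /(_ b0 a0 (esym ab)); rewrite enormB maxC.
move=> a0 b0 cab; rewrite (max_l ab).
have ea := enorm_gt0 a0; have eb := enorm_gt0 b0.
pose u : V := (enorm a)^-1 *: a; pose w : V := (enorm b)^-1 *: b.
pose M : R := (2 * n).+1%:R.
have M0 : 0 < M by rewrite ltr0n.
have coord_u (c : V) i : 0 < enorm c -> 0 <= (c 0 i / enorm c + 1) * M /\ (c 0 i / enorm c + 1) * M < (4 * n).+3%:R.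
  move=> ec; have := enorm_coord c i; rewrite ler_norml => /andP[h1 h2].
  have {h1}h1 : -1 <= c 0 i / enorm c by rewrite ler_pdivlMr// mulN1r.
  have {h2}h2 : c 0 i / enorm c <= 1 by rewrite ler_pdivrMr// mul1r.
  split; first by rewrite mulr_ge0 ?(ltW M0)//; lra.
  apply: (@le_lt_trans _ _ (2 * M)); first by rewrite ler_pM2r//; lra.
  by rewrite -natrM ltr_nat; lia.
have close i : `|u 0 i - w 0 i| < M^-1.
  have [a1 a2] := coord_u a i ea; have [b1 b2] := coord_u b i eb.
  have := congr1 (fun f : {ffun _ -> _} => val (f i)) cab; rewrite !ffunE.
  have tr (c : R) : 0 <= c -> c < (4 * n).+3%:R -> (Num.truncn c < (4 * n).+3)%N.
    by move=> c0 c1; rewrite -(ltr_nat R) (le_lt_trans _ c1)// truncn_le.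
  rewrite /= !inordK ?tr// => E.
  set p := (a 0 i / enorm a + 1) * M in a1 a2 *; set q := (b 0 i / enorm b + 1) * M in b1 b2 *.
  rewrite -/M -/p -/q in E.
  have h1 : (Num.truncn p)%:R <= p by rewrite truncn_le.
  have h2 : (Num.truncn q)%:R <= q by rewrite truncn_le.
  have := truncnS_gt p; have := truncnS_gt q; rewrite -E in h2 *; rewrite -natr1 => h3 h4.
  have h : `|p - q| < 1 by rewrite ltr_norml; apply/andP; split; lra.
  move: h; rewrite -mulrBl normrM (gtr0_norm M0) -ltr_pdivlMr// div1r.
  by rewrite !mxE ![_^-1 * _]mulrC opprD addrACA subrr addr0.
have uw : enorm (u - w) < 1.
  apply: (@le_lt_trans _ _ (\sum_(i < n) M^-1)).
    apply: le_trans (enorm_le_sum _) _; apply: ler_sum => i _.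
    by rewrite !mxE; have := close i; rewrite !mxE => /ltW.
  rewrite sumr_const card_ord -[_ *+ _]mulr_natl ltr_pdivrMr// mul1r ltr_nat; lia.
have eu : enorm u = 1 by rewrite enormZ ger0_norm ?invr_ge0 ?enorm_ge0// mulVf// gt_eqF.
have ew : enorm w = 1 by rewrite enormZ ger0_norm ?invr_ge0 ?enorm_ge0// mulVf// gt_eqF.
have duw : 1 < 2 * dotp u w.
  have : dotp (u - w) (u - w) < 1.
    by rewrite dotpvv expr_lt1// enorm_ge0.
  rewrite dotpBl (dotpC u) (dotpC w) !dotpBl !dotpvv eu ew (dotpC w u); lra.
have dab : dotp u w = (enorm a)^-1 * (enorm b)^-1 * dotp a b.
  by rewrite dotpZl dotpZr mulrA.
have key : enorm a * enorm b < 2 * dotp a b.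
  move: duw; rewrite dab mulrCA -invfM => h.
  have ab0 : 0 < enorm a * enorm b by rewrite mulr_gt0.
  by rewrite -(ltr_pM2l (_ : 0 < (enorm a * enorm b)^-1)) ?invr_gt0// mulVf ?gt_eqF.
rewrite -(@ltr_sqr _ (enorm (a - b))) ?nnegrE ?enorm_ge0//.
rewrite -dotpvv dotpBl (dotpC a) (dotpC b) !dotpBl !dotpvv (dotpC b a).
have : enorm b ^+ 2 <= enorm a * enorm b by rewrite expr2 ler_wpM2r// enorm_ge0.
lra.
Qed.

(** Seen from [y], two centres different from [y] whose balls contain [y] cannot have the same
    direction class, since [dir_classP] would contradict their separation. The additional 1 accounts
    for [y] itself being a centre. *)
Lemma overlap_bound : exists N : nat, forall (rho : V -> R) (s : seq V) y, uniq s ->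
  (forall x z, x \in s -> z \in s -> x != z -> Num.max (rho x) (rho z) <= enorm (x - z)) ->
  (count (fun x => (enorm (y - x) < rho x)%R) s <= N)%N.
Proof.
exists (#|{: {ffun 'I_n -> 'I_(4 * n).+3}}|.+1) => rho s y us sep.
rewrite -size_filter; set t := seq.filter _ s.
have ut : uniq t by exact: filter_uniq.
have tP x : x \in t -> x \in s /\ enorm (x - y) < rho x.
  by rewrite mem_filter enormB => /andP[].
suff h : (size [seq x <- t | x != y] <= #|{: {ffun 'I_n -> 'I_(4 * n).+3}}|)%N.
  have : (count_mem y t <= 1)%N by rewrite count_uniq_mem//; case: (_ \in _).
  rewrite size_filter in h; rewrite -(count_predC (pred1 y) t) => h1.
  exact: (leq_add h1 h).
set t' := seq.filter _ _.
have ut' : uniq t' by exact: filter_uniq.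
have inj : {in t' &, injective (fun x => dir_class (x - y))}.
  move=> x z; rewrite (mem_filter _ x) (mem_filter _ z) => /andP[xy xt] /andP[zy zt] E.
  have [xs xr] := tP _ xt; have [zs zr] := tP _ zt.
  apply/eqP; apply: contraT => xz.
  have := dir_classP (a := x - y) (b := z - y); rewrite !subr_eq0 => /(_ xy zy E).
  rewrite opprB addrA subrK => h; have := sep _ _ xs zs xz.
  rewrite leNgt (lt_le_trans h)// ge_max !le_max (ltW xr) (ltW zr) orbT//.
rewrite -(size_map (fun x => dir_class (x - y))) cardE; apply: uniq_leq_size.
  by rewrite map_inj_in_uniq.
by move=> c _; rewrite mem_enum.
Qed.

Lemma separated_bound (C : set V) (r : R) : compact C -> 0 < r -> exists M : nat,
  forall s, (forall x, x \in s -> C x) -> uniq s ->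
  (forall x z, x \in s -> z \in s -> x != z -> r <= enorm (x - z)) -> (size s <= M)%N.
Proof.
move=> cC r0; have r2 : 0 < r / 2 by rewrite divr_gt0.
have := cC; rewrite compact_cover => /(_ V setT (fun x => eball x (r / 2))) [].
- by move=> x _; exact: eball_open.
- by move=> x Cx; exists x => //; rewrite /eball/= subrr enorm0.
move=> D _ CD; exists #|` D|%fset => s sC us sep.
have /choice[c cP] : forall x, exists c, x \in s -> c \in D /\ enorm (x - c) < r / 2.
  move=> x; have [xs|] := boolP (x \in s); last by exists x.
  by have [c cD xc] := CD x (sC _ xs); exists c.
rewrite -(size_map c); apply: uniq_leq_size; last first.
  by move=> _ /mapP[x xs ->]; case: (cP x xs).
rewrite map_inj_in_uniq// => x z xs zs E; apply/eqP; apply: contraT => xz.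
have h := sep _ _ xs zs xz; have [_ h1] := cP x xs; have [_] := cP z zs; rewrite -E enormB => h2.
have := le_lt_trans (le_trans h (enorm_triangle (c x) x z)) (ltrD h1 h2).
by rewrite -splitr ltxx.
Qed.

(** Greedy choice in decreasing order of the finitely many radii: a maximal separated family of
    centres with the largest radius, finite by compactness, and then recursion on the points not yet
    covered. *)
Lemma finite_covering (C : set V) (l : seq R) rho (E : set V) : compact C -> E `<=` C ->
  (forall r, r \in l -> 0 < r) -> (forall x, E x -> rho x \in l) ->
  exists s, [/\ uniq s, forall x, x \in s -> E x,
    forall x z, x \in s -> z \in s -> x != z -> Num.max (rho x) (rho z) <= enorm (x - z) &
    forall y, E y -> exists2 x, x \in s & enorm (y - x) < rho x].
Proof.
move=> cC; move: (sort_sorted (@ge_total _ R) l).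
wlog : l / sorted >=%R l.
  move=> h sl EC l0 El; apply: (h (sort >=%R l)) => //.
  - by rewrite sort_sorted//; exact: ge_total.
  - by move=> r; rewrite mem_sort; exact: l0.
  - by move=> x Ex; rewrite mem_sort; exact: El.
move=> + _; elim: l E => [|r l IH] E sl EC l0 El.
  by exists [::]; split => // y /El.
have r0 : 0 < r by apply: l0; rewrite mem_head.
have lr q : q \in r :: l -> q <= r.
  rewrite inE => /predU1P[->//|ql].
  by move: sl => /= /(order_path_min (rev_trans le_trans))/allP/(_ _ ql).
pose P (s : seq V) := [/\ uniq s, forall x, x \in s -> E x /\ rho x = r &
  forall x z, x \in s -> z \in s -> x != z -> r <= enorm (x - z)].
have [M sM] := separated_bound cC r0.
have [s1 [Ps1 max1]] : exists s, P s /\ forall y, ~ P (y :: s).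
  apply: contrapT => h.
  have : forall k, exists s, P s /\ size s = k.
    elim=> [|k [s [Ps sk]]]; first by exists [::].
    have [y Py] : exists y, P (y :: s).
      by apply: contrapT => hy; apply: h; exists s; split => // y Py; apply: hy; exists y.
    by exists (y :: s); rewrite /= sk.
  move=> /(_ M.+1)[s [[us sE sep] sk]].
  have := sM s (fun x xs => EC _ (sE x xs).1) us sep.
  by rewrite sk ltnn.
have [us1 s1E sep1] := Ps1.
(* By maximality of [s1] no point of radius [r] remains here, so the shorter list [l] suffices for
   the recursion. *)
pose E' : set V := [set y | E y /\ forall x, x \in s1 -> r <= enorm (y - x)].
have E'l x : E' x -> rho x \in l.
  move=> [Ex Ex']; have := El x Ex; rewrite inE => /predU1P[xr|//].
  exfalso; apply: (max1 x); split.
  - rewrite /= us1 andbT; apply/negP => /Ex'.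
    by rewrite subrr enorm0 leNgt r0.
  - by move=> z; rewrite inE => /predU1P[->//|]; exact: s1E.
  - move=> z w; rewrite !inE => /predU1P[->|zs] /predU1P[->|ws] zw.
    + by rewrite eqxx in zw.
    + exact: Ex'.
    + by rewrite enormB; exact: Ex'.
    + exact: sep1.
have [||||s2 [us2 s2E sep2 cov2]] := IH E'.
- by move: sl => /= /path_sorted.
- by move=> x [/EC].
- by move=> q ql; apply: l0; rewrite inE ql orbT.
- exact: E'l.
have s12 x z : x \in s1 -> z \in s2 -> Num.max (rho x) (rho z) <= enorm (z - x).
  move=> xs zs; have [Ez /(_ x xs)] := s2E z zs; apply: le_trans.
  by have [_ ->] := s1E x xs; rewrite ge_max lexx/= lr// El.
exists (s1 ++ s2); split.
- rewrite cat_uniq us1 us2 andbT/=; apply/hasPn => z zs2; apply/negP => zs1.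
  have := s12 z z zs1 zs2; rewrite subrr enorm0 maxxx leNgt; have [_ ->] := s1E z zs1.
  by rewrite r0.
- by move=> x; rewrite mem_cat => /orP[/s1E[]//|/s2E[]].
- move=> x z; rewrite !mem_cat => /orP[xs|xs] /orP[zs|zs] xz.
  + have [_ ->] := s1E x xs; have [_ ->] := s1E z zs; rewrite maxxx; exact: sep1.
  + by rewrite enormB; exact: s12.
  + by rewrite maxC; exact: s12.
  + exact: sep2.
- move=> y Ey; have [[x xs1 yx]|h] := pselect (exists2 x, x \in s1 & enorm (y - x) < r).
    by exists x; rewrite ?mem_cat ?xs1//; have [_ ->] := s1E x xs1.
  have [|x xs2 yx] := cov2 y; last by exists x; rewrite ?mem_cat ?xs2 ?orbT.
  by split => // x xs1; rewrite leNgt; apply/negP => yx; apply: h; exists x.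
Qed.

End Covering.

(** * Points of density zero of one measure with respect to another *)

Section DensityZero.
Context {R : realType} {n : nat}.
Local Notation V := 'rV[R]_n.
Local Notation B := (@Borel R n).
Variables (th m : {measure set B -> \bar R}).
Hypotheses (thT : (th setT < +oo)%E) (mT : (m setT < +oo)%E).

(** Summing over the chosen balls, [lam * m W] is at most the sum of their [th]-measures, and
    bounded overlap inside [U] bounds this by [N * th U]. *)
Lemma finite_covering_measure : exists N : nat, forall (C : set V) (l : seq R)
    (rho : V -> R) (E U : set V) (lam : R), compact C -> E `<=` C ->
  (forall r, r \in l -> 0 < r) -> (forall x, E x -> rho x \in l) -> open U -> 0 < lam ->
  (forall x, E x -> eball x (rho x) `<=` U) ->
  (forall x, E x -> (lam%:E * m (eball x (rho x)) <= th (eball x (rho x)))%E) ->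
  exists W : set V, [/\ measurable (W : set B), E `<=` W &
    (lam%:E * m W <= N%:R%:E * th U)%E].
Proof.
have [N NP] := @overlap_bound R n; exists N => C l rho E U lam cC EC l0 El oU lam0 EU Elam.
have [s [us sE sep cov]] := finite_covering cC EC l0 El.
have mB x : measurable (eball x (rho x) : set B) by exact: borel_eball.
pose W : set V := \big[setU/set0]_(x <- s) eball x (rho x).
exists W; split.
- by apply: bigsetU_measurable.
- move=> y /cov[x xs yx]; rewrite /W -bigcup_seq; exists x => //.
apply: (@le_trans _ _ (\sum_(x <- s) th (eball x (rho x)))%E).
  apply: (@le_trans _ _ (\sum_(x <- s) lam%:E * m (eball x (rho x)))%E); last first.
    by rewrite big_seq [leRHS]big_seq; apply: lee_sum => x xs; apply: Elam; exact: sE.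
  rewrite -ge0_sume_distrr// lee_pmul2l ?lte_fin//.
  rewrite /W; elim: (s) => [|x t IH]; first by rewrite !big_nil measure0.
  rewrite !big_cons; apply: (le_trans (measureU2 _ _ _)) => //.
    by apply: bigsetU_measurable.
  by rewrite leeD2l.
have -> : (\sum_(x <- s) th (eball x (rho x)) =
    \int[th]_y \sum_(x <- s) (\1_(eball x (rho x)) y)%:E)%E.
  rewrite ge0_integral_sum//.
  - by apply: eq_bigr => x _; rewrite integral_indic// setIT.
  - by move=> x; apply/measurable_EFinP; exact: measurable_indic.
have mU : measurable (U : set B) by exact: borel_open.
have <- : (\int[th]_y (N%:R * \1_U y)%:E = N%:R%:E * th U)%E.
  under eq_integral do rewrite EFinM.
  rewrite ge0_integralZl//; last by apply/measurable_EFinP; exact: measurable_indic.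
  by rewrite integral_indic// setIT.
apply: ge0_le_integral => //.
- by move=> y ?; apply: sume_ge0.
- by apply: emeasurable_sum => x; apply/measurable_EFinP; exact: measurable_indic.
- apply/measurable_EFinP; apply: measurable_funM; first exact: measurable_cst.
  exact: measurable_indic.
move=> y _; rewrite sumEFin lee_fin.
have -> : \sum_(x <- s) \1_(eball x (rho x)) y = (count (fun x => (enorm (y - x) < rho x)%R) s)%:R :> R.
  elim: (s) => [|x t IH]; first by rewrite big_nil.
  rewrite big_cons IH /= natrD indicE; congr (_%:R + _).
  by rewrite -[in RHS](asboolb (_ < _)).
have [Uy|Uy] := pselect (U y).
  by rewrite indicE mem_set// mulr1 ler_nat; exact: NP.
rewrite (_ : count _ s = 0%N) ?mulr_ge0//.
apply/eqP; rewrite -leqn0 leqNgt -has_count; apply/hasPn => x xs.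
by apply/negP => yx; apply: Uy; exact: (EU x (sE x xs)).
Qed.

(** Continuity from below for sets that need not be measurable: the covers [W k] are replaced by
    their lower limit. *)
Lemma liminf_cover (E : nat -> set V) (W : nat -> set V) (b : \bar R) :
  (forall k, measurable (W k : set B)) -> (forall k, E k `<=` W k) ->
  (forall k l, (k <= l)%N -> E k `<=` E l) -> (forall k, (m (W k) <= b)%E) ->
  exists Z : set V, [/\ measurable (Z : set B), \bigcup_k E k `<=` Z & (m Z <= b)%E].
Proof.
move=> mW EW nE Wb; pose F k : set V := \bigcap_(l in [set l | (k <= l)%N]) W l.
have mF k : measurable (F k : set B) by apply: bigcap_measurable => //; exists k => /=.
exists (\bigcup_k F k); split; first exact: bigcup_measurable.
  by move=> x [k _ Ex]; exists k => // l /= kl; apply: EW; exact: nE Ex.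
have ndF : nondecreasing_seq F.
  by move=> k l kl; apply/subsetPset => x Fx i /= li; apply: Fx => /=; exact: leq_trans li.
have mUF : measurable (\bigcup_k F k : set B) by exact: bigcup_measurable.
have := nondecreasing_cvg_mu (mu := m) mF mUF ndF; move/cvg_lim => <-//.
apply: lime_le; first by apply/cvg_ex; exists (m (\bigcup_k F k)); exact: nondecreasing_cvg_mu.
apply: nearW => k /=; apply: le_trans (Wb k); apply: le_measure; rewrite ?inE//.
by move=> x Fx; apply: Fx => /=.
Qed.

(** Shrinking the radius slightly keeps a strict inequality, as [th] is continuous from below and
    [m] is monotone. Rational radii can then be exhausted by finite lists, as the covering lemma
    demands. *)
Lemma eball_rational (x : V) (r lam : R) : 0 < r -> 0 <= lam ->
  (lam%:E * m (eball x r) < th (eball x r))%E ->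
  exists q : rat, [/\ 0 < (ratr q : R), ratr q < r &
    (lam%:E * m (eball x (ratr q)) <= th (eball x (ratr q)))%E].
Proof.
move=> r0 lam0 h; pose F (k : nat) : set V := eball x (r - r / k.+2%:R).
have mF k : measurable (F k : set B) by exact: borel_eball.
have FU : \bigcup_k F k = eball x r.
  rewrite eqEsubset; split=> y.
    move=> [k _]; rewrite /F /eball/= => /lt_trans; apply.
    by rewrite ltrBlDr ltrDl divr_gt0.
  rewrite /eball/= => yr; have d0 : 0 < (r - enorm (y - x)) / r by rewrite divr_gt0// subr_gt0.
  have /ltr_add_invr[k] := d0; rewrite add0r => hk; exists k => //; rewrite /F /eball/=.
  rewrite ltrBrDr -ltrBrDl; apply: (@le_lt_trans _ _ (r / k.+1%:R)).
    by rewrite ler_pM2l// lef_pV2 ?posrE// ler_nat.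
  by rewrite mulrC -ltr_pdivlMr.
have ndF : nondecreasing_seq F.
  move=> k l kl; apply/subsetPset => y; rewrite /F /eball/= => /lt_le_trans; apply.
  by rewrite lerD2l lerN2 ler_pM2l// lef_pV2 ?posrE// ler_nat !ltnS.
have mUF : measurable (\bigcup_k F k : set B) by exact: bigcup_measurable.
have [k hk] : exists k, (lam%:E * m (eball x r) < th (F k))%E.
  apply: contrapT => /forallNP nh.
  have := nondecreasing_cvg_mu (mu := th) mF mUF ndF; rewrite FU => cF.
  have : (th (eball x r) <= lam%:E * m (eball x r))%E.
    rewrite -(cvg_lim _ cF)//; apply: lime_le; first by apply/cvg_ex; exists (th (eball x r)).
    by apply: nearW => k /=; rewrite leNgt; apply/negP; exact: nh.
  by rewrite leNgt h.
have rk : r - r / k.+2%:R < r by rewrite ltrBlDr ltrDl divr_gt0.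
have [q] := rat_in_itvoo rk; rewrite in_itv/= => /andP[q1 q2].
exists q; split => //.
  apply: le_lt_trans q1; rewrite subr_ge0 ler_pdivrMr// ler_peMr ?(ltW r0)//.
  by rewrite ler1n.
apply: (@le_trans _ _ (lam%:E * m (eball x r))%E).
  rewrite lee_wpmul2l ?lee_fin//; apply: le_measure; rewrite ?inE; try exact: borel_eball.
  by move=> y; rewrite /eball/= => /lt_trans; apply.
apply: (le_trans (ltW hk)); apply: le_measure; rewrite ?inE; try exact: borel_eball.
by move=> y; rewrite /F /eball/= => /lt_trans; apply.
Qed.

(** The bad points at level [lam] lie in [C], which has neighbourhoods [U] with [th U] arbitrarily
    small; the covering estimate bounds their [m]-measure by a fixed multiple of [th U / lam]. *)
Lemma density_zero (C : set V) : compact C -> th C = 0%E ->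
  {ae m, forall x, C x -> forall lam : R, 0 < lam -> exists2 d : R, 0 < d &
    forall r, 0 < r -> r < d -> (th (eball x r) <= lam%:E * m (eball x r))%E}.
Proof.
move=> cC thC; have [N NP] := finite_covering_measure.
pose bad (lam : R) : set V := [set x | C x /\ forall d : R, 0 < d -> exists r,
  [/\ 0 < r, r < d & (lam%:E * m (eball x r) < th (eball x r))%E]].
have small lam (e : R) : 0 < lam -> 0 < e ->
    exists Z : set V, [/\ measurable (Z : set B), bad lam `<=` Z & (m Z <= e%:E)%E].
  (* Chosen so that [N * e' <= lam * e]; the successor of [N] excludes division by zero. *)
  move=> lam0 e0; pose e' := e * lam / (N.+1%:R).
  have e'0 : 0 < e' by rewrite divr_gt0// mulr_gt0.
  have [D [U [cD oU DC CU nU]]] := borel_regular thT (borel_compact cC) e'0.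
  have thU : (th U <= e'%:E)%E.
    have D0 : th D = 0%E.
      apply/eqP; rewrite eq_le measure_ge0 andbT -thC; apply: le_measure; rewrite ?inE//.
        exact: borel_closed.
      exact: borel_compact.
    have mD := borel_closed cD; have mU := borel_open oU.
    apply: (@le_trans _ _ (th D + th (U `\` D))%E); last by rewrite D0 add0e ltW.
    rewrite -[in leLHS](setDUK (subset_trans DC CU)); apply: measureU2 => //.
    exact: measurableD.
  pose q (k : nat) : R := if choice.unpickle k is Some r then ratr (r : rat) else 1.
  pose ok x r := [/\ 0 < r, eball x r `<=` U & (lam%:E * m (eball x r) <= th (eball x r))%E].
  (* Bad points detected by one of the first [k] rational radii: finitely many radii for each [k],
     and all bad points in the union. *)
  pose E k : set V := [set x | C x /\ exists2 j, (j < k)%N & ok x (q j)].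
  have EW k : exists W : set V, [/\ measurable (W : set B), E k `<=` W & (m W <= e%:E)%E].
    have /choice[rho rhoP] : forall x, exists r, E k x -> ok x r /\ exists2 j, (j < k)%N & r = q j.
      move=> x; have [[Cx [j jk okj]]|h] := pselect (E k x); last by exists 0.
      by exists (q j) => _; split => //; exists j.
    pose l := [seq r <- [seq q j | j <- iota 0 k] | 0 < r].
    have [|||||||W [mW EW hW]] := NP C l rho (E k) U lam cC.
    - by move=> x [].
    - by move=> r; rewrite mem_filter => /andP[].
    - move=> x /rhoP[[r0 _ _] [j jk rj]]; rewrite mem_filter r0/= rj map_f// mem_iota//.
    - by [].
    - by [].
    - by move=> x /rhoP[[]].
    - by move=> x /rhoP[[]].
    exists W; split => //.
    rewrite -(@lee_pmul2l _ lam%:E) ?lte_fin//; apply: (le_trans hW).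
    apply: (@le_trans _ _ (N%:R%:E * e'%:E)%E); first by rewrite lee_wpmul2l// lee_fin.
    rewrite -!EFinM lee_fin /e' mulrCA [leRHS]mulrC ler_piMr//.
      by rewrite mulr_ge0// ltW.
    by rewrite ler_pdivrMr// mul1r ler_nat.
  have /choice[W WP] := EW.
  have [||||Z [mZ EZ hZ]] := @liminf_cover E W e%:E.
  - by move=> k; case: (WP k).
  - by move=> k; case: (WP k).
  - by move=> k l kl x [Cx [j jk okj]]; split => //; exists j => //; exact: leq_trans kl.
  - by move=> k; case: (WP k).
  exists Z; split => // x [Cx xbad]; apply: EZ.
  have /nbhs_eballP[d d0 dU] : nbhs x U by apply: open_nbhs_nbhs; split => //; exact: CU.
  have [r [r0 rd hr]] := xbad d d0.
  have [p [p0 pr hp]] := eball_rational r0 (ltW lam0) hr.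
  exists (choice.pickle p).+1 => //; split => //; exists (choice.pickle p) => //.
  rewrite /q choice.pickleK; split => // y; rewrite /eball/= => yp; apply: dU.
  by rewrite /eball/= (lt_trans yp)// (lt_trans pr).
have neg lam : 0 < lam -> m.-negligible (bad lam : set B).
  move=> lam0.
  have /choice[Z ZP] : forall k : nat, exists Z : set V, [/\ measurable (Z : set B),
      bad lam `<=` Z & (m Z <= (k.+1%:R^-1)%:E)%E].
    by move=> k; apply: small.
  exists (\bigcap_k Z k); split.
  - by apply: bigcapT_measurable => k; case: (ZP k).
  - apply/eqP; rewrite eq_le measure_ge0 andbT; apply/lee_addgt0Pr => e e0; rewrite add0e.
    have /ltr_add_invr[k] := e0; rewrite add0r => ke.
    apply: (@le_trans _ _ (k.+1%:R^-1)%:E); last by rewrite lee_fin ltW.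
    have [mZ _ Zk] := ZP k; apply: le_trans Zk; apply: le_measure; rewrite ?inE//.
      by apply: bigcapT_measurable => j; case: (ZP j).
    exact: bigcap_inf.
  - by move=> x bx k _; case: (ZP k) => _ + _; apply.
have : m.-negligible (\bigcup_k bad (k.+1%:R^-1) : set B).
  by apply: negligible_bigcup => k; apply: neg; rewrite invr_gt0.
apply: negligibleS => x /= h; apply: contrapT => hx; apply: h => Cx lam lam0.
have /ltr_add_invr[k] := lam0; rewrite add0r => klam.
apply: contrapT => /forall2NP nd; apply: hx; exists k => //; split => // d d0.
have [//|/existsNP[r /not_implyP[r0 /not_implyP[rd /negP]]]] := nd d.
rewrite -ltNge => hr; exists r; split => //; apply: le_lt_trans hr.
by rewrite lee_wpmul2r// lee_fin ltW.
Qed.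

End DensityZero.

(** * Densities of divergence-free measures belong to the bundle *)

Section DecompDensity.
Context {R : realType} {n : nat}.
Local Notation V := 'rV[R]_n.
Local Notation B := (@Borel R n).

Lemma Rintegral_bound (nu : {measure set B -> \bar R}) (A : set B) (f : V -> R) (M : R) :
  (nu setT < +oo)%E -> measurable A -> measurable_fun A (f : B -> R) ->
  0 <= M -> (forall x, A x -> `|f x| <= M) -> `|\int[nu]_(x in A) f x| <= M * fine (nu A).
Proof.
move=> nuT mA mf M0 fM; have fi := bounded_integrable nuT mA mf fM.
apply: (le_trans (le_normr_Rintegral mA fi)); rewrite -Rintegral_cst//.
apply: le_Rintegral => //.
  have := integrable_abse fi; rewrite (_ : abse \o _ = EFin \o (fun x => `|f x|))//.
by apply: (bounded_integrable nuT (M := M)) => // x _; rewrite ger0_norm.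
Qed.

Variables (mu nu : {measure set B -> \bar R}) (tau s : V -> V) (Om C : set V).
Hypothesis mOm : measurable (Om : set B).
Let m : {measure set B -> \bar R} := mrestr mu mOm.
Hypotheses (oOm : open Om) (mT : (m setT < +oo)%E) (ft : finite_vmeasure nu tau)
  (dt : divfree nu tau) (tau1 : forall x i, `|tau x 0 i| <= 1)
  (cC : compact C) (COm : C `<=` Om) (ms : measurable_fun (C : set B) (s : B -> B))
  (cs : {within C, continuous s}).
Hypothesis sE : forall A i, measurable (A : set B) -> A `<=` C ->
  \int[nu]_(x in A) (tau x 0 i) = \int[m]_(x in A) (s x 0 i).

Let mC : measurable (C : set B). Proof. exact: borel_compact. Qed.
Let mC' : measurable (~` C : set B). Proof. exact: measurableC. Qed.

(** Collects what continuity of [s] on [C] does not control: the parts of both [nu] and [m] outside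
    [C]. It vanishes on [C], so [density_zero] applies. *)
Let th : {measure set B -> \bar R} := mrestr (measure_add nu m) mC'.

Let nuT : (nu setT < +oo)%E. Proof. by case: ft. Qed.

Let thE (D : set B) : th D = (nu (D `\` C) + m (D `\` C))%E.
Proof. by rewrite setDE -measure_addE. Qed.

Let thT : (th setT < +oo)%E.
Proof.
rewrite thE lte_add_pinfty//.
  by apply: finite_measure_lty => //; exact: measurableD.
by apply: (finite_measure_lty mT); exact: measurableD.
Qed.

Let th_out (D : set V) : measurable (D : set B) ->
  fine (nu (D `\` C)) <= fine (th D) /\ fine (m (D `\` C)) <= fine (th D).
Proof.
move=> mD; have mDC : measurable (D `\` C : set B) by exact: measurableD.
have fn := finite_measure_fin nuT mDC; have fm := finite_measure_fin mT mDC.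
rewrite thE fineD//.
by rewrite lerDl lerDr !fine_ge0.
Qed.

Let mtau i A : measurable (A : set B) -> measurable_fun (A : set B) ((fun x => tau x 0 i) : B -> R).
Proof. by move=> mA; apply: measurable_coord; apply: measurable_funTS; case: ft => _ []. Qed.

(** On [C] the vector measure is [s m] and [s] oscillates by at most [lam]; outside [C] the
    coordinates of [tau] are at most 1 and those of [s x] at most [c], which is charged to [th]. *)
Lemma restr_diff_bound (x : V) (r lam c : R) (E : set V) : measurable (E : set B) ->
  eball x r `<=` Om -> 0 <= lam -> (forall i, `|s x 0 i| <= c) -> 0 <= c ->
  (forall y i, C y -> eball x r y -> `|s y 0 i - s x 0 i| <= lam) ->
  enorm (restr_diff nu mu tau (s x) x r E) <=
    n%:R * (lam * fine (m (E `&` eball x r)) + (1 + c) * fine (th (E `&` eball x r))).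
Proof.
move=> mE rOm lam0 sc c0 sl; set D := E `&` eball x r.
have mD : measurable (D : set B) by apply: measurableI => //; exact: borel_eball.
have mDC : measurable (D `&` C : set B) by exact: measurableI.
have mDN : measurable (D `\` C : set B) by exact: measurableD.
have muD : mu D = m D.
  by rewrite /m/= /mrestr setIidl// => y [_ /rOm].
have [h1 h2] := th_out mD.
apply: (le_trans (enorm_le_sum _)); rewrite mulr_natl -[X in _ *+ X](card_ord n) -sumr_const.
apply: ler_sum => i _; rewrite /restr_diff -/D /vmeasure !mxE muD.
have iD := bounded_integrable nuT mD (mtau i mD) (fun y _ => tau1 y i).
have dis : [disjoint D `&` C & D `\` C].
  by apply/eqP; rewrite setDE setIACA setICr setI0.
have DU : D = (D `&` C) `|` (D `\` C) by rewrite setUIDK.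
have -> : \int[nu]_(y in D) tau y 0 i =
   \int[m]_(y in D `&` C) s y 0 i + \int[nu]_(y in D `\` C) tau y 0 i.
  rewrite [in LHS]DU Rintegral_setU//; last by rewrite -DU.
  by rewrite sE//; apply: subIsetr.
have fm1 := finite_measure_fin mT mDC; have fm2 := finite_measure_fin mT mDN.
have mm : fine (m D) = fine (m (D `&` C)) + fine (m (D `\` C)).
  rewrite -fineD// {1}DU measureU//.
  by apply/eqP; rewrite setDE setIACA setICr setI0.
have ms' : measurable_fun (D `&` C : set B) ((fun y => s y 0 i) : B -> R).
  by apply: measurable_coord; apply: measurable_funS ms => //; apply: subIsetr.
have is' : m.-integrable (D `&` C : set B) (EFin \o (fun y => s y 0 i)).
  apply: (bounded_integrable mT (M := lam + c)) => // y [[_ yr] Cy].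
  rewrite -[s y 0 i](subrK (s x 0 i)); apply: (le_trans (ler_normD _ _)).
  by rewrite lerD// sl.
have -> : \int[m]_(y in D `&` C) s y 0 i + \int[nu]_(y in D `\` C) tau y 0 i - fine (m D) * s x 0 i =
    \int[m]_(y in D `&` C) (s y 0 i - s x 0 i) + (\int[nu]_(y in D `\` C) tau y 0 i -
    fine (m (D `\` C)) * s x 0 i).
  rewrite RintegralB//; last first.
    by apply: (bounded_integrable mT (M := c)) => // y _; exact: sc.
  by rewrite Rintegral_cst// mm; ring.
have b1 : `|\int[m]_(y in D `&` C) (s y 0 i - s x 0 i)| <= lam * fine (m (D `&` C)).
  apply: Rintegral_bound => //.
    by apply: measurable_funB => //; exact: measurable_cst.
  by move=> y [[_ yr] Cy]; exact: sl.
have b2 : `|\int[nu]_(y in D `\` C) tau y 0 i| <= 1 * fine (nu (D `\` C)).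
  by apply: Rintegral_bound => //; exact: mtau.
have b3 : `|fine (m (D `\` C)) * s x 0 i| <= fine (m (D `\` C)) * c.
  by rewrite normrM ger0_norm ?fine_ge0// ler_wpM2l// fine_ge0.
apply: (le_trans (ler_normD _ _)); apply: lerD.
  apply: (le_trans b1); rewrite ler_wpM2l// mm lerDl fine_ge0//.
apply: (le_trans (ler_normB _ _)); rewrite mulrDl; apply: lerD.
  exact: (le_trans b2 (ler_wpM2l _ h1)).
apply: (le_trans b3); rewrite mulrC ler_wpM2l//.
Qed.

Lemma mass_restr_diff_bound (x : V) (r lam c : R) :
  eball x r `<=` Om -> 0 <= lam -> (forall i, `|s x 0 i| <= c) -> 0 <= c ->
  (forall y i, C y -> eball x r y -> `|s y 0 i - s x 0 i| <= lam) ->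
  (mass (restr_diff nu mu tau (s x) x r) <=
    (n%:R * (lam * fine (m (eball x r)) + (1 + c) * fine (th (eball x r))))%:E)%E.
Proof.
move=> rOm lam0 sc c0 sl; have mb : measurable (eball x r : set B) by exact: borel_eball.
have c10 : 0 <= 1 + c by rewrite addr_ge0.
have n0 : 0 <= n%:R :> R by [].
(* Regarding the bound as a measure of [E] makes it summable over any partition in the definition of
   [mass]. *)
pose ka : {measure set B -> \bar R} := mscale (NngNum n0)
  (measure_add (mscale (NngNum lam0) (mrestr m mb)) (mscale (NngNum c10) (mrestr th mb))).
have kaE (E : set B) : measurable E ->
    ka E = (n%:R * (lam * fine (m (E `&` eball x r)) + (1 + c) * fine (th (E `&` eball x r))))%:E.
  move=> mE; have mEb : measurable (E `&` eball x r) by exact: measurableI.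
  have -> : ka E = (n%:R%:E * (lam%:E * m (E `&` eball x r) + (1 + c)%:E * th (E `&` eball x r)))%E.
    by rewrite -[in RHS]/(mrestr m mb E) -[in RHS]/(mrestr th mb E) -[in RHS]/(mscale (NngNum lam0) _ _)
      -[in RHS]/(mscale (NngNum c10) _ _) -measure_addE.
  by rewrite EFinM (EFinD (lam * _)) !EFinM !fineK//; [exact: finite_measure_fin thT _ mEb|exact: finite_measure_fin mT _ mEb].
apply: ge_ereal_sup => _ [F [mF [tF UF]] <-].
apply: (@le_trans _ _ (\sum_(k <oo) ka (F k))%E).
  apply: lee_nneseries => k *; first by rewrite lee_fin enorm_ge0.
  by rewrite kaE// lee_fin; exact: restr_diff_bound.
by rewrite -measure_semi_bigcup// UF// kaE// setTI.
Qed.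

(** The same measure [tau nu] witnesses membership at almost every point of [C]: the ratio tends to
    0 because [s] is continuous on [C] and [th] has density zero there. *)
Theorem decomp_density : {ae m, forall x, C x -> in_decomp mu x (s x)}.
Proof.
have thC : th C = 0%E by rewrite thE setDv !measure0 adde0.
have := density_zero m thT cC thC.
apply: (@filterS _ _ (ae_filter_ringOfSetsType m)) => x h Cx; have {}h := h Cx.
exists nu, tau; do 2 split => //.
pose c := enorm (s x); have sc i : `|s x 0 i| <= c by exact: enorm_coord.
have c0 : 0 <= c by exact: enorm_ge0.
have [d0 d00 dOm] : exists2 d : R, 0 < d & eball x d `<=` Om.
  by apply/nbhs_eballP; apply: open_nbhs_nbhs; split => //; exact: COm.
(* On small balls the mass will be at most [n (1 + (1 + c)) lam] times the measure of the ball,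
   whence [lam = e / K]. *)
apply/cvgrPdist_le => e e0; pose K := n%:R * (1 + (1 + c)) + 1.
have K0 : 0 < K by rewrite ltr_wpDl// mulr_ge0// addr_ge0// addr_ge0.
pose lam := e / K; have lam0 : 0 < lam by rewrite divr_gt0.
have [d1 d10 h1] := h lam lam0.
have [d2 d20 h2] : exists2 d : R, 0 < d & forall y i, C y -> eball x d y -> `|s y 0 i - s x 0 i| <= lam.
  move/subspace_continuousP : cs => /(_ x Cx)/cvgrPdist_le/(_ lam lam0).
  move=> /nbhs_eballP[d d0' dP]; exists d => // y i Cy yd.
  have := dP y yd Cy; apply: le_trans.
  by have := norm_coord (s x - s y) i; rewrite !mxE distrC.
near=> r.
have r0 : 0 < r by near: r; exact: nbhs_right_gt.
have rd0 : r < d0 by near: r; exact: nbhs_right_lt.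
have rd1 : r < d1 by near: r; exact: nbhs_right_lt.
have rd2 : r < d2 by near: r; exact: nbhs_right_lt.
have rOm : eball x r `<=` Om.
  by move=> y yr; apply: dOm; rewrite /eball/= in yr *; exact: lt_trans rd0.
have mb : measurable (eball x r : set B) by exact: borel_eball.
have fm := finite_measure_fin mT mb; have fth := finite_measure_fin thT mb.
have := mass_restr_diff_bound rOm (ltW lam0) sc c0
  (fun y i Cy yr => h2 y i Cy (lt_trans yr rd2)).
have -> : mu (eball x r) = m (eball x r) by rewrite /m/= /mrestr setIidl.
have thb : fine (th (eball x r)) <= lam * fine (m (eball x r)).
  by rewrite -lee_fin EFinM !fineK//; exact: h1.
(* The partition into the whole space and empty sets shows that this supremum is nonnegative. *)
set ms' := mass _; have ms0 : (0 <= ms')%E.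
  apply: (@le_trans _ _ (\sum_(k <oo) (enorm (restr_diff nu mu tau (s x) x r (bigcup2 setT set0 k)))%:E)%E).
    by apply: nneseries_ge0 => k _ _; rewrite lee_fin enorm_ge0.
  apply: ereal_sup_ubound; exists (bigcup2 setT set0) => //; split.
    by move=> [|[|k]]//=; exact: measurable0.
  split; last by rewrite bigcup2E setU0.
  by apply/trivIsetP => -[|[|i]] [|[|j]]//= _ _ _; rewrite ?set0I ?setI0.
move=> msb; have fms : ms' \is a fin_num by rewrite ge0_fin_numE// (le_lt_trans msb)// ltry.
have {}msb : fine ms' <= n%:R * (lam * fine (m (eball x r)) + (1 + c) * fine (th (eball x r))).
  by rewrite -lee_fin fineK.
have mb0 : 0 <= fine (m (eball x r)) by exact: fine_ge0.
rewrite sub0r normrN ger0_norm; last by rewrite divr_ge0// fine_ge0.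
(* On a null ball the quotient is 0, since the inverse of 0 is 0. *)
move: mb0; rewrite le_eqVlt => /predU1P[<-|mb0]; first by rewrite invr0 mulr0 ltW.
rewrite ler_pdivrMr//; apply: (le_trans msb).
apply: (@le_trans _ _ (n%:R * (lam * fine (m (eball x r)) + (1 + c) * (lam * fine (m (eball x r)))))).
  by rewrite ler_wpM2l// lerD2l ler_wpM2l// addr_ge0.
set M := fine (m (eball x r)) in mb0 *.
have -> : n%:R * (lam * M + (1 + c) * (lam * M)) = (n%:R * (1 + (1 + c))) * lam * M by ring.
by rewrite ler_pM2r// /lam mulrCA ler_piMr ?(ltW e0)// ler_pdivrMr// mul1r /K lerDl.
Unshelve. all: by end_near. Qed.

End DecompDensity.

(** * The divergence-free part inside the bundle *)

Section LebesgueDecomposition.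
Context d (T : measurableType d) (R : realType).
Variables (nu m : {measure set T -> \bar R}).
Hypotheses (nuT : (nu setT < +oo)%E) (mT : (m setT < +oo)%E).

(** [D] is the set where the density of [m] with respect to [nu + m] is positive. If [m] vanishes on
    a subset of [D], the integral of a positive function over it is zero, so [nu + m] vanishes there
    too. *)
Lemma lebesgue_decomposition : exists D : set T, [/\ measurable D, m (~` D) = 0%E &
  forall E, measurable E -> E `<=` D -> m E = 0%E -> nu E = 0%E].
Proof.
pose rho : {measure set T -> \bar R} := measure_add nu m.
have rhoE (A : set T) : rho A = (nu A + m A)%E by exact: measure_addE.
have rhoT : (rho setT < +oo)%E by rewrite rhoE lte_add_pinfty.
have [|a [ma ia aE _]] := @radon_nikodym_real _ _ _ m rho mT rhoT.
  by move=> A mA /eqP; rewrite rhoE padde_eq0// => /andP[_ /eqP].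
pose D := [set x | 0 < a x].
have mD : measurable D.
  have -> : D = setT `&` a @^-1` `]0, +oo[%classic.
    by apply/seteqP; split=> x /=; rewrite in_itv/= andbT => // -[].
  exact: (ma measurableT _ (measurable_itv _)).
have mD' := measurableC mD.
exists D; split => //.
  apply/eqP; rewrite eq_le measure_ge0 andbT aE// -oppe_ge0 -integralN.
    by apply: integral_ge0 => x /= /negP; rewrite -leNgt lee_fin oppr_ge0.
  by apply: (integrable_add_def mD'); exact: (integrableS measurableT mD' (@subsetT _ _) ia).
move=> E mE ED mE0.
have : {ae rho, forall x, E x -> (EFin \o a) x = 0%E}.
  apply/(ae_eq_integral_abs rho mE); first by apply/measurable_EFinP; exact: measurable_funTS.
  rewrite -mE0 aE//; apply: eq_integral => x; rewrite inE => /ED ax.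
  by rewrite gee0_abs// lee_fin ltW.
move=> [N [mN rN EN]].
have : rho E = 0%E.
  apply/eqP; rewrite eq_le measure_ge0 andbT -rN; apply: le_measure; rewrite ?inE//.
  move=> x Ex; apply: EN => /= h; have [] := h Ex.
  by apply/eqP; rewrite gt_eqF//; exact: ED.
by move/eqP; rewrite rhoE padde_eq0// => /andP[/eqP].
Qed.

End LebesgueDecomposition.

Section Perp.
Context {R : realType} {n : nat}.
Local Notation V := 'rV[R]_n.
Local Notation B := (@Borel R n).
Variables (mu nu : {measure set B -> \bar R}) (tau f : V -> V) (Om : set V) (M : R).
Hypothesis mOm : measurable (Om : set B).
Let m : {measure set B -> \bar R} := mrestr mu mOm.
Hypotheses (oOm : open Om) (mT : (m setT < +oo)%E) (ft : finite_vmeasure nu tau)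
  (dt : divfree nu tau) (tau1 : forall x i, `|tau x 0 i| <= 1)
  (mf : measurable_fun setT (f : B -> B)) (fM : forall x i, `|f x 0 i| <= M)
  (fperp : {ae m, forall x, Om x -> forall v, in_decomp mu x v -> dotp (f x) v = 0}).

Let nuT : (nu setT < +oo)%E. Proof. by case: ft. Qed.
Let mtau : measurable_fun setT (tau : B -> B). Proof. by case: ft => _ []. Qed.

(** On the carrier [D] of [m] the measure [nu] is absolutely continuous, so there [tau nu = s m]
    with [s = e tau]. Almost every value [s x] lies in the bundle and is orthogonal to [f x]. *)
Lemma perp_carrier : exists D : set V, [/\ measurable (D : set B), m (~` D) = 0%E &
  \int[nu]_(x in D) dotp (f x) (tau x) = 0].
Proof.
have [D0 [mD0 D00 ac]] := lebesgue_decomposition nuT mT.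
pose D : set V := D0 `&` Om.
have mD : measurable (D : set B) by exact: measurableI.
have D'0 : m (~` D) = 0%E.
  apply/eqP; rewrite eq_le measure_ge0 andbT /D setCI.
  apply: (@le_trans _ _ (m (~` D0) + m (~` Om))%E); first by apply: measureU2; exact: measurableC.
  by rewrite D00 add0e /m/= /mrestr setICl measure0.
exists D; split => //.
pose al : {measure set B -> \bar R} := mrestr nu mD.
have alT : (al setT < +oo)%E by rewrite /al/= /mrestr setTI; exact: finite_measure_lty.
have [|e [me ie eE eI]] := @radon_nikodym_real _ _ _ al m alT mT.
  move=> A mA mA0; apply: ac; first exact: measurableI.
    by move=> x [_ []].
  apply/eqP; rewrite eq_le measure_ge0 andbT -mA0; apply: le_measure; rewrite ?inE//.
  exact: measurableI.
pose s x := e x *: tau x.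
have ms : measurable_fun setT (s : B -> B).
  apply: measurable_row => i; under eq_fun do rewrite mxE.
  by apply: measurable_funM => //; exact: measurable_coord.
have nual (A : set B) (w : B -> R) : measurable A -> A `<=` D ->
    \int[al]_(x in A) w x = \int[nu]_(x in A) w x.
  move=> mA AD; congr fine; apply: eq_measure_integral => E mE EA.
  by rewrite /al/= /mrestr setIidl// => x /EA /AD.
have transfer (A : set B) (w : B -> R) (b : R) : measurable A -> A `<=` D ->
    measurable_fun setT w -> (forall x, `|w x| <= b) ->
    \int[nu]_(x in A) w x = \int[m]_(x in A) (w x * e x).
  move=> mA AD mw wb; rewrite -nual// Rintegral_mkcond -(eI _ (`|b|)).
  - rewrite [RHS]Rintegral_mkcond; apply: eq_Rintegral => x _.
    by rewrite /patch; case: ifP => //; rewrite mul0r.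
  - by apply/measurable_restrict => //; rewrite setTI; exact: measurable_funTS.
  - move=> x; rewrite /patch; case: ifP => _; last by rewrite normr0.
    by rewrite (le_trans (wb x))// ler_norm.
have zero : {ae m, forall x, D x -> dotp (f x) (s x) = 0}.
  (* [decomp_density] asks for a compact set on which the density is continuous; Lusin's theorem
     supplies such sets filling [D] up to a null set. *)
  have good k : exists C : set V, [/\ measurable (C : set B), C `<=` D,
      (m (D `\` C) < (k.+1%:R^-1 : R)%:E)%E & {ae m, forall x, C x -> dotp (f x) (s x) = 0}].
    have k0 : 0 < (k.+1%:R^-1 : R) by rewrite invr_gt0.
    have [C [cC CD mC cs]] := lusin_borel mT mD (measurable_funTS ms) k0.
    have mC' := borel_compact cC.
    have COm : C `<=` Om by move=> x /CD[].
    exists C; split => //.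
    have [|h] := pselect ({ae m, forall x, C x -> in_decomp mu x (s x)}); last first.
      case: h; apply: (@decomp_density R n mu nu tau s Om C mOm oOm mT ft dt tau1 cC COm
        (measurable_funTS ms) cs).
      move=> A i mA AC; rewrite (@transfer _ _ 1)//.
      + by apply: eq_Rintegral => x _; rewrite mxE mulrC.
      + by move=> x /AC /CD.
      + exact: measurable_coord.
    move=> h; apply: (@filterS2 _ _ (ae_filter_ringOfSetsType m) _ _ _ _ h fperp).
    by move=> x h1 h2 Cx; apply: h2; [exact: COm|exact: h1].
  have /choice[C CP] := good.
  have : m.-negligible (\bigcup_k [set x : B | ~ (C k x -> dotp (f x) (s x) = 0)]).
    by apply: negligible_bigcup => k; case: (CP k).
  move=> [N [mN N0 CN]].
  have mDC k : measurable (D `\` C k : set B) by case: (CP k) => mC _ _ _; exact: measurableD.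
  exists (N `|` \bigcap_k (D `\` C k)); split.
  - by apply: measurableU => //; apply: bigcapT_measurable.
  - have E0 : m (\bigcap_k (D `\` C k)) = 0%E.
      apply/eqP; rewrite eq_le measure_ge0 andbT; apply/lee_addgt0Pr => e' e0; rewrite add0e.
      have /ltr_add_invr[k] := e0; rewrite add0r => ke.
      apply: (@le_trans _ _ (k.+1%:R^-1)%:E); last by rewrite lee_fin ltW.
      have [mC _ /ltW Zk _] := CP k; apply: le_trans Zk; apply: le_measure; rewrite ?inE//.
        exact: bigcapT_measurable.
      exact: bigcap_inf.
    apply/eqP; rewrite eq_le measure_ge0 andbT.
    apply: (@le_trans _ _ (m N + m (\bigcap_k (D `\` C k)))%E).
      by apply: measureU2 => //; exact: bigcapT_measurable.
    by rewrite N0 E0 adde0.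
  - move=> x /= /not_implyP[Dx fx].
    have [[k Ck]|h] := pselect (exists k, C k x).
      by left; apply: CN; exists k => // h; apply: fx; exact: h.
    by right => k _; split => // Ck; apply: h; exists k.
have dotb x : `|dotp (f x) (tau x)| <= n%:R * M.
  rewrite /dotp; apply: (le_trans (ler_norm_sum _ _ _)).
  rewrite mulr_natl -[X in _ *+ X](card_ord n) -sumr_const; apply: ler_sum => i _.
  by rewrite normrM -[leRHS]mulr1 ler_pM.
rewrite (@transfer _ _ (n%:R * M))//; last exact: measurable_dotp.
rewrite /Rintegral (ae_eq_integral (cst 0%E)) ?integral0//.
- apply/measurable_EFinP; apply: measurable_funM; apply: measurable_funTS => //.
  exact: measurable_dotp.
- apply: (@filterS _ _ (ae_filter_ringOfSetsType m) _ _ _ zero) => x h Dx /=.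
  by rewrite mulrC -dotpZr h.
Qed.

End Perp.

(** * Approximation of orthogonal fields by gradients *)

Section TestFunctions.
Context {R : realType} {n : nat}.
Local Notation V := 'rV[R]_n.
Implicit Types (g h : V -> R) (i : 'I_n) (a b : R).

Lemma partial_comb a b g h i x : derivable g x (unitv i) -> derivable h x (unitv i) ->
  partial i (fun y => a * g y + b * h y) x = a * partial i g x + b * partial i h x.
Proof.
move=> dg dh; rewrite /partial.
have -> : (fun y => a * g y + b * h y) = (a \*: g + b \*: h) by [].
rewrite deriveD; [|exact: derivableZ|exact: derivableZ].
by rewrite (deriveZ a dg) (deriveZ b dh).
Qed.

Lemma smooth_comb a b g h : smooth g -> smooth h -> smooth (fun x => a * g x + b * h x).
Proof.
move=> sg sh; have E l : iter_partial l (fun x => a * g x + b * h x) =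
    fun x => a * iter_partial l g x + b * iter_partial l h x.
  elim: l => [//|i l IH]; rewrite /iter_partial/= -/(iter_partial l _) IH.
  apply/funext => x; rewrite -/(iter_partial l g) -/(iter_partial l h).
  by apply: partial_comb; [case: (sg l)|case: (sh l)].
move=> l; rewrite E; have [cg dg] := sg l; have [ch dh] := sh l; split.
  move=> x; apply: (@continuousD R R^o V); apply: continuousM; try exact: cst_continuous.
    exact: cg.
  exact: ch.
by move=> i x; apply: derivableD; apply: derivableZ.
Qed.

Lemma test_fun_comb a b g h : test_fun g -> test_fun h -> test_fun (fun x => a * g x + b * h x).
Proof.
move=> [sg [K1 [cK1 K10]]] [sh [K2 [cK2 K20]]]; split; first exact: smooth_comb.
exists (K1 `|` K2); split; first exact: compactU.
by move=> x /not_orP[h1 h2]; rewrite K10// K20// !mulr0 addr0.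
Qed.

Lemma grad_comb a b g h : test_fun g -> test_fun h ->
  grad (fun x => a * g x + b * h x) = fun x => a *: grad g x + b *: grad h x.
Proof.
move=> [sg _] [sh _]; apply/funext => x; apply/rowP => i; rewrite !mxE.
by apply: partial_comb; [case: (sg [::]) => _ + |case: (sh [::]) => _ +]; exact.
Qed.

Lemma test_fun0 : test_fun (fun _ : V => 0).
Proof.
have E (l : seq 'I_n) : iter_partial l (fun _ : V => 0) = (fun _ => 0) :> (V -> R).
  elim: l => [//|i l IH]; rewrite /iter_partial/= -/(iter_partial l _) IH.
  by apply/funext => x; rewrite /partial derive_cst.
split; last by exists set0; split => //; exact: compact0.
by move=> l; rewrite E; split; [exact: cst_continuous|move=> i x; exact: derivable_cst].
Qed.

Lemma test_fun_grad g : test_fun g -> Ccv (grad g).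
Proof.
move=> [sg [K [cK K0]]] i; under eq_fun do rewrite mxE.
split; first by case: (sg [:: i]).
exists K; split => // x Kx; rewrite /partial.
have clK : closed K by apply: compact_closed => //; exact: norm_hausdorff.
have : \forall y \near x, g y = (fun=> 0) y.
  have : nbhs x (~` K) by apply: open_nbhs_nbhs; split => //; exact: closed_openC.
  by apply: filterS => y; exact: K0.
by move/(near_eq_derive _) => ->; rewrite derive_cst.
Qed.

End TestFunctions.

Lemma summand_le (R : realDomainType) (x y z e : R) : 0 <= x -> 0 <= y -> 0 <= z ->
  x + y + z < e -> [/\ x <= e, y <= e & z <= e].
Proof. by move=> x0 y0 z0 h; split; lra. Qed.

Section GradientApproximation.
Context {R : realType} {n : nat}.
Local Notation V := 'rV[R]_n.
Local Notation B := (@Borel R n).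

Definition weighted_sup (phi : V -> R) (v : V -> V) : R :=
  sup (range (fun x => enorm (v x) / phi x)).

Lemma Ccv_bounded (v : V -> V) : Ccv v -> exists M, 0 < M /\ forall x, enorm (v x) <= M.
Proof.
move=> cv; have [M [M0 vM]] := Cc_bounded (Ccv_enorm cv); exists M; split => // x.
by apply: le_trans (vM x); exact: ler_norm.
Qed.

Section WeightedSup.
Variables (phi : V -> R) (c0 : R).
Hypotheses (c00 : 0 < c0) (phi0 : forall x, c0 <= phi x).

Let phi_gt0 x : 0 < phi x. Proof. exact: lt_le_trans (phi0 x). Qed.

Let has_sup_weighted v : Ccv v -> has_sup (range (fun x => enorm (v x) / phi x)).
Proof.
move=> cv; split; first by exists (enorm (v 0) / phi 0); exists 0.
have [M [M0 vM]] := Ccv_bounded cv; exists (M / c0) => _ [x _ <-].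
by rewrite ler_pM ?enorm_ge0 ?invr_ge0 ?(ltW (phi_gt0 x))// lef_pV2 ?posrE.
Qed.

Lemma weighted_sup_ge v x : Ccv v -> enorm (v x) <= weighted_sup phi v * phi x.
Proof.
by move=> cv; rewrite -ler_pdivrMr//; apply: (sup_upper_bound (has_sup_weighted cv)); exists x.
Qed.

Lemma weighted_sup_le v a : (forall x, enorm (v x) <= a * phi x) -> weighted_sup phi v <= a.
Proof.
move=> h; apply: ge_sup; first by exists (enorm (v 0) / phi 0); exists 0.
by move=> _ [x _ <-]; rewrite ler_pdivrMr.
Qed.

Lemma weighted_sup_ge0 v : Ccv v -> 0 <= weighted_sup phi v.
Proof.
move=> cv; have := weighted_sup_ge 0 cv => /(le_trans (enorm_ge0 _)).
by rewrite pmulr_lge0.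
Qed.

Lemma weighted_supD v1 v2 : Ccv v1 -> Ccv v2 ->
  weighted_sup phi (v1 + v2) <= weighted_sup phi v1 + weighted_sup phi v2.
Proof.
move=> c1 c2; apply: weighted_sup_le => x; rewrite mulrDl.
by apply: (le_trans (enormD _ _)); apply: lerD; exact: weighted_sup_ge.
Qed.

Lemma weighted_supZ a v : 0 <= a -> Ccv v -> weighted_sup phi (a *: v) = a * weighted_sup phi v.
Proof.
move=> a0 cv; have le b w : 0 < b -> Ccv w -> weighted_sup phi (b *: w) <= b * weighted_sup phi w.
  move=> b0 cw; apply: weighted_sup_le => x.
  by rewrite enormZ gtr0_norm// -mulrA ler_pM2l// weighted_sup_ge.
move: a0; rewrite le_eqVlt => /predU1P[<-|a0].
  rewrite mul0r scale0r; apply/eqP; rewrite eq_le; apply/andP; split.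
    by apply: weighted_sup_le => x; rewrite mul0r enorm0.
  by apply: weighted_sup_ge0; exact: Ccv0.
apply/eqP; rewrite eq_le le//= mulrC -ler_pdivlMr// mulrC.
have := @le a^-1 (a *: v); rewrite scalerA mulVf ?gt_eqF// scale1r invr_gt0.
by apply => //; exact: Ccv_scale.
Qed.

End WeightedSup.

(** Genuine functions bounded at every point: they form a vector space on which [L1norm] is a finite
    seminorm, without passing to classes modulo null sets. *)
Definition bounded_field (w : V -> V) := measurable_fun setT (w : B -> B) /\
  exists M, forall x, enorm (w x) <= M.

Lemma bounded_field_comb a (w1 w2 : V -> V) : bounded_field w1 -> bounded_field w2 ->
  bounded_field (a *: w1 + w2).
Proof.
move=> [m1 [M1 h1]] [m2 [M2 h2]]; split.
  apply: measurable_row => i; under eq_fun do rewrite !mxE.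
  apply: measurable_funD; last exact: measurable_coord.
  by apply: measurable_funM; [exact: measurable_cst|exact: measurable_coord].
exists (`|a| * M1 + M2) => x; apply: (le_trans (enormD _ _)); rewrite enormZ.
by rewrite lerD// ler_wpM2l.
Qed.

Lemma bounded_field0 : bounded_field (0 : V -> V).
Proof.
split; first by apply: measurable_row => i; under eq_fun do rewrite mxE; exact: measurable_cst.
by exists 0 => x; rewrite enorm0.
Qed.

Lemma bounded_fieldZ a (w : V -> V) : bounded_field w -> bounded_field (a *: w).
Proof. by move=> bw; rewrite -[_ *: _]addr0; apply: bounded_field_comb => //; exact: bounded_field0. Qed.

Lemma bounded_fieldD (w1 w2 : V -> V) : bounded_field w1 -> bounded_field w2 ->
  bounded_field (w1 + w2).
Proof. by move=> b1 b2; rewrite -[w1]scale1r; exact: bounded_field_comb. Qed.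

Lemma Ccv_bounded_field v : Ccv v -> bounded_field v.
Proof.
by move=> cv; split; [exact: Ccv_measurable|have [M [_ h]] := Ccv_bounded cv; exists M].
Qed.

Section L1.
Variable m : {measure set B -> \bar R}.
Hypothesis mT : (m setT < +oo)%E.

Definition L1norm (w : V -> V) : R := \int[m]_x enorm (w x).

Lemma bounded_field_integrable w : bounded_field w ->
  m.-integrable setT (EFin \o (fun x : B => enorm (w x))).
Proof.
move=> [mw [M wM]]; apply: (bounded_integrable mT (M := M)) => //; first exact: measurable_enorm.
by move=> x _; rewrite ger0_norm ?enorm_ge0.
Qed.

Lemma L1norm_ge0 w : 0 <= L1norm w.
Proof. by apply: Rintegral_ge0 => x _; exact: enorm_ge0. Qed.

Lemma L1normD w1 w2 : bounded_field w1 -> bounded_field w2 ->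
  L1norm (w1 + w2) <= L1norm w1 + L1norm w2.
Proof.
move=> b1 b2; rewrite /L1norm -RintegralD//; try exact: bounded_field_integrable.
apply: le_Rintegral => //.
- by apply: bounded_field_integrable; exact: bounded_fieldD.
- have := integrableD measurableT (bounded_field_integrable b1) (bounded_field_integrable b2).
  by apply: eq_integrable.
- by move=> x _; exact: enormD.
Qed.

Lemma L1normZ a w : 0 <= a -> bounded_field w -> L1norm (a *: w) = a * L1norm w.
Proof.
move=> a0 bw; rewrite /L1norm -RintegralZl//; last exact: bounded_field_integrable.
by apply: eq_Rintegral => x _; rewrite enormZ ger0_norm.
Qed.

Lemma L1norm_le w M : bounded_field w -> (forall x, enorm (w x) <= M) ->
  L1norm w <= M * fine (m setT).
Proof.
move=> bw wM; rewrite -Rintegral_cst//; apply: le_Rintegral => //.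
  exact: bounded_field_integrable.
by apply: (bounded_integrable mT (M := `|M|)) => // x _.
Qed.

Lemma L1norm_support w (A : set B) M : bounded_field w -> measurable A -> 0 <= M ->
  (forall x, enorm (w x) <= M) -> (forall x, ~ A x -> w x = 0) -> L1norm w <= M * fine (m A).
Proof.
move=> bw mA M0 wM w0; have iw := bounded_field_integrable bw.
have -> : L1norm w = \int[m]_(x in A) enorm (w x).
  rewrite [RHS]Rintegral_mkcond; apply: eq_Rintegral => x _.
  rewrite /patch; case: ifPn => // /negP; rewrite inE => Ax.
  by rewrite w0// enorm0.
rewrite -Rintegral_cst//; apply: le_Rintegral => //.
  exact: (integrableS measurableT mA (@subsetT _ _) iw).
by apply: (bounded_integrable mT (M := M)) => // x _; rewrite ger0_norm.
Qed.

End L1.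

Variables (mu : {measure set B -> \bar R}) (Om : set V) (f : V -> V) (phi : V -> R) (c0 : R).
Hypothesis mOm : measurable (Om : set B).
Let m : {measure set B -> \bar R} := mrestr mu mOm.
Hypotheses (oOm : open Om) (mT : (m setT < +oo)%E) (bf : bounded_field f)
  (fperp : {ae m, forall x, Om x -> forall v, in_decomp mu x v -> dotp (f x) v = 0})
  (cphi : continuous phi) (c00 : 0 < c0) (phi0 : forall x, c0 <= phi x)
  (fphi : forall x, enorm (f x) <= phi x).

(* By duality, the distance to be shown at most [1] equals the value of a functional vanishing on
   gradients, i.e. of the pairing of [f] with a divergence-free measure; there the absolutely
   continuous part contributes nothing. *)
Lemma duality_bound (l : (V -> V) * (V -> V) * R^o -> R) (C m' : R) : 0 <= C ->
  linear_on [set z | Ccv z.1.1 /\ bounded_field z.1.2] l ->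
  (forall z, Ccv z.1.1 -> bounded_field z.1.2 -> l z <= weighted_sup phi z.1.1 + C * L1norm m z.1.2) ->
  (forall g (t : R^o), test_fun g -> 0 <= t -> t * m' <= l (grad g, grad g - t *: f, t)) ->
  m' <= 1.
Proof.
move=> C0 ll lp lG; pose D := [set z : (V -> V) * (V -> V) * R^o | Ccv z.1.1 /\ bounded_field z.1.2].
have B0 := bounded_field0; have V0 : Ccv (0 : V -> V) by exact: Ccv0.
have ws0 : weighted_sup phi 0 = 0.
  apply/eqP; rewrite eq_le (weighted_sup_ge0 c00 phi0)// andbT.
  by apply: (weighted_sup_le c00 phi0) => x; rewrite mul0r enorm0.
have L10 : L1norm m 0 = 0.
  by apply/eqP; rewrite eq_le L1norm_ge0 andbT -(mul0r (fine (m setT))); apply: L1norm_le => // x; rewrite enorm0.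
have lin2 a b x y : D x -> D y -> l (a *: x + b *: y) = a * l x + b * l y.
  move=> Dx Dy; have l0 : l 0 = 0.
    by have := ll (-1) 0 0 (conj V0 B0) (conj V0 B0); rewrite scaler0 addr0; lra.
  have Dby : D (b *: y).
    by case: Dy => y1 y2; split => /=; [exact: Ccv_scale|exact: bounded_fieldZ].
  rewrite ll//; congr (_ + _); have := ll b y 0 Dy (conj V0 B0); rewrite addr0 l0 addr0//.
(* [S] is continuous for the weighted sup norm and [H] for the L^1 norm; [Tf = S + H] is the
   combination seen by gradients. *)
pose S v := l (v, 0, 0); pose H w := l (0, w, 0); pose Tf v := l (v, v, 0).
(* The dominating functional ignores the last coordinate, so [l] is bounded above by 0 on a whole
   line. *)
have lt0 (t : R^o) : l (0, 0, t) = 0.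
  have le (s : R^o) : l (0, 0, s) <= 0.
    by have := lp (0, 0, s) V0 B0; rewrite /= ws0 L10 mulr0 addr0.
  apply/eqP; rewrite eq_le le/=; have := lin2 (-1) 0 (0, 0, t) 0 (conj V0 B0) (conj V0 B0).
  have -> : (-1) *: ((0, 0, t) : (V -> V) * (V -> V) * R^o) + 0 *: 0 = (0, 0, - t).
    by rewrite scale0r addr0; congr (_, _, _); rewrite ?scaler0// scaleN1r.
  by have := le (- t); lra.
have split_l v w (t : R^o) : Ccv v -> bounded_field w -> l (v, w, t) = S v + H w.
  move=> cv bw.
  have -> : (v, w, t) = 1 *: (v, 0, 0) + 1 *: (0, w, t) :> (V -> V) * (V -> V) * R^o.
    by rewrite !scale1r; congr (_, _, _); rewrite ?addr0 ?add0r.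
  rewrite lin2 ?mul1r//; congr (_ + _).
  have -> : (0, w, t) = 1 *: (0, w, 0) + 1 *: (0, 0, t) :> (V -> V) * (V -> V) * R^o.
    by rewrite !scale1r; congr (_, _, _); rewrite ?addr0 ?add0r.
  by rewrite lin2 ?mul1r// lt0 addr0.
have H_le w : bounded_field w -> H w <= C * L1norm m w.
  by move=> bw; have := lp (0, w, 0) V0 bw; rewrite /= ws0 add0r.
have HB v w : bounded_field v -> bounded_field w -> H (v - w) = H v - H w.
  move=> bv bw; rewrite /H.
  have -> : (0, v - w, 0) = 1 *: (0, v, 0) + (-1) *: (0, w, 0) :> (V -> V) * (V -> V) * R^o.
    by rewrite scale1r scaleN1r -[RHS]/(0 - 0, v - w, 0 - 0) !subr0.
  by rewrite lin2// mul1r mulN1r.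
have S_le v : Ccv v -> S v <= weighted_sup phi v.
  by move=> cv; have := lp (v, 0, 0) cv B0; rewrite /= L10 mulr0 addr0.
have S_lin a b v1 v2 : Ccv v1 -> Ccv v2 ->
    S (fun x => a *: v1 x + b *: v2 x) = a * S v1 + b * S v2.
  move=> c1 c2; rewrite /S -lin2//; congr l.
  by rewrite -[RHS]/(a *: v1 + b *: v2, a *: 0 + b *: 0, a *: 0 + b *: 0) !scaler0 !addr0.
have Tf_lin a b v1 v2 : Ccv v1 -> Ccv v2 ->
    Tf (fun x => a *: v1 x + b *: v2 x) = a * Tf v1 + b * Tf v2.
  move=> c1 c2; rewrite /Tf -lin2//; last 2 first.
  - by split => //=; exact: Ccv_bounded_field.
  - by split => //=; exact: Ccv_bounded_field.
  by congr l; rewrite -[RHS]/(a *: v1 + b *: v2, a *: v1 + b *: v2, a *: 0 + b *: 0) !scaler0 addr0.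
have ws_le v a : 0 <= a -> (forall x, enorm (v x) <= a) -> weighted_sup phi v <= c0^-1 * a.
  move=> a0 va; apply: (weighted_sup_le c00 phi0) => x; apply: (le_trans (va x)).
  by rewrite mulrAC ler_peMl// mulrC ler_pdivlMr// mul1r.
have S_bound v a : 0 <= a -> Ccv v -> (forall x, enorm (v x) <= a) -> S v <= c0^-1 * a.
  by move=> a0 cv va; apply: (le_trans (S_le _ cv)); exact: ws_le.
have Tf_bound v a : 0 <= a -> Ccv v -> (forall x, enorm (v x) <= a) ->
    Tf v <= (c0^-1 + C * fine (m setT)) * a.
  move=> a0 cv va; have bv := Ccv_bounded_field cv.
  apply: (le_trans (lp (v, v, 0) cv bv)) => /=; rewrite mulrDl lerD//; first exact: ws_le.
  by rewrite -mulrA ler_wpM2l// mulrC; exact: L1norm_le.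
have [la [q [[laT mq] q1 qE laS la_ad]]] := vector_riesz S_lin S_bound.
have [nu [tau [[nuT mtau] tau1 tauE nuS _]]] := vector_riesz Tf_lin Tf_bound.
have grad0 : grad (fun _ : V => 0) = 0 :> (V -> V).
  apply/funext => x; apply/rowP => i; rewrite !mxE /partial.
  by rewrite (_ : (fun=> 0) = cst 0)// derive_cst.
have Hf : m' <= - H f.
  have := lG (fun=> 0) 1 test_fun0 ler01; rewrite grad0 mul1r scale1r split_l//; last first.
    by rewrite -[f]scale1r -scaleNr addrC; exact: bounded_field_comb.
  rewrite HB// /H /S; have := lt0 0; rewrite /=; lra.
have enorm_tau x : enorm (tau x) <= n%:R.
  apply: (le_trans (enorm_le_sum _)); rewrite -[leRHS]mulr_natl mulr1 -[X in _ *+ X](card_ord n) -sumr_const.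
  by apply: ler_sum => i _; exact: tau1.
have ft : finite_vmeasure nu tau.
  split; [exact: nuT|split => //]; apply: (bounded_integrable nuT (M := n%:R)) => //.
    exact: measurable_enorm.
  by move=> x _; rewrite ger0_norm ?enorm_ge0.
have dt : divfree nu tau.
  move=> g tg; have cg := test_fun_grad tg; rewrite tauE//.
  (* At [t = 0] the cone contains all gradients together with their negatives, so a lower bound on
     it forces [Tf] to vanish on gradients. *)
  have pos h : test_fun h -> 0 <= Tf (grad h).
    move=> th; have := lG h 0 th (lexx _); rewrite mul0r scale0r subr0//.
  apply/eqP; rewrite eq_le pos// andbT.
  have := pos _ (test_fun_comb (-1) 0 tg tg); rewrite grad_comb// Tf_lin//; lra.
have [mf [M0 fM0]] := bf.
pose M := `|M0| + 1; have Mgt : 0 < M by rewrite ltr_wpDl.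
have fM x : enorm (f x) <= M by apply: (le_trans (fM0 x)); rewrite /M; apply: ler_wpDr => //; exact: ler_norm.
have fMi x i : `|f x 0 i| <= M by apply: le_trans (fM x); exact: enorm_coord.
have [D' [mD D'0 Dint]] := @perp_carrier R n mu nu tau f Om M mOm oOm mT ft dt tau1 mf fMi fperp.
(* [F] equals [f] up to an [m]-null set, which [H] cannot see, while its pairing with [tau nu] is
   zero. *)
pose F x := \1_D' x *: f x.
have mF : measurable_fun setT (F : B -> B).
  apply: measurable_row => i; under eq_fun do rewrite mxE.
  by apply: measurable_funM; [exact: measurable_indic|exact: measurable_coord].
have F_le x : enorm (F x) <= enorm (f x).
  rewrite /F indicE; case: (_ \in _); rewrite ?scale1r ?scale0r ?enorm0 //; exact: enorm_ge0.
have FM x i : setT x -> `|F x 0 i| <= M.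
  by move=> _; apply: (le_trans (enorm_coord _ _)); exact: le_trans (F_le x) (fM x).
(* A single continuous approximation of [F] has to be good for the three measures behind [H], [Tf]
   and [S]; Lusin's theorem is applied to their sum. *)
pose ka : {measure set B -> \bar R} := measure_add (measure_add m nu) la.
have kaE A : ka A = (m A + nu A + la A)%E by rewrite -measure_addE -measure_addE.
have kaT : (ka setT < +oo)%E by rewrite kaE !lte_add_pinfty.
pose b := n%:R * M.
have b0 : 0 <= b by rewrite mulr_ge0// ltW.
have n0 : 0 <= n%:R :> R by [].
(* The chain of estimates: [m' <= - H f], which is close to [- H v = S v - Tf v] for the continuous
   [v]; [Tf v] is close to the pairing of [F] with [tau nu], which is 0, and [S v] exceeds 1 by
   little. The coefficient of [e] collects the errors of [estA], [estB] and [estC]. *)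
suff key (e : R) : 0 < e -> m' <= 1 + (C * (b + M) + (b + M) * n%:R + 1 + b) * e.
  pose K := C * (b + M) + (b + M) * n%:R + 1 + b; rewrite -/K in key.
  have K0 : 0 <= K by rewrite /K !addr_ge0 ?mulr_ge0 ?addr_ge0 ?(ltW Mgt).
  apply/ler_addgt0Pr => e e0; have K1 : 0 < K + 1 by rewrite ltr_wpDl.
  apply: (le_trans (key _ (divr_gt0 e0 K1))); rewrite lerD2l mulrCA ler_piMr ?(ltW e0)//.
  by rewrite ler_pdivrMr// mul1r lerDl.
move=> e0; have [K [v [[cK _] kaK cv vF vM]]] := lusin_Ccv kaT measurableT mF Mgt e0 FM.
have mK := borel_compact cK; have mK' := measurableC mK.
rewrite setTD kaE in kaK.
have [mKe nKe lKe] : [/\ fine (m (~` K)) <= e, fine (nu (~` K)) <= e & fine (la (~` K)) <= e].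
  have f1 := finite_measure_fin mT mK'; have f2 := finite_measure_fin nuT mK'.
  have f3 := finite_measure_fin laT mK'.
  have p1 : 0 <= fine (m (~` K)) by exact: fine_ge0.
  have p2 : 0 <= fine (nu (~` K)) by exact: fine_ge0.
  have p3 : 0 <= fine (la (~` K)) by exact: fine_ge0.
  move: kaK; rewrite -(fineK f1) -(fineK f2) -(fineK f3) -!EFinD lte_fin => h.
  exact: summand_le.
have bv := Ccv_bounded_field cv.
have vb x : enorm (v x) <= b.
  apply: (le_trans (enorm_le_sum _)); rewrite /b mulr_natl -[X in _ *+ X](card_ord n) -sumr_const.
  by apply: ler_sum => i _; exact: vM.
have estA : - H f <= - H v + C * (b + M) * e.
  have bvf : bounded_field (v - f) by rewrite -[f]scale1r -scaleNr addrC; exact: bounded_field_comb.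
  have mA : measurable (~` (K `&` D') : set B) by apply: measurableC; exact: measurableI.
  have : H (v - f) <= C * ((b + M) * e).
    apply: (le_trans (H_le _ bvf)); rewrite ler_wpM2l//.
    apply: (@le_trans _ _ ((b + M) * fine (m (~` (K `&` D'))))).
      apply: L1norm_support => //; first by rewrite addr_ge0// ltW.
        by move=> x; apply: (le_trans (enormD _ _)); rewrite enormN lerD.
      move=> x /contrapT[Kx Dx]; rewrite fctE /= vF// /F indicE mem_set// scale1r subrr//.
    rewrite ler_wpM2l ?addr_ge0 ?(ltW Mgt)//; apply: le_trans mKe.
    apply: fine_le; [exact: (finite_measure_fin mT)|exact: (finite_measure_fin mT)|].
    rewrite setCI; apply: (le_trans (measureU2 _ _ _)) => //; first exact: measurableC.
    by rewrite [X in (_ + X)%E](_ : _ = 0%E) ?adde0.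
  by rewrite HB// mulrA; lra.
have Tv : Tf v = S v + H v by rewrite /Tf split_l.
have iF : nu.-integrable setT (EFin \o (fun x => dotp (F x) (tau x))).
  apply: (bounded_integrable nuT (M := M * n%:R)) => //; first exact: measurable_dotp.
  move=> x _; apply: (le_trans (dotp_abs_le _ _)); rewrite ler_pM ?enorm_ge0//.
  exact: le_trans (F_le x) (fM x).
have iv : nu.-integrable setT (EFin \o (fun x => dotp (v x) (tau x))).
  apply: (bounded_integrable nuT (M := b * n%:R)) => //.
    by apply: measurable_dotp => //; exact: Ccv_measurable.
  by move=> x _; apply: (le_trans (dotp_abs_le _ _)); rewrite ler_pM ?enorm_ge0.
have F0 : \int[nu]_x dotp (F x) (tau x) = 0.
  rewrite -[RHS]Dint [RHS]Rintegral_mkcond; apply: eq_Rintegral => x _.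
  by rewrite /F dotpZl /patch indicE; case: ifP => _; rewrite ?mul1r ?mul0r.
have estB : - Tf v <= (b + M) * n%:R * e.
  rewrite -tauE// -[X in - X]subr0 -F0 -RintegralB//.
  have -> : \int[nu]_x (dotp (v x) (tau x) - dotp (F x) (tau x)) =
      \int[nu]_(x in ~` K) (dotp (v x) (tau x) - dotp (F x) (tau x)).
    rewrite [RHS]Rintegral_mkcond; apply: eq_Rintegral => x _.
    rewrite /patch; case: ifPn => //; rewrite notin_setE => /contrapT Kx.
    by rewrite vF// subrr.
  apply: (le_trans (ler_norm _)); rewrite normrN.
  apply: (@le_trans _ _ ((b + M) * n%:R * fine (nu (~` K)))); last first.
    by rewrite ler_wpM2l// mulr_ge0// addr_ge0// ltW.
  apply: Rintegral_bound => //.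
  - by apply: measurable_funTS; apply: measurable_funB; apply: measurable_dotp => //; exact: Ccv_measurable.
  - by rewrite mulr_ge0// addr_ge0// ltW.
  - move=> x _; rewrite -dotpBl; apply: (le_trans (dotp_abs_le _ _)); rewrite ler_pM ?enorm_ge0//.
    apply: (le_trans (enormD _ _)); rewrite enormN lerD//; exact: le_trans (F_le x) (fM x).
have [u [cu u01 u1 _]] := cutoff cK openT (@subsetT _ K).
have cw : Cc (fun x => u x * phi x) by exact: Cc_mul.
have phi_ge0 x : 0 <= phi x by exact: le_trans (ltW c00) (phi0 x).
have w0 x : 0 <= u x * phi x by rewrite mulr_ge0//; case/andP: (u01 x).
have estC : S v <= 1 + e + b * e.
  (* The integral of [u * phi] against the variation is nearly attained by some [S v'] with
     [|v'| <= phi], and such values are at most 1. *)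
  have [v' [cv' v'w h']] := la_ad _ _ cw w0 e0.
  have Sv' : S v' <= 1.
    apply: (le_trans (S_le _ cv')); apply: (weighted_sup_le c00 phi0) => x; apply: (le_trans (v'w x)).
    by rewrite ler_wpM2r//; case/andP: (u01 x).
  apply: (le_trans (laS _ cv)).
  have i1 : la.-integrable setT (EFin \o (fun x : B => b * \1_(~` K) x)).
    apply: (bounded_integrable laT (M := b)) => //.
      by apply: measurable_funM => //; exact: measurable_indic.
    by move=> x _; rewrite normrM !ger0_norm// ler_piMr// indicE; case: (_ \in _).
  have i2 := Cc_integrable laT cw.
  apply: (@le_trans _ _ (\int[la]_x (u x * phi x + b * \1_(~` K) x))).
    apply: le_Rintegral => //.
    - exact: (bounded_field_integrable laT bv).
    - have := integrableD measurableT i2 i1; apply: eq_integrable => //.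
    - move=> x _; have [Kx|Kx] := pselect (K x).
        rewrite vF// u1// mul1r; apply: (@le_trans _ _ (phi x)); first exact: le_trans (F_le x) (fphi x).
        by rewrite lerDl mulr_ge0.
      by rewrite indicE mem_set// mulr1 (le_trans (vb x))// lerDr.
  have i3 : la.-integrable setT (EFin \o (\1_(~` K) : B -> R)).
    by apply: (bounded_integrable laT (M := 1)) => //; move=> x _; rewrite indicE; case: (_ \in _); rewrite ?normr1 ?normr0.
  rewrite RintegralD// RintegralZl//.
  have -> : \int[la]_x \1_(~` K) x = fine (la (~` K)).
    by rewrite /Rintegral integral_indic// setIT.
  have : b * fine (la (~` K)) <= b * e by rewrite ler_wpM2l.
  by lra.
have -> : 1 + (C * (b + M) + (b + M) * n%:R + 1 + b) * e =
  C * (b + M) * e + (b + M) * n%:R * e + (1 + e + b * e) by ring.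
by lra.
Qed.

(** If no [g] works, then for every [g] either the weighted sup of the gradient exceeds [1 + d] or
    its L^1 distance to [f] exceeds [d], so the combined gauge [p] is at least [1 + d]. By
    homogeneity this extends to the cone spanned by the triples, and the separating functional
    contradicts [duality_bound]. *)
Theorem gradient_approximation (d : R) : 0 < d -> exists g : V -> R,
  [/\ test_fun g, forall x, enorm (grad g x) <= (1 + d) * phi x &
    L1norm m (fun x => grad g x - f x) <= d].
Proof.
move=> d0; apply: contrapT => /forallNP nog.
(* With this factor an L^1 distance above [d] contributes more than [1 + d] to [p]. *)
pose C := (1 + d) / d; have C0 : 0 <= C by rewrite divr_ge0 ?addr_ge0 ?ltW.
pose D : set ((V -> V) * (V -> V) * R^o) := [set z | Ccv z.1.1 /\ bounded_field z.1.2].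
pose p (z : (V -> V) * (V -> V) * R^o) := weighted_sup phi z.1.1 + C * L1norm m z.1.2.
pose G : set ((V -> V) * (V -> V) * R^o) :=
  [set z | exists g (t : R), [/\ test_fun g, 0 <= t & z = (grad g, grad g - t *: f, t)]].
(* Keeping [t] as a coordinate makes [c] a function of the triple even if [f] is zero, when the two
   fields do not determine [t]. *)
pose c (z : (V -> V) * (V -> V) * R^o) : R := z.2 * (1 + d).
have sD : linear_subspace D.
  split.
    change (Ccv (fun _ : V => 0 : V) /\ bounded_field (0 : V -> V)).
    by split; [exact: Ccv0|exact: bounded_field0].
  move=> a x y [x1 x2] [y1 y2]; split => /=.
    by apply: Ccv_add => //; exact: Ccv_scale.
  exact: bounded_field_comb.
have sp : sublinear_on D p.
  split.
    move=> x y [x1 x2] [y1 y2]; rewrite /p/= addrACA -mulrDr; apply: lerD.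
      exact: (weighted_supD c00 phi0).
    by rewrite ler_wpM2l// L1normD.
  move=> a x a0 [x1 x2]; rewrite /p/= (weighted_supZ c00 phi0)// L1normZ// mulrDr.
  by rewrite mulrCA.
have bgt g t : test_fun g -> bounded_field (grad g - t *: f).
  move=> tg; rewrite -scaleNr addrC; apply: bounded_field_comb => //.
  by apply: Ccv_bounded_field; exact: test_fun_grad.
have GD : G `<=` D.
  by move=> _ [g [t [tg t0 ->]]]; split => /=; [exact: test_fun_grad|exact: bgt].
have cG : cone G.
  split.
  - exists (fun=> 0), 0; split => //; first exact: test_fun0.
    have -> : grad (fun=> 0) = 0 :> (V -> V).
      apply/funext => x; apply/rowP => i; rewrite !mxE /partial.
      by rewrite (_ : (fun=> 0) = cst 0)// derive_cst.
    by rewrite scale0r subr0.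
  - move=> _ _ [g [t [tg t0 ->]]] [h [s [th s0 ->]]].
    exists (fun x => 1 * g x + 1 * h x), (t + s); split; [exact: test_fun_comb|exact: addr_ge0|].
    rewrite grad_comb//; congr (_, _, _).
      by apply/funext => x; rewrite !scale1r.
    apply/funext => x; rewrite !fctE !scale1r scalerDl opprD addrACA//.
  - move=> a _ a0 [g [t [tg t0 ->]]]; exists (fun x => a * g x + 0 * g x), (a * t).
    split; [exact: test_fun_comb|exact: mulr_ge0|].
    rewrite grad_comb//; congr (_, _, _).
      by apply/funext => x; rewrite scale0r addr0.
    by apply/funext => x; rewrite !fctE scale0r addr0 scalerBr scalerA.
have lc : cone_linear G c.
  split.
    by move=> _ _ [g [t [tg t0 ->]]] [h [s [th s0 ->]]]; rewrite /c/= mulrDl.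
  by move=> a _ a0 [g [t [tg t0 ->]]]; rewrite /c/= mulrA.
have far g : test_fun g -> 1 + d <= p (grad g, grad g - f, 1).
  move=> tg; have cg := test_fun_grad tg.
  have bg : bounded_field (grad g - f) by rewrite -[f]scale1r; exact: bgt.
  have [h|h] := ltP (1 + d) (weighted_sup phi (grad g)).
    by apply: (le_trans (ltW h)); rewrite /p/= lerDl mulr_ge0// L1norm_ge0.
  have {}h x : enorm (grad g x) <= (1 + d) * phi x.
    have px : 0 <= phi x by apply: le_trans (phi0 x); exact: ltW.
    apply: (le_trans (weighted_sup_ge c00 phi0 x cg)); exact: (ler_wpM2r px h).
  have : ~ (L1norm m (fun x => grad g x - f x) <= d) by move=> h'; apply: (nog g).
  move/negP; rewrite -ltNge => h'.
  rewrite /p/= -[leLHS]add0r lerD//; first exact: (weighted_sup_ge0 c00 phi0).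
  by rewrite /C mulrAC ler_pdivlMr// ler_pM2l ?ltW// addr_gt0.
have cp x : G x -> c x <= p x.
  move=> [g [t [tg t0 ->]]]; rewrite /c/=; move: t0; rewrite le_eqVlt => /predU1P[<-|t0].
    rewrite mul0r /p/= addr_ge0//; first by apply: (weighted_sup_ge0 c00 phi0); exact: test_fun_grad.
    by rewrite mulr_ge0// L1norm_ge0.
  have th : test_fun (fun x => t^-1 * g x + 0 * g x) by exact: test_fun_comb.
  have gE : grad (fun x => t^-1 * g x + 0 * g x) = t^-1 *: grad g.
    by rewrite grad_comb//; apply/funext => y; rewrite scale0r addr0.
  have := far _ th; rewrite gE -(ler_pM2l t0) => /le_trans; apply.
  have Dz : D (t^-1 *: grad g, t^-1 *: grad g - f, 1 : R^o).
    by have := GD (grad (fun x => t^-1 * g x + 0 * g x), grad (fun x => t^-1 * g x + 0 * g x) - 1 *: f, 1 : R^o);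
      rewrite gE scale1r; apply; exists (fun x => t^-1 * g x + 0 * g x), 1; rewrite gE scale1r.
  rewrite -(sp.2 _ _ (ltW t0) Dz) /p/= scalerBr !scalerA mulfV ?gt_eqF// !scale1r//.
have [l [ll lp lG]] := mazur_orlicz sD sp GD cG lc cp.
have : 1 + d <= 1.
  apply: (@duality_bound l C (1 + d) C0 ll).
  - by move=> z z1 z2; exact: lp.
  - by move=> g t tg t0; apply: (lG (grad g, grad g - t *: f, t)); exists g, t.
by rewrite gerDl leNgt d0.
Qed.

End GradientApproximation.

(** * Functions with continuous partial derivatives *)

Section ContinuousPartials.
Context {R : realType} {n : nat}.
Local Notation V := 'rV[R]_n.
Implicit Types (u : V -> R) (G : V -> V).

Lemma is_derive_line u (x v : V) (s d : R) :
  is_derive (x + s *: v) v u d <-> is_derive s 1 (fun t : R => u (x + t *: v)) d.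
Proof.
have E : (fun h : R => h^-1 *: (u (h *: v + (x + s *: v)) - u (x + s *: v))) =
    (fun h : R => h^-1 *: (u (x + (h *: (1 : R^o) + s) *: v) - u (x + s *: v))).
  by apply/funext => h; congr (_ *: (u _ - _)); rewrite scalerDl /GRing.scale/= mulr1 addrCA.
by split=> -[h1 h2]; split; move: h1 h2; rewrite /derivable /derive /= E.
Qed.

Lemma is_derive_comp (f : R -> R) u (x v : V) (a b : R) :
  is_derive (u x) 1 f a -> is_derive x v u b -> is_derive x v (fun y => f (u y)) (a * b).
Proof.
move=> fa; rewrite -[x in is_derive x](addr0 x) -(scale0r v) => /is_derive_line ub.
apply/is_derive_line; apply: (@is_derive1_comp _ f (fun t => u (x + t *: v))) => //.
by rewrite scale0r addr0.
Qed.

(** Carrying the gradient as an explicit function lets sums, products and series be built together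
    with their gradients; only the end result is translated to [C1_on]. *)
Definition has_grad u G := (forall (i : 'I_n) x, is_derive x (unitv i) u (G x 0 i)) /\
  forall i, continuous (fun x => G x 0 i).

Lemma has_gradE u G : has_grad u G -> grad u = G.
Proof.
move=> [uG _]; apply/funext => x; apply/rowP => i; rewrite mxE /partial.
by have [_] := uG i x.
Qed.

Lemma test_fun_has_grad u : test_fun u -> has_grad u (grad u).
Proof.
move=> [su _]; split=> i; last first.
  by have [+ _] := su [:: i]; rewrite (_ : (fun x => grad u x 0 i) = partial i u)//; apply/funext => x; rewrite mxE.
by move=> x; apply: DeriveDef; [have [_] := su [::]; exact|rewrite mxE].
Qed.

Lemma has_grad_add u G w H : has_grad u G -> has_grad w H ->
  has_grad (fun x => u x + w x) (fun x => G x + H x).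
Proof.
move=> [uG cG] [wH cH]; split=> i.
  move=> x; rewrite mxE; have h1 := uG i x; have h2 := wH i x; exact: is_deriveD.
have -> : (fun x => (G x + H x) 0 i) = (fun x => G x 0 i + H x 0 i) by apply/funext => x; rewrite mxE.
by move=> x; apply: continuousD; [exact: cG|exact: cH].
Qed.

Lemma has_grad_mvt u G (x : V) (i : 'I_n) (h : R) : has_grad u G ->
  exists2 xi, `|xi| <= `|h| & u (x + h *: unitv i) - u x = h * G (x + xi *: unitv i) 0 i.
Proof.
move=> [uG cG]; pose f (t : R) : R := u (x + t *: unitv i); pose df (t : R) : R := G (x + t *: unitv i) 0 i.
have fd (t : R) : is_derive t 1 f (df t) by apply/is_derive_line.
have cf a b : {within `[a, b], continuous f}.
  apply: continuous_subspaceT => t; apply: differentiable_continuous.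
  by apply/derivable1_diffP; have [] := fd t.
have f0 : f 0 = u x by rewrite /f scale0r addr0.
have [h0|h0] := leP 0 h.
  have [c + e] := @MVT_segment R f df 0 h h0 (fun t _ => fd t) (cf _ _).
  rewrite in_itv/= => /andP[c0 ch]; exists c; first by rewrite !ger0_norm// (le_trans c0).
  by rewrite -f0 -/(f h) e subr0 mulrC.
have [c + e] := @MVT_segment R f df h 0 (ltW h0) (fun t _ => fd t) (cf _ _).
rewrite in_itv/= => /andP[ch c0]; exists c.
  by rewrite ler0_norm// ltr0_norm// lerN2.
by rewrite -f0 -/(f h) -opprB e sub0r mulrN opprK mulrC.
Qed.

(** The vertices of the axis-parallel path from 0 to [h]. *)
Definition trunc (k : nat) (h : V) : V := \row_j (if (j < k)%N then h 0 j else 0).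

Lemma trunc_recr (i : 'I_n) h : trunc i.+1 h = trunc i h + h 0 i *: unitv i.
Proof.
apply/rowP => j; rewrite !mxE eqxx/= ltnS leq_eqVlt -val_eqE/=.
by case: eqVneq => [/val_inj ->|ne] /=; rewrite ?ltnn ?mulr1 ?add0r// mulr0 addr0.
Qed.

(** The increment of [u] is telescoped along the axis-parallel path; on each edge the mean value
    theorem produces a partial derivative at a point within [|h|] of [x], where continuity
    applies. *)
Lemma has_grad_differentiable u G (x : V) : has_grad u G -> differentiable u x.
Proof.
move=> uG; have [_ cG] := uG.
have lin : linear (dotp (G x) : V -> R^o).
  by move=> a v w; rewrite dotpDr dotpZr.
pose L : {linear V -> R^o} := HB.pack (dotp (G x) : V -> R^o)
  (GRing.isLinear.Build _ _ _ _ (dotp (G x) : V -> R^o) lin).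
have cL : continuous (L : V -> R).
  have -> : (L : V -> R) = (fun y => \sum_i G x 0 i * y 0 i) by [].
  apply: continuous_bigsum => i z; apply: (@continuousM R V (fun=> G x 0 i)); [exact: cst_continuous|exact: coord_continuous].
suff E : u \o shift x = cst (u x) + L +o_ (0 : V) id.
  apply/diff_locallyP; have -> := diff_unique cL E; split => //.
apply/eqaddoP => e e0.
pose e' := e / (n%:R + 1).
have e'0 : 0 < e' by rewrite divr_gt0// ltr_wpDl.
have : \forall y \near x, forall i, `|G x 0 i - G y 0 i| <= e'.
  apply: (@filter_forall V 'I_n (fun i y => `|G x 0 i - G y 0 i| <= e') (nbhs x) _) => i.
  by have /cvgrPdist_le/(_ _ e'0) := cG i x.
move=> /nbhs_ballP[d /= d0 hd].
near=> h.
have hd' : `|h| < d.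
  by near: h; apply/nbhs_ballP; exists d => // h; rewrite -ball_normE/= sub0r normrN.
rewrite fctE /= [X in `|X - _|](_ : _ = u (h + x))// fctE /=.
have tr0 : trunc 0 h = 0 by apply/rowP => j; rewrite !mxE ltn0.
have trn : trunc n h = h by apply/rowP => j; rewrite !mxE ltn_ord.
have -> : u (h + x) - (u x + dotp (G x) h) =
    \sum_(i < n) ((u (x + trunc i.+1 h) - u (x + trunc i h)) - G x 0 i * h 0 i).
  rewrite big_split/= sumrN -/(dotp (G x) h) -(big_mkord xpredT (fun i => u (x + trunc i.+1 h) - u (x + trunc i h))).
  by rewrite (telescope_sumr (fun k => u (x + trunc k h)))// tr0 trn addr0 opprD addrA (addrC h).
apply: (le_trans (ler_norm_sum _ _ _)).
apply: (@le_trans _ _ (\sum_(i < n) (e' * `|h|))); last first.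
  rewrite sumr_const card_ord -mulr_natl mulrA ler_wpM2r// /e' mulrCA ler_piMr ?(ltW e0)//.
  by rewrite ler_pdivrMr ?ltr_wpDl// mul1r lerDl.
apply: ler_sum => i _; rewrite trunc_recr addrA.
have [xi xih ->] := has_grad_mvt (x + trunc i h) i (h 0 i) uG.
rewrite [G x 0 i * _]mulrC -mulrBr normrM mulrC; apply: ler_pM => //; last exact: norm_coord.
rewrite distrC; apply: (hd) => //; rewrite -ball_normE/=; apply: le_lt_trans hd'.
rewrite -addrA opprD addrA subrr add0r normrN; apply: norm_le => // j.
rewrite !mxE eqxx/=; case: eqVneq => [->|ne]; rewrite ?ltnn ?mulr1 ?add0r.
  by apply: (le_trans xih); exact: norm_coord.
rewrite mulr0 addr0; case: ifP => _; rewrite ?normr0//; exact: norm_coord.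
Unshelve. all: by end_near. Qed.

Lemma has_grad_C1 u G (O : set V) : has_grad u G -> C1_on O u.
Proof.
move=> uG; split=> [x _|i x _]; first exact: has_grad_differentiable uG.
have -> : partial i u = (fun x => G x 0 i).
  by apply/funext => y; rewrite -(has_gradE uG) mxE.
by have [_] := uG; exact.
Qed.

End ContinuousPartials.

(** * Alberti's Lusin theorem for gradients *)

Section SmoothApproximation.
Context {R : realType} {n : nat}.
Local Notation V := 'rV[R]_n.
Implicit Types (u : V -> R) (G : V -> V).

Lemma compact_net (K : set V) (r : V -> R) : compact K -> (forall x, 0 < r x) ->
  exists s : seq V, forall x, K x -> exists2 y, y \in s & enorm (x - y) < r y.
Proof.
rewrite compact_cover => cK r0.
have [||s _ sK] := cK V setT (fun y => eball y (r y)).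
- by move=> y _; exact: eball_open.
- by move=> x Kx; exists x => //; rewrite /eball/= subrr enorm0.
exists (enum_fset s) => x /sK[y /= ys xy]; by exists y.
Qed.

(** Uniform continuity at the points of [K] in which the second point may lie outside [K], as the
    net points used later do. *)
Lemma Cc_uniform (K : set V) (w : V -> R) (e : R) : compact K -> continuous w -> 0 < e ->
  exists2 r, 0 < r & forall x y, K x -> enorm (y - x) < r -> `|w y - w x| <= e.
Proof.
move=> cK cw e0; have e2 : 0 < e / 2 by rewrite divr_gt0.
have /choice[r rP] x : exists r : R, 0 < r /\ forall y, enorm (y - x) < r + r -> `|w y - w x| <= e / 2.
  have : \forall y \near x, `|w x - w y| <= e / 2 by have /cvgrPdist_le/(_ _ e2) := cw x.
  move=> /nbhs_eballP[r r0 h]; exists (r / 2); split; first by rewrite divr_gt0.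
  by move=> y yx; rewrite distrC; apply: h; rewrite /eball/=; move: yx; rewrite -splitr.
have [s sK] := compact_net cK (fun x => proj1 (rP x)).
have [d d0 dr] : exists2 d : R, 0 < d & forall y, y \in s -> d <= r y.
  elim: s {sK} => [|y s [d d0 IH]]; first by exists 1.
  exists (Num.min (r y) d); first by rewrite lt_min d0 andbT; have [] := rP y.
  by move=> z; rewrite inE ge_min => /predU1P[->|/IH->]; rewrite ?lexx ?orbT.
exists d => // x z /sK[y ys xy] zx; have ry := dr _ ys.
have -> : w z - w x = (w z - w y) - (w x - w y) by ring.
apply: (le_trans (ler_normB _ _)); rewrite (splitr e); have [r0 h] := rP y; apply: lerD; apply: h.
  rewrite (_ : z - y = (z - x) + (x - y)); last by rewrite addrA subrK.
  by apply: (le_lt_trans (enormD _ _)); apply: ltrD => //; exact: lt_le_trans ry.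
by apply: (lt_trans xy); rewrite ltrDl.
Qed.

Lemma is_derive_bigsum (s : seq V) (w : V -> V -> R) (dw : V -> R) (x v : V) :
  (forall y, is_derive x v (w y) (dw y)) ->
  is_derive x v (fun x => \sum_(y <- s) w y x) (\sum_(y <- s) dw y).
Proof.
move=> h; elim: s => [|y s IH].
  rewrite big_nil (_ : (fun x => _) = cst 0); last by apply/funext => z; rewrite big_nil.
  exact: is_derive_cst.
rewrite big_cons (_ : (fun x => _) = (fun x => w y x + \sum_(y <- s) w y x)); last first.
  by apply/funext => z; rewrite big_cons.
exact: is_deriveD.
Qed.

Lemma is_derive_affine (a b : R) (v : V) (x : V) (i : 'I_n) :
  is_derive x (unitv i) (fun x => a * (2 * dotp x v - b)) (2 * a * v 0 i).
Proof.
rewrite -[x in is_derive x](addr0 x) -(scale0r (unitv i)); apply/is_derive_line.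
rewrite (_ : (fun t => _) = (fun t : R => a * (2 * dotp x v - b) + (2 * a * v 0 i) * t)); last first.
  by apply/funext => t; rewrite dotpDl dotpZl (dotpC (unitv i)) dotp_unitv; ring.
have h := is_deriveD (is_derive_cst (a * (2 * dotp x v - b) : R^o) (0 : R) 1) (is_deriveZ (2 * a * v 0 i) (is_derive_id (0 : R) 1)).
by move: h; rewrite add0r /GRing.scale/= mulr1.
Qed.

(* The smooth partition of unity consists of the softmax weights of [- lam * |x - y|^2], [y \in s]:
   dividing by [exp (- lam * |x|^2)] makes the exponents affine, so that gradients are bounded. *)
Lemma softmax_approx (K : set V) (g : V -> R) (a e : R) : compact K -> {within K, continuous g} ->
  0 < a -> (forall x, K x -> `|g x| <= a) -> 0 < e ->
  exists (h : V -> R) (G : V -> V) (L : R), [/\ has_grad h G, forall x, `|h x| <= a,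
    forall i x, `|G x 0 i| <= L & forall x, K x -> `|h x - g x| <= e].
Proof.
move=> cK cg a0 ga e0.
have [w [[cw _] wg wa]] := extend_Cc cK a0 cg ga.
have e2 : 0 < e / 2 by rewrite divr_gt0.
have [r r0 wr] := Cc_uniform cK cw e2.
have r2 : 0 < r / 2 by rewrite divr_gt0.
have [s sK] := @compact_net K (fun=> r / 2) cK (fun=> r2).
(* An empty net covers only an empty [K]; this case is separated because the denominator below must
   be positive. *)
have [s0|s_neq0] := eqVneq s [::].
  exists (fun=> 0), (fun=> 0), 0; split.
  - split=> i; last by move=> x; rewrite (_ : (fun x : V => _) = cst 0); [exact: cst_continuous|apply/funext => y; rewrite mxE].
    by move=> x; rewrite mxE; exact: is_derive_cst.
  - by move=> x; rewrite normr0 ltW.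
  - by move=> i x; rewrite mxE normr0.
  - by move=> x /sK[y]; rewrite s0.
(* [q] bounds the relative weight of a net point at distance at least [r], so that all of these
   together contribute at most [e / 2]. Against a net point within [r / 2] the gap of exponents is
   at least [lam (r^2 - r^2 / 4) = 1 / q], and [exp (- 1 / q) <= q]. *)
pose q := e / (4 * a * ((size s)%:R + 1)).
have q0 : 0 < q by rewrite divr_gt0// !mulr_gt0// ltr_wpDl.
pose lam := q^-1 / (3 / 4 * r ^+ 2).
have lam0 : 0 < lam by rewrite divr_gt0 ?invr_gt0// mulr_gt0// exprn_gt0.
pose E (y x : V) := expR (lam * (2 * dotp x y - dotp y y)).
have E0 y x : 0 < E y x by exact: expR_gt0.
have dE y x i : is_derive x (unitv i) (E y) (E y x * (2 * lam * y 0 i)).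
  by apply: is_derive_comp; exact: is_derive_affine.
have cE y : continuous (E y).
  move=> x; apply: (@continuous_comp _ _ _ (fun x => lam * (2 * dotp x y - dotp y y)) expR); last exact: continuous_expR.
  apply: (@continuousM R V (fun=> lam)); first exact: cst_continuous.
  apply: (@continuousB R R^o V); last exact: cst_continuous.
  apply: (@continuousM R V (fun=> 2)); first exact: cst_continuous.
  apply: continuous_bigsum => i z; apply: (@continuousM R V (fun z => z 0 i) (fun=> y 0 i)).
    exact: coord_continuous.
  exact: cst_continuous.
pose D x := \sum_(y <- s) E y x; pose N x := \sum_(y <- s) w y * E y x.
have D0 x : 0 < D x.
  rewrite /D; suff : forall s', s' != [::] -> 0 < \sum_(y <- s') E y x by apply.
  by case=> // y s' _; rewrite big_cons ltr_pwDl// sumr_ge0// => *; apply: ltW.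
pose DD i x := \sum_(y <- s) E y x * (2 * lam * y 0 i).
pose DN i x := \sum_(y <- s) w y * (E y x * (2 * lam * y 0 i)).
have dD x i : is_derive x (unitv i) D (DD i x) by exact: is_derive_bigsum.
have dN x i : is_derive x (unitv i) N (DN i x).
  apply: is_derive_bigsum => y; exact: is_deriveZ.
have ND x : `|N x| <= a * D x.
  rewrite /N /D mulr_sumr; apply: (le_trans (ler_norm_sum _ _ _)); apply: ler_sum => y _.
  by rewrite normrM (ger0_norm (ltW (E0 _ _))) ler_wpM2r// ltW.
pose rho := \sum_(y <- s) `|y|.
have rho0 : 0 <= rho by rewrite sumr_ge0.
have rhoP y i : y \in s -> `|2 * lam * y 0 i| <= 2 * lam * rho.
  move=> ys; have l20 : 0 <= 2 * lam by apply: mulr_ge0 => //; exact: ltW.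
  rewrite normrM (ger0_norm l20); apply: ler_wpM2l => //.
  apply: (le_trans (norm_coord _ _)); rewrite /rho (big_rem y)//= lerDl sumr_ge0//.
have DDb i x : `|DD i x| <= D x * (2 * lam * rho).
  rewrite /DD /D mulr_suml; apply: (le_trans (ler_norm_sum _ _ _)); rewrite big_seq [leRHS]big_seq; apply: ler_sum => y ys.
  by rewrite normrM (ger0_norm (ltW (E0 _ _))) ler_wpM2l ?(ltW (E0 _ _))// rhoP.
have DNb i x : `|DN i x| <= a * (D x * (2 * lam * rho)).
  rewrite /DN /D mulr_suml mulr_sumr; apply: (le_trans (ler_norm_sum _ _ _)); rewrite big_seq [leRHS]big_seq; apply: ler_sum => y ys.
  rewrite normrM; apply: ler_pM => //.
  by rewrite normrM (ger0_norm (ltW (E0 _ _))) ler_wpM2l ?(ltW (E0 _ _))// rhoP.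
pose G x : V := \row_i (N x * (- (D x) ^- 2 * DD i x) + (D x)^-1 * DN i x).
exists (fun x => N x * (D x)^-1), G, (a * (4 * lam * rho)); split.
- split=> i; last first.
    have -> : (fun x => G x 0 i) = (fun x => N x * (- (D x) ^- 2 * DD i x) + (D x)^-1 * DN i x).
      by apply/funext => x; rewrite mxE.
    have cD : continuous D by exact: continuous_bigsum.
    have cN : continuous N.
      by apply: continuous_bigsum => y x; apply: (@continuousM R V (fun=> w y)); [exact: cst_continuous|exact: cE].
    have cEy y : continuous (fun x => E y x * (2 * lam * y 0 i)).
      by move=> x; apply: (@continuousM R V (E y) (fun=> _)); [exact: cE|exact: cst_continuous].
    have cDD : continuous (DD i) by exact: continuous_bigsum.
    have cDN : continuous (DN i).
      by apply: continuous_bigsum => y x; apply: (@continuousM R V (fun=> w y)); [exact: cst_continuous|exact: cEy].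
    have cV : continuous (fun x => (D x)^-1).
      by move=> x; apply: (@continuous_comp _ _ _ D); [exact: cD|apply: inv_continuous; rewrite gt_eqF].
    have cV2 : continuous (fun x => - (D x)^-2).
      rewrite (_ : (fun x => _) = (fun x => - ((D x)^-1 * (D x)^-1))); last first.
        by apply/funext => x; rewrite expr2 invfM.
      by move=> x; apply: (@continuousN R R^o V); apply: continuousM; exact: cV.
    move=> x; apply: (@continuousD R R^o V); apply: continuousM; [exact: cN| |exact: cV|exact: cDN].
    by apply: continuousM; [exact: cV2|exact: cDD].
  move=> x; rewrite mxE.
  have dV : is_derive x (unitv i) (fun x => (D x)^-1) (- (D x) ^- 2 * DD i x).
    apply: (@is_derive_comp _ _ (fun t => t^-1)) => //.
    have := @is_deriveV R id (D x) 1 1; rewrite /= gt_eqF// => /(_ isT (is_derive_id _ _)).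
    by rewrite /GRing.scale/= mulr1.
  exact: is_deriveM.
- move=> x; rewrite normrM normfV (ger0_norm (ltW (D0 x))) ler_pdivrMr//.
- move=> i x; rewrite mxE.
  have -> : a * (4 * lam * rho) = a * D x * ((D x)^-2 * (D x * (2 * lam * rho))) + (D x)^-1 * (a * (D x * (2 * lam * rho))).
    by field; rewrite gt_eqF.
  apply: (le_trans (ler_normD _ _)); apply: lerD.
    rewrite normrM; apply: ler_pM => //; rewrite normrM; apply: ler_pM => //.
    by rewrite normrN ger0_norm// invr_ge0 exprn_ge0// ltW.
  rewrite normrM; apply: ler_pM => //; by rewrite ger0_norm// invr_ge0 ltW.
move=> x Kx; rewrite -wg//.
have [y0 y0s y0x] := sK _ Kx.
have far y : r <= enorm (y - x) -> E y x <= q * D x.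
  move=> yx; apply: (@le_trans _ _ (q * E y0 x)); last first.
    by rewrite ler_wpM2l ?(ltW q0)// /D (big_rem y0)//= lerDl sumr_ge0// => *; exact: ltW.
  rewrite -ler_pdivrMr// /E -expRB.
  set t := (X in expR X).
  have tle : t <= - q^-1.
    have -> : - q^-1 = lam * (- (3 / 4 * r ^+ 2)).
      by rewrite /lam; field; rewrite !gt_eqF.
    have -> : t = lam * (enorm (x - y0) ^+ 2 - enorm (y - x) ^+ 2).
      by rewrite /t -!dotpvv !dotpBl !(dotpC _ (_ - _)) !dotpBl (dotpC y x) (dotpC y0 x); ring.
    rewrite ler_wpM2l ?(ltW lam0)//.
    have : enorm (x - y0) ^+ 2 <= (r / 2) ^+ 2.
      by rewrite lerXn2r ?nnegrE ?enorm_ge0 ?(ltW r2)// ltW.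
    have : r ^+ 2 <= enorm (y - x) ^+ 2 by rewrite lerXn2r ?nnegrE ?enorm_ge0 ?(ltW r0).
    by rewrite expr_div_n; lra.
  apply: (@le_trans _ _ (expR (- q^-1))); first by rewrite ler_expR.
  rewrite expRN -[leRHS]invrK lef_pV2 ?posrE ?expR_gt0 ?invr_gt0//.
  by apply: le_trans (expR_ge1Dx _); rewrite lerDr.
have -> : N x * (D x)^-1 - w x = (\sum_(y <- s) (w y - w x) * E y x) / D x.
  have -> : \sum_(y <- s) (w y - w x) * E y x = N x - w x * D x.
    by rewrite /N /D mulr_sumr -sumrB; apply: eq_bigr => y _; rewrite mulrBl.
  by field; rewrite gt_eqF.
rewrite normrM normfV (ger0_norm (ltW (D0 x))) ler_pdivrMr//.
apply: (le_trans (ler_norm_sum _ _ _)).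
apply: (@le_trans _ _ (\sum_(y <- s) (e / 2 * E y x + (2 * a) * (q * D x)))).
  apply: ler_sum => y _; rewrite normrM (ger0_norm (ltW (E0 _ _))).
  have [yr|yr] := ltP (enorm (y - x)) r.
    apply: ler_wpDr.
      by apply: mulr_ge0; [rewrite mulr_ge0// ltW|apply: mulr_ge0; exact: ltW].
    by rewrite ler_wpM2r ?(ltW (E0 _ _))// wr.
  apply: ler_wpDl; first by apply: mulr_ge0; exact: ltW.
  apply: ler_pM => //; [exact: ltW|by rewrite mulr_natl mulr2n; apply: (le_trans (ler_normB _ _)); apply: lerD|exact: far].
rewrite big_split/= -mulr_sumr -/(D x) big_const_seq count_predT iter_addr_0 -[X in _ + X <= _]mulr_natl.
have S1 : 0 < (size s)%:R + 1 :> R by rewrite ltr_wpDl.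
have -> : (size s)%:R * (2 * a * (q * D x)) = (size s)%:R / ((size s)%:R + 1) * (e / 2 * D x).
  by rewrite /q; field; rewrite gt_eqF//= gt_eqF.
have : (size s)%:R / ((size s)%:R + 1) * (e / 2 * D x) <= e / 2 * D x.
  apply: ler_piMl; first by rewrite mulr_ge0// ltW.
  by rewrite ler_pdivrMr// mul1r lerDl.
lra.
Qed.

End SmoothApproximation.

(** * A smooth periodic sawtooth *)

Section Sawtooth.
Context {R : realType}.
Implicit Types (d t : R).

(** For [d = 0] this is [2 atan (tan (t / 2))], the sawtooth equal to [t] between [- pi] and [pi]; a
    positive [d] smooths its jumps while the values stay within [pi]. *)
Definition saw d t : R := 2 * atan (sin t / (1 + d + cos t)).

(** The derivative of [saw d]. The denominator is [(1 + d + cos t)^2 + sin^2 t]; in this form the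
    deviation from 1 is visibly small unless [cos t] is near [-1]. *)
Definition saw_slope d t : R := 1 - d * (2 + d) / (d ^+ 2 + 2 * (1 + d) * (1 + cos t)).

Lemma cos_add1_ge0 t : 0 <= 1 + cos t.
Proof. by have := cos_geN1 t; lra. Qed.

Lemma saw_denom_ge d t : 0 < d -> d ^+ 2 <= d ^+ 2 + 2 * (1 + d) * (1 + cos t).
Proof. by move=> d0; rewrite lerDl !mulr_ge0 ?cos_add1_ge0// addr_ge0// ltW. Qed.

Lemma saw_derive d t : 0 < d -> is_derive t 1 (saw d) (saw_slope d t).
Proof.
move=> d0; have D0 : 1 + d + cos t != 0 by rewrite gt_eqF// addrAC ltr_wpDl// cos_add1_ge0.
have h1 : is_derive t 1 (fun t : R => 1 + d + cos t) (0 - sin t).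
  exact: (is_deriveD (is_derive_cst (1 + d : R^o) t 1) (is_derive_cos t)).
have h2 := is_deriveM (is_derive_sin t) (@is_deriveV R (fun t => 1 + d + cos t) t (0 - sin t) 1 D0 h1).
have h3 := @is_derive1_comp _ atan _ t _ _ (is_derive1_atan _) h2.
have h4 := is_deriveZ 2 h3.
have -> : saw_slope d t = 2 *: ((1 + (sin t * (1 + d + cos t)^-1) ^+ 2)^-1 *
    (sin t *: (- (1 + d + cos t) ^- 2 *: (0 - sin t)) + (1 + d + cos t)^-1 *: cos t)) :> R.
  have D1 : d ^+ 2 + 2 * (1 + d) * (1 + cos t) != 0.
    by rewrite gt_eqF// (lt_le_trans _ (saw_denom_ge t d0))// exprn_gt0.
  have e1 : (1 + d + cos t) ^+ 2 + sin t ^+ 2 = d ^+ 2 + 2 * (1 + d) * (1 + cos t).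
    by rewrite sin2cos2; ring.
  have e2 : 1 + (sin t * (1 + d + cos t)^-1) ^+ 2 =
      (d ^+ 2 + 2 * (1 + d) * (1 + cos t)) / (1 + d + cos t) ^+ 2.
    by rewrite -e1; field.
  have e3 : sin t * (- (1 + d + cos t) ^- 2 * (0 - sin t)) + (1 + d + cos t)^-1 * cos t =
      (1 + cos t * (1 + d)) / (1 + d + cos t) ^+ 2.
    have e4 : sin t * (- (1 + d + cos t) ^- 2 * (0 - sin t)) = (1 - cos t ^+ 2) / (1 + d + cos t) ^+ 2.
      by rewrite -sin2cos2 sub0r mulrNN mulrC expr2; ring.
    by rewrite e4; field.
  by rewrite /GRing.scale/= e2 e3 /saw_slope; field; rewrite D0.
exact: h4.
Qed.

Lemma saw_bound d t : `|saw d t| <= pi.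
Proof.
rewrite /saw; set x := sin t / _; have := atan_gtNpi2 x; have := atan_ltpi2 x.
by rewrite ler_norml; lra.
Qed.

Lemma saw_slope_bound d t : 0 < d -> d <= 1 -> `|saw_slope d t| <= 4 / d.
Proof.
move=> d0 d1; rewrite /saw_slope; have den := saw_denom_ge t d0; have d20 : 0 < d ^+ 2 by rewrite exprn_gt0.
set D := d ^+ 2 + _ in den *; clearbody D; have D0 : 0 < D by exact: lt_le_trans den.
have q0 : 0 <= d * (2 + d) / D by apply: (divr_ge0 _ (ltW D0)); rewrite mulr_ge0 ?addr_ge0 ?(ltW d0)//.
apply: (le_trans (ler_normB _ _)); rewrite normr1 (ger0_norm q0).
apply: (@le_trans _ _ (d^-1 + d * (2 + 1) / d ^+ 2)); last first.
  by rewrite (_ : d^-1 + d * (2 + 1) / d ^+ 2 = 4 / d)//; field; rewrite gt_eqF.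
apply: lerD; first by rewrite -[leLHS]invr1 lef_pV2 ?posrE.
apply: ler_pM; [by rewrite mulr_ge0 ?addr_ge0 ?(ltW d0)|by rewrite invr_ge0 ltW| |by rewrite lef_pV2 ?posrE].
by rewrite ler_wpM2l ?(ltW d0)// lerD2l.
Qed.

Lemma saw_slope_near1 d t b : 0 < d -> 0 < b -> b <= 1 + cos t -> `|saw_slope d t - 1| <= d / b.
Proof.
move=> d0 b0 bt; rewrite /saw_slope addrAC subrr sub0r normrN.
have den : 2 * (1 + d) * b <= d ^+ 2 + 2 * (1 + d) * (1 + cos t).
  by apply: ler_wpDl; [rewrite sqr_ge0|rewrite ler_wpM2l// mulr_ge0// addr_ge0// ltW].
have D0 : 0 < 2 * (1 + d) * b by rewrite !mulr_gt0// addr_gt0.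
set D := d ^+ 2 + _ in den *; clearbody D; have D1 : 0 < D by exact: lt_le_trans den.
have q0 : 0 <= d * (2 + d) / D by apply: (divr_ge0 _ (ltW D1)); rewrite mulr_ge0 ?addr_ge0 ?(ltW d0)//.
rewrite (ger0_norm q0).
apply: (@le_trans _ _ (d * (2 * (1 + d)) / (2 * (1 + d) * b))); last first.
  by rewrite (_ : d * (2 * (1 + d)) / (2 * (1 + d) * b) = d / b)//; field; rewrite !gt_eqF// addr_gt0.
apply: ler_pM; [by rewrite mulr_ge0 ?addr_ge0 ?(ltW d0)|by rewrite invr_ge0 ltW| |by rewrite lef_pV2 ?posrE].
by rewrite ler_wpM2l ?(ltW d0)//; move: d0; lra.
Qed.

Lemma sin_ge_linear t : 0 <= t <= 1 -> cos 1 * t <= sin t.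
Proof.
move=> /andP[t0 t1].
have [c] := @MVT_segment R sin cos 0 t t0 (fun x _ => is_derive_sin x) (continuous_subspaceT (@continuous_sin R)).
rewrite in_itv/= => /andP[c0 ct]; rewrite sin0 !subr0 => ->.
have c1 := le_trans ct t1; rewrite ler_wpM2r//.
have [e] := @MVT_segment R cos (fun x => - sin x) c 1 c1 (fun x _ => is_derive_cos x) (continuous_subspaceT (@continuous_cos R)).
rewrite in_itv/= => /andP[ec e1] h; rewrite -subr_le0 h mulNr oppr_le0 mulr_ge0// ?subr_ge0//.
apply: sin_ge0_pi; rewrite (le_trans c0)//=; apply: (le_trans e1).
by apply: le_trans (@pi_ge2 R); rewrite ler1n.
Qed.

Lemma cos_le_quadratic t : 0 <= t <= 2 -> cos t <= 1 - cos 1 ^+ 2 * t ^+ 2 / 2.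
Proof.
move=> /andP[t0 t2]; have h : 0 <= t / 2 <= 1 by rewrite divr_ge0//= ler_pdivrMr// mul1r.
have s := sin_ge_linear h.
have -> : cos t = 1 - 2 * sin (t / 2) ^+ 2.
  rewrite [in cos t](_ : t = (t / 2) *+ 2); last by rewrite -mulr_natr divfK.
  by rewrite cos_mulr2n sin2cos2; ring.
have : (cos 1 * (t / 2)) ^+ 2 <= sin (t / 2) ^+ 2.
  have c1 := @cos1_gt0 R; case/andP: h => h0 _.
  by rewrite lerXn2r ?nnegrE ?(le_trans _ s)// mulr_ge0// ltW.
rewrite exprMn expr_div_n; lra.
Qed.

(** The arc where [1 + cos] is below [b = cos 1 ^ 2 / (16 N^2)] is shorter than [1 / N]. Indeed two
    of its points [u], [v] satisfy [cos (u - v) >= 1 - 4 b], whereas a shift of at least [1 / N] and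
    at most 1 has cosine at most [1 - 8 b]. *)
Lemma shifts_disjoint (N j k : nat) t : (j < N)%N -> (k < N)%N -> 
  1 + cos (t + j%:R / N%:R) < cos 1 ^+ 2 / (16 * N%:R ^+ 2) ->
  1 + cos (t + k%:R / N%:R) < cos 1 ^+ 2 / (16 * N%:R ^+ 2) -> j = k.
Proof.
wlog : j k / (k <= j)%N => [H jN kN h1 h2|].
  by have [kj|jk] := leqP k j; [exact: H|apply/esym/H => //; exact: ltnW].
rewrite leq_eqVlt => /predU1P[->//|kj jN kN h1 h2]; exfalso.
have N0 : 0 < N%:R :> R by rewrite ltr0n (leq_trans _ jN).
set b := cos 1 ^+ 2 / _ in h1 h2.
pose phi : R := (j - k)%N%:R / N%:R.
have phiN : N%:R^-1 <= phi by rewrite /phi ler_peMl ?invr_ge0 ?(ltW N0)// ler1n subn_gt0.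
have phi1 : phi <= 1.
  by rewrite /phi ler_pdivrMr// mul1r ler_nat (leq_trans (leq_subr _ _))// ltnW.
have bE : b = cos 1 ^+ 2 * (N%:R^-1) ^+ 2 / 16.
  by rewrite /b; field; rewrite gt_eqF.
have c1 := @cos1_gt0 R.
have b0 : 0 < b by rewrite /b divr_gt0 ?mulr_gt0 ?exprn_gt0.
have cphi : cos phi <= 1 - 8 * b.
  apply: (@le_trans _ _ (1 - cos 1 ^+ 2 * phi ^+ 2 / 2)).
    apply: cos_le_quadratic; rewrite (le_trans phi1) ?ler1n// andbT.
    by rewrite (le_trans _ phiN)// invr_ge0 ltW.
  have : cos 1 ^+ 2 * (N%:R^-1) ^+ 2 <= cos 1 ^+ 2 * phi ^+ 2.
    by rewrite ler_wpM2l ?sqr_ge0// lerXn2r ?nnegrE ?invr_ge0 ?(ltW N0)// (le_trans _ phiN)// invr_ge0 ltW.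
  by rewrite bE; lra.
set u := t + j%:R / N%:R in h1; set v := t + k%:R / N%:R in h2.
have uv : phi = u - v.
  by rewrite /phi natrB ?(ltnW kj)// /u /v; ring.
have := cosB u v; rewrite -uv => E.
have s2 x : 1 + cos x < b -> sin x ^+ 2 <= 2 * b.
  move=> h; have -> : sin x ^+ 2 = (1 - cos x) * (1 + cos x) by rewrite sin2cos2; ring.
  have c1' := cos_le1 x; have c2 := cos_geN1 x; apply: ler_pM; lra.
have p1 := s2 _ h1; have p2 := s2 _ h2.
have p3 : - (2 * b) <= sin u * sin v.
  by have := sqr_ge0 (sin u + sin v); rewrite sqrrD; lra.
have p4 : 1 - 2 * b <= cos u * cos v.
  have q1 : 0 <= (b - (1 + cos u)) * (1 - cos v) by rewrite mulr_ge0 ?subr_ge0 ?cos_le1// ltW.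
  have q2 : 0 <= (b - (1 + cos v)) by rewrite subr_ge0 ltW.
  have q3 := cos_geN1 u; have q4 := cos_geN1 v; have q5 := cos_le1 u; have q6 := cos_le1 v.
  have q7 : 0 <= (1 + cos u) * (1 + cos v) by rewrite mulr_ge0 ?cos_add1_ge0.
  lra.
lra.
Qed.

End Sawtooth.

(** * One step of Alberti's construction *)

Section AlbertiStep.
Context {R : realType} {n : nat}.
Local Notation V := 'rV[R]_n.
Local Notation B := (@Borel R n).
Implicit Types (u : V -> R) (G : V -> V).

Lemma has_grad_mul u G w H : has_grad u G -> has_grad w H ->
  has_grad (fun x => u x * w x) (fun x => u x *: H x + w x *: G x).
Proof.
move=> uG wH; have [dG cG] := uG; have [dH cH] := wH.
have cu : continuous u by move=> x; apply: differentiable_continuous; exact: has_grad_differentiable uG.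
have cw : continuous w by move=> x; apply: differentiable_continuous; exact: has_grad_differentiable wH.
split=> i; first by move=> x; rewrite !mxE; exact: is_deriveM.
rewrite (_ : (fun x => _) = (fun x => u x * H x 0 i + w x * G x 0 i)); last first.
  by apply/funext => x; rewrite !mxE.
move=> x; apply: (@continuousD R R^o V); apply: continuousM; [exact: cu|exact: cH|exact: cw|exact: cG].
Qed.

Lemma has_grad0 : has_grad (fun _ : V => 0) (fun _ => 0).
Proof.
split=> i; first by move=> x; rewrite mxE; exact: is_derive_cst.
by rewrite (_ : (fun x => _) = cst 0); [exact: cst_continuous|apply/funext => x; rewrite mxE].
Qed.

Lemma has_grad_sum (I : Type) (r : seq I) (u : I -> V -> R) (G : I -> V -> V) :
  (forall i, has_grad (u i) (G i)) ->
  has_grad (fun x => \sum_(i <- r) u i x) (fun x => \sum_(i <- r) G i x).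
Proof.
move=> h; elim: r => [|i r IH].
  rewrite (_ : (fun x => _) = fun=> 0); last by apply/funext => x; rewrite big_nil.
  rewrite [X in has_grad _ X](_ : _ = fun=> 0); last by apply/funext => x; rewrite big_nil.
  exact: has_grad0.
rewrite (_ : (fun x => _) = fun x => u i x + \sum_(i <- r) u i x); last by apply/funext => x; rewrite big_cons.
rewrite [X in has_grad _ X](_ : _ = fun x => G i x + \sum_(i <- r) G i x); last by apply/funext => x; rewrite big_cons.
exact: has_grad_add.
Qed.

Lemma is_derive_coord (i j : 'I_n) (x : V) : is_derive x (unitv j) (fun y : V => y 0 i) (i == j)%:R.
Proof.
rewrite -[x in is_derive x](addr0 x) -(scale0r (unitv j)); apply/is_derive_line.
have -> : (fun t : R => (x + t *: unitv j) 0 i) = (fun t : R => x 0 i + (i == j)%:R * t).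
  by apply/funext => t; rewrite !mxE eqxx/= mulrC.
have := is_deriveD (is_derive_cst (x 0 i : R^o) (0 : R) 1) (is_deriveZ ((i == j)%:R) (is_derive_id (0 : R) 1)).
by rewrite add0r /GRing.scale/= mulr1.
Qed.

(** Scaling by [eta] shrinks the amplitude to [eta * pi] and leaves the range of slopes
    unchanged. *)
Lemma saw_has_grad (d eta theta : R) (i : 'I_n) : 0 < d -> eta != 0 ->
  has_grad (fun x : V => eta * saw d (theta + eta^-1 * x 0 i))
    (fun x => saw_slope d (theta + eta^-1 * x 0 i) *: unitv i).
Proof.
move=> d0 e0; pose S (t : R) := eta * saw d (theta + eta^-1 * t).
have dS (t : R) : is_derive t 1 S (saw_slope d (theta + eta^-1 * t)).
  have h1 := is_deriveD (is_derive_cst (theta : R^o) (t : R) 1) (is_deriveZ eta^-1 (is_derive_id (t : R) 1)).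
  have h2 := @is_derive1_comp _ (saw d) (fun t => theta + eta^-1 * t) t _ _ (saw_derive _ d0) h1.
  have h3 := is_deriveZ eta h2.
  by move: h3; rewrite add0r /GRing.scale/= mulr1 mulrCA mulfV ?mulr1.
have ca : continuous (fun x : V => theta + eta^-1 * x 0 i).
  move=> x; apply: (@continuousD R R^o V); first exact: cst_continuous.
  apply: (@continuousM R V (fun=> eta^-1)); first exact: cst_continuous.
  exact: coord_continuous.
split=> j.
  move=> x; rewrite mxE unitvE eq_sym; apply: (@is_derive_comp _ _ S (fun x => x 0 i)).
  exact: is_derive_coord.
rewrite (_ : (fun x => _) = (fun x : V => (j == i)%:R * saw_slope d (theta + eta^-1 * x 0 i))); last first.
  by apply/funext => x; rewrite mxE unitvE mulrC.
have cs : continuous (saw_slope d).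
  rewrite (_ : saw_slope d = (fun t => 1 - d * (2 + d) * (d ^+ 2 + 2 * (1 + d) * (1 + cos t))^-1))//.
  move=> t; apply: cvgB; first exact: cvg_cst.
  apply: cvgM; first exact: cvg_cst.
  apply: cvgV.
    by rewrite gt_eqF// (lt_le_trans _ (saw_denom_ge t d0))// exprn_gt0.
  apply: cvgD; first exact: cvg_cst.
  apply: cvgM; first exact: cvg_cst.
  apply: cvgD; first exact: cvg_cst.
  exact: continuous_cos.
move=> x; apply: (@continuousM R V (fun=> (j == i)%:R)); first exact: cst_continuous.
by apply: (@continuous_comp _ _ _ (fun x : V => theta + eta^-1 * x 0 i)); [exact: ca|exact: cs].
Qed.

Variable m : {measure set B -> \bar R}.
Hypothesis mT : (m setT < +oo)%E.

Lemma measure_pigeonhole (N : nat) (A : nat -> set B) : (0 < N)%N ->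
  (forall k, measurable (A k)) ->
  (forall x j k, (j < N)%N -> (k < N)%N -> A j x -> A k x -> j = k) ->
  exists2 k, (k < N)%N & fine (m (A k)) <= fine (m setT) / N%:R.
Proof.
move=> N0 mA dA; apply: contrapT => no.
have big k : (k < N)%N -> fine (m setT) / N%:R < fine (m (A k)).
  by move=> kN; rewrite ltNge; apply/negP => h; apply: no; exists k.
have f k := finite_measure_fin mT (mA k).
have mU : measurable (\big[setU/set0]_(k < N) A k) by exact: bigsetU_measurable.
have tA : trivIset `I_N A by move=> i j /= iN jN [x [Ai Aj]]; exact: dA Ai Aj.
have E := measure_semi_additive_ord_I m (fun k _ => mA k) tA mU.
have : (m (\big[setU/set0]_(k < N) A k) <= m setT)%E by apply: le_measure => //; rewrite inE.
rewrite [X in (X <= _)%E]E => h.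
have : fine (\sum_(k < N) m (A k))%E <= fine (m setT).
  apply: fine_le => //; first by apply/sum_fin_numP => k _ _; exact: f.
  exact: (finite_measure_fin mT).
rewrite -sum_fine; last by move=> k _; exact: f.
apply/negP; rewrite -ltNge.
have -> : fine (m setT) = \sum_(k < N) (fine (m setT) / N%:R).
  by rewrite sumr_const card_ord -[RHS]mulr_natr divfK// pnatr_eq0 -lt0n.
case: N N0 big {dA no mU tA E h} => // N _ big.
rewrite !big_ord_recr/=; apply: ler_ltD; last exact: big.
by apply: ler_sum => k _; apply: ltW; apply: big; rewrite ltnS ltnW.
Qed.

(** The regions of bad slope for [N] equally spaced phases are disjoint, so one of them carries at
    most [1 / N] of the mass, whatever the measure is. *)
Lemma good_shift (N : nat) (eta : R) (i : 'I_n) : (0 < N)%N -> exists theta : R,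
  fine (m [set x : V | 1 + cos (theta + eta^-1 * x 0 i) < cos 1 ^+ 2 / (16 * N%:R ^+ 2)]) <=
    fine (m setT) / N%:R.
Proof.
move=> N0; pose A (k : nat) : set B := [set x : V | 1 + cos (k%:R / N%:R + eta^-1 * x 0 i) < cos 1 ^+ 2 / (16 * N%:R ^+ 2)].
have [|x j k jN kN|k kN Ak] := @measure_pigeonhole N A N0.
- move=> k; apply: borel_open.
  have -> : A k = (fun x : V => 1 + cos (k%:R / N%:R + eta^-1 * x 0 i)) @^-1` [set t | t < cos 1 ^+ 2 / (16 * N%:R ^+ 2)] by [].
  apply: open_comp; last exact: open_lt.
  move=> x _; apply: (@continuousD R R^o V); first exact: cst_continuous.
  apply: (@continuous_comp _ _ _ (fun x : V => k%:R / N%:R + eta^-1 * x 0 i)); last exact: continuous_cos.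
  apply: (@continuousD R R^o V); first exact: cst_continuous.
  apply: (@continuousM R V (fun=> eta^-1)); first exact: cst_continuous.
  exact: coord_continuous.
- rewrite /A/= ![_ / _ + _]addrC; exact: shifts_disjoint.
- by exists (k%:R / N%:R).
Qed.

(* [u] is [\sum_i h_i(x) s_i(x_i)] with [h_i] a smooth approximation of the [i]-th coordinate of [F]
   and [s_i] a smooth sawtooth of tiny amplitude whose slope is close to [1] except on a set of small
   measure. *)
Lemma alberti_step (K : set V) (F : V -> V) (a : R) (N : nat) : compact K ->
  (forall i, {within K, continuous (fun x => F x 0 i)}) -> 0 < a ->
  (forall x i, K x -> `|F x 0 i| <= a) -> (0 < N)%N ->
  exists u G (K' : set V), [/\ has_grad u G,
    forall x, `|u x| <= a * a /\ forall i, `|G x 0 i| <= 4097 / cos 1 ^+ 2 * N%:R ^+ 2 * a,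
    compact K' /\ K' `<=` K,
    fine (m (K `\` K')) <= n%:R * (fine (m setT) / N%:R) &
    forall x i, K' x -> `|F x 0 i - G x 0 i| <= a / 16].
Proof.
move=> cK cF a0 Fa N0; have a64 : 0 < a / 64 by rewrite divr_gt0.
have NR : 1 <= N%:R :> R by rewrite ler1n.
have c1 := @cos1_gt0 R; have c1' := @cos_le1 R 1.
pose b : R := cos 1 ^+ 2 / (16 * N%:R ^+ 2).
have b0 : 0 < b by rewrite divr_gt0 ?mulr_gt0 ?exprn_gt0// (lt_le_trans _ NR).
have N2 : 1 <= N%:R ^+ 2 :> R by rewrite exprn_ege1.
have c2 : cos 1 ^+ 2 <= 1 :> R by rewrite exprn_ile1// ltW.
have b1 : b <= 1 by rewrite ler_pdivrMr ?mul1r; [|rewrite mulr_gt0// (lt_le_trans _ N2)]; lra.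
(* Off the bad region the slope error is then at most [d / b = 1 / 64]. The slope bound [4 / d]
   equals [4096 N^2 / cos 1 ^ 2]; one further unit absorbs the term [a / 64] and gives 4097. *)
pose d := b / 64; have d0 : 0 < d by rewrite divr_gt0.
have d1 : d <= 1 by rewrite /d; lra.
have /choice[h hP] i : exists h : V -> R, exists (G : V -> V) (L : R), [/\ has_grad h G, forall x, `|h x| <= a,
    forall i x, `|G x 0 i| <= L & forall x, K x -> `|h x - F x 0 i| <= a / 64].
  by apply: softmax_approx => // x; exact: Fa.
have /choice[H /choice[L HP]] := hP.
have L0 i : 0 <= L i by have [_ _ + _] := HP i => /(_ i 0); exact: le_trans.
(* With [eta] chosen from [LL], the summand [sum L] makes the products of sawteeth with the
   gradients of the [h i] at most [a / 64], and the summand [n] bounds [u] itself. *)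
pose LL := \sum_i L i + n%:R; have SL0 : 0 <= \sum_i L i by rewrite sumr_ge0.
have LL0 : 0 <= LL by rewrite addr_ge0.
pose eta := a / 64 / (LL * pi + 1).
have pi0 := @pi_ge0 R.
have e1 : 0 < LL * pi + 1 by rewrite ltr_wpDl// mulr_ge0.
have eta0 : 0 < eta by rewrite divr_gt0.
have /choice[th thP] i := good_shift eta i N0.
pose bad i := [set x : V | 1 + cos (th i + eta^-1 * x 0 i) < b].
have obad i : open (bad i).
  have -> : bad i = (fun x : V => 1 + cos (th i + eta^-1 * x 0 i)) @^-1` [set t | t < b] by [].
  apply: open_comp; last exact: open_lt.
  move=> x _; apply: (@continuousD R R^o V); first exact: cst_continuous.
  apply: (@continuous_comp _ _ _ (fun x : V => th i + eta^-1 * x 0 i)); last exact: continuous_cos.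
  apply: (@continuousD R R^o V); first exact: cst_continuous.
  apply: (@continuousM R V (fun=> eta^-1)); first exact: cst_continuous.
  exact: coord_continuous.
pose s i (x : V) := eta * saw d (th i + eta^-1 * x 0 i).
pose ds i (x : V) := saw_slope d (th i + eta^-1 * x 0 i).
have sG i : has_grad (s i) (fun x => ds i x *: unitv i) by apply: saw_has_grad; rewrite ?gt_eqF.
have s_le i x : `|s i x| <= eta * pi by rewrite normrM (ger0_norm (ltW eta0)) ler_wpM2l ?(ltW eta0)// saw_bound.
pose G x := \sum_i (h i x *: (ds i x *: unitv i) + s i x *: H i x).
have uG : has_grad (fun x => \sum_i h i x * s i x) G.
  by apply: has_grad_sum => i; apply: has_grad_mul => //; have [] := HP i.
have GE x j : G x 0 j = h j x * ds j x + \sum_i s i x * H i x 0 j.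
  rewrite /G summxE (eq_bigr (fun i => h i x * (ds i x * (j == i)%:R) + s i x * H i x 0 j)); last first.
    by move=> i _; rewrite !mxE eqxx/=.
  rewrite big_split/= (bigD1 j)//= eqxx mulr1 big1 ?addr0// => i ij.
  by rewrite eq_sym (negbTE ij) !mulr0.
have ep : 0 <= eta * pi by apply: mulr_ge0 => //; exact: ltW.
have eLL : eta * pi * LL <= a / 64.
  rewrite /eta -mulrA mulrAC ler_pdivrMr//; apply: ler_wpM2l; first exact: ltW.
  by rewrite mulrC lerDl.
have small x j : `|\sum_i s i x * H i x 0 j| <= a / 64.
  apply: (le_trans (ler_norm_sum _ _ _)).
  apply: (@le_trans _ _ (\sum_i eta * pi * L i)).
    apply: ler_sum => i _; rewrite normrM; apply: ler_pM => //.
    by have [_ _ + _] := HP i; exact.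
  rewrite -mulr_sumr; apply: le_trans eLL; rewrite (ler_wpM2l ep)// lerDl//.
have h_le i x : `|h i x| <= a by have [_ + _ _] := HP i; exact.
exists (fun x => \sum_i h i x * s i x), G, (K `\` \bigcup_i bad i); split => //.
- move=> x; split.
    apply: (le_trans (ler_norm_sum _ _ _)); apply: (@le_trans _ _ (\sum_(i < n) a * (eta * pi))).
      by apply: ler_sum => i _; rewrite normrM; apply: ler_pM.
    rewrite sumr_const card_ord -mulr_natr -mulrA ler_wpM2l ?(ltW a0)//.
    apply: (@le_trans _ _ (eta * pi * LL)); last by apply: (le_trans eLL); lra.
    by rewrite (ler_wpM2l ep)// lerDr.
  move=> j; rewrite GE; apply: (le_trans (ler_normD _ _)).
  apply: (@le_trans _ _ (a * (4 / d) + a / 64)).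
    apply: lerD => //; rewrite normrM; apply: ler_pM => //; exact: saw_slope_bound.
  have -> : 4 / d = 4096 * (N%:R ^+ 2 / cos 1 ^+ 2).
    by rewrite /d /b; field; rewrite !gt_eqF// (lt_le_trans _ NR).
  have -> : 4097 / cos 1 ^+ 2 * N%:R ^+ 2 * a = 4097 * (a * (N%:R ^+ 2 / cos 1 ^+ 2)) by ring.
  have : a <= a * (N%:R ^+ 2 / cos 1 ^+ 2).
    by rewrite ler_peMr ?(ltW a0)// ler_pdivlMr ?exprn_gt0// mul1r (le_trans c2).
  lra.
- split; last exact: subDsetl.
  have -> : K `\` \bigcup_i bad i = K `&` ~` (\bigcup_i bad i) by rewrite setDE.
  apply: compact_closedI => //; apply: open_closedC; exact: bigcup_open.
- have mb i : measurable (bad i : set B) by exact: borel_open.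
  have fb i := finite_measure_fin mT (mb i).
  have -> : K `\` (K `\` \bigcup_i bad i) = K `&` \bigcup_i bad i by rewrite setDD.
  have mK := borel_compact cK.
  have mU : measurable (\bigcup_(i in [set: 'I_n]) bad i : set B) by apply: fin_bigcup_measurable => //; exact: finite_finset.
  have le : (m (K `&` \bigcup_i bad i) <= \sum_(i < n) m (bad i))%E.
    apply: (@le_trans _ _ (m (\big[setU/set0]_(i < n) bad i))).
      apply: le_measure; rewrite ?inE; [exact: measurableI|exact: bigsetU_measurable|].
      by move=> x [_ [i _ bi]]; rewrite (bigD1 i)//=; left.
    suff [] : measurable (\big[setU/set0]_(i < n) bad i : set B) /\
      (m (\big[setU/set0]_(i < n) bad i) <= \sum_(i < n) m (bad i))%E by [].
    elim/big_ind2 : _ => [|X p Y q [mX Xp] [mY Yq]|//]; first by rewrite measure0.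
    by split; [exact: measurableU|apply: (le_trans (measureU2 _ _ _)) => //; exact: leeD].
  apply: (@le_trans _ _ (fine (\sum_(i < n) m (bad i))%E)).
    apply: fine_le => //; first by apply: (finite_measure_fin mT); exact: measurableI.
    by apply/sum_fin_numP => i _ _; exact: fb.
  rewrite -sum_fine; last by move=> i _; exact: fb.
  rewrite -[X in X%:R * _](card_ord n) mulr_natl -sumr_const; apply: ler_sum => i _; exact: thP.
- move=> x j [Kx nb]; rewrite GE.
  have good : b <= 1 + cos (th j + eta^-1 * x 0 j).
    by rewrite leNgt; apply/negP => hb; apply: nb; exists j.
  have q1 : `|h j x - F x 0 j| <= a / 64 by have [_ _ _ +] := HP j; exact.
  have q2 : `|h j x * (1 - ds j x)| <= a / 64.
    rewrite normrM; apply: (@le_trans _ _ (a * (d / b))); last first.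
      by rewrite /d (_ : b / 64 / b = 64^-1)//; field; rewrite gt_eqF.
    apply: ler_pM => //; rewrite distrC; exact: saw_slope_near1.
  have q3 := small x j.
  have -> : F x 0 j - (h j x * ds j x + \sum_i s i x * H i x 0 j) =
    - (h j x - F x 0 j) + h j x * (1 - ds j x) - \sum_i s i x * H i x 0 j by ring.
  apply: (le_trans (ler_normB _ _)); have := ler_normD (- (h j x - F x 0 j)) (h j x * (1 - ds j x)).
  by rewrite normrN; lra.
Qed.

End AlbertiStep.

(** * Geometric series of functions with gradients, and the iteration *)

Section GradientSeries.
Context {R : realType} {n : nat}.
Local Notation V := 'rV[R]_n.
Local Notation B := (@Borel R n).
Local Notation q := (4^-1 : R).
Implicit Types (u : V -> R) (G : V -> V).

Lemma geometric_le0 (A x : R) : (forall k, x <= A * q ^+ k) -> x <= 0.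
Proof.
move=> h; rewrite leNgt; apply/negP => x0.
have /cvgrPdist_lt/(_ _ x0)[k _ /(_ k (leqnn k))] : geometric A q @ \oo --> 0.
  by apply: cvg_geometric; rewrite ger0_norm// invf_lt1// ltr1n.
rewrite sub0r normrN /= ltNge => /negP; apply.
by apply: le_trans (ler_norm _); exact: h.
Qed.

(** The limit is the supremum of the increasing lower bounds obtained by subtracting the tail
    [4 / 3 * A * q^k] from the partial sums. *)
Lemma geometric_series_limit (c : nat -> R) (A : R) : (forall k, `|c k| <= A * q ^+ k) ->
  exists l, forall k, `|l - \sum_(j < k) c j| <= 2 * A * q ^+ k.
Proof.
move=> cA; pose S k := \sum_(j < k) c j.
have A0 : 0 <= A by have := cA 0; rewrite expr0 mulr1; exact: le_trans.
pose L k := S k - 4 / 3 * A * q ^+ k; pose U k := S k + 4 / 3 * A * q ^+ k.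
have Aq k : 0 <= A * q ^+ k by rewrite mulr_ge0// exprn_ge0.
have L1 k : L k <= L k.+1.
  by rewrite /L /S big_ord_recr/= exprS; have := ler_norm (- c k); rewrite normrN; have := cA k; lra.
have U1 k : U k.+1 <= U k.
  by rewrite /U /S big_ord_recr/= exprS; have := ler_norm (c k); have := cA k; lra.
have LL : {homo L : i j / (i <= j)%N >-> i <= j} by apply: homo_leq => // ? ? ?; exact: le_trans.
have UU i j : (i <= j)%N -> U j <= U i.
  by move=> ij; rewrite -(subnK ij); elim: (j - i)%N => // k IH; rewrite addSn; exact: le_trans IH.
have LU k : L k <= U k by rewrite /L /U; have := Aq k; lra.
have LUij i j : L i <= U j.
  by apply: (@le_trans _ _ (L (maxn i j))); [rewrite LL// leq_maxl|apply: (le_trans (LU _)); rewrite UU// leq_maxr].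
exists (sup (range L)) => k.
have h1 : L k <= sup (range L) by apply: ub_le_sup; [exists (U 0) => _ [i _ <-]|exists k].
have h2 : sup (range L) <= U k by apply: ge_sup; [by exists (L 0), 0|move=> _ [i _ <-]].
rewrite -/(S k) ler_norml; move: h1 h2; rewrite /L /U; have := Aq k; lra.
Qed.

Lemma is_derive_near u (x v : V) (d : R) :
  (forall e, 0 < e -> \forall h \near (0 : R), `|u (x + h *: v) - u x - h * d| <= e * `|h|) ->
  is_derive x v u d.
Proof.
move=> H; have cv : (fun h : R => h^-1 *: (u (h *: v + x) - u x)) @ 0^' --> d.
  apply/cvgrPdist_le => e e0; have := H e e0 => Hh.
  near=> h; have h0 : h != 0 by near: h; exact: nbhs_dnbhs_neq.
  rewrite (_ : d - _ = - h^-1 * (u (x + h *: v) - u x - h * d)).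
    rewrite normrM normrN normfV mulrC ler_pdivrMr ?normr_gt0//.
    by near: h; exact: nbhs_dnbhs.
  by rewrite [h *: v + x]addrC /GRing.scale/=; field.
by apply: DeriveDef; [exact: cvgP cv|exact: cvg_lim cv].
Unshelve. all: by end_near. Qed.

(** Gradients converge uniformly, so the limit is continuous; the difference quotient of [u] is
    compared with the mean value theorem for partial sums. *)
Lemma has_grad_series (w : nat -> V -> R) (H : nat -> V -> V) (A C : R) :
  (forall k, has_grad (w k) (H k)) -> (forall k x, `|w k x| <= A * q ^+ k) ->
  (forall k x i, `|H k x 0 i| <= C * q ^+ k) ->
  exists u G, [/\ has_grad u G, forall x i, `|G x 0 i| <= 2 * C &
    forall x i k, `|G x 0 i - \sum_(j < k) H j x 0 i| <= 2 * C * q ^+ k].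
Proof.
move=> wH wA HC.
have /choice[u uP] x := geometric_series_limit (fun k => wA k x).
have /choice[g0 g0P] x : exists l : 'I_n -> R, forall i k, `|l i - \sum_(j < k) H j x 0 i| <= 2 * C * q ^+ k.
  by have /choice[l lP] i := geometric_series_limit (fun k => HC k x i); exists l.
pose G x : V := \row_i g0 x i.
have GP x i k : `|G x 0 i - \sum_(j < k) H j x 0 i| <= 2 * C * q ^+ k by rewrite mxE.
have Gb x i : `|G x 0 i| <= 2 * C.
  by have := GP x i 0; rewrite big_ord0 subr0 expr0 mulr1.
have SH k : has_grad (fun x => \sum_(j < k) w j x) (fun x => \sum_(j < k) H j x).
  exact: has_grad_sum.
have cG i : continuous (fun x => G x 0 i).
  move=> x; apply/(@cvgrPdist_le R R^o _ (nbhs x) (nbhs_filter x)) => e e0.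
  have [k hk] : exists k, 2 * C * q ^+ k <= e / 3.
    apply: contrapT => /forallNP hk.
    have : e / 3 <= 0 by apply: (@geometric_le0 (2 * C)) => k; rewrite leNgt; apply/negP => /ltW; exact: hk.
    by lra.
  have e3 : 0 < e / 3 by rewrite divr_gt0.
  have /cvgrPdist_le/(_ _ e3) hc := proj2 (SH k) i x.
  near=> y; have : `|(\sum_(j < k) H j x) 0 i - (\sum_(j < k) H j y) 0 i| <= e / 3 by near: y.
  rewrite !summxE => h1.
  have h2 := GP x i k; have h3 := GP y i k.
  set s := \sum_(j < k) _ in h1 h2; set t := \sum_(j < k) _ in h1 h3.
  have -> : G x 0 i - G y 0 i = (G x 0 i - s) + (s - t) - (G y 0 i - t) by ring.
  apply: (le_trans (ler_normB _ _)); have := ler_normD (G x 0 i - s) (s - t); lra.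
exists u, G; split => //; split=> // i x; apply: is_derive_near => e e0.
have /cvgrPdist_le/(_ _ e0)/nbhs_ballP[d /= d0 hd] := cG i x.
near=> h; have hd' : `|h| < d.
  by near: h; apply/nbhs_ballP; exists d => // h; rewrite -ball_normE/= sub0r normrN.
(* At fixed [h] the truncation errors decay like [q^k], so the bound [e * |h|] is reached by letting
   [k] grow. *)
rewrite -subr_le0; apply: (@geometric_le0 (4 * A + 2 * C * `|h|)) => k.
rewrite lerBlDr.
have [xi xih E] := has_grad_mvt x i h (SH k).
rewrite summxE in E.
have h1 := uP x k; have h2 := uP (x + h *: unitv i) k; have h3 := GP (x + xi *: unitv i) i k.
set s := \sum_(j < k) w j x in h1 E; set t := \sum_(j < k) w j _ in h2 E.
set p := \sum_(j < k) _ in h3 E.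
have h4 : `|G x 0 i - G (x + xi *: unitv i) 0 i| <= e.
  apply: hd; rewrite -ball_normE/= opprD addrA subrr add0r normrN.
  apply: le_lt_trans hd'; apply: norm_le => // j.
  by rewrite mxE unitvE normrM; case: eqVneq => _; rewrite ?normr1 ?normr0 ?mulr1 ?mulr0.
have -> : u (x + h *: unitv i) - u x - h * G x 0 i =
   (u (x + h *: unitv i) - t) - (u x - s) + h * ((p - G (x + xi *: unitv i) 0 i) - (G x 0 i - G (x + xi *: unitv i) 0 i)).
  by move: E; lra.
apply: (le_trans (ler_normD _ _)); rewrite normrM.
have h5 : `|(p - G (x + xi *: unitv i) 0 i) - (G x 0 i - G (x + xi *: unitv i) 0 i)| <= 2 * C * q ^+ k + e.
  by apply: (le_trans (ler_normB _ _)); rewrite lerD// distrC.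
have h6 : `|h| * `|(p - G (x + xi *: unitv i) 0 i) - (G x 0 i - G (x + xi *: unitv i) 0 i)| <= `|h| * (2 * C * q ^+ k + e).
  by rewrite ler_wpM2l.
have h7 := ler_normB (u (x + h *: unitv i) - t) (u x - s).
lra.
Unshelve. all: by end_near. Qed.

Variable m : {measure set B -> \bar R}.
Hypothesis mT : (m setT < +oo)%E.

(* The factor gained on the residual at each step beats the growth of the constant of [alberti_step]
   when the exceptional sets shrink geometrically. *)
Lemma alberti_lusin (e : R) : 0 < e -> exists2 C : R, 0 < C &
  forall (K : set V) (F : V -> V) (a : R), compact K ->
  (forall i, {within K, continuous (fun x => F x 0 i)}) -> 0 < a ->
  (forall x i, K x -> `|F x 0 i| <= a) ->
  exists u G (K' : set V), [/\ has_grad u G, forall x i, `|G x 0 i| <= C * a,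
    compact K' /\ K' `<=` K, (m (K `\` K') <= e%:E)%E & forall x, K' x -> G x = F x].
Proof.
move=> e0; have M0 : 0 <= fine (m setT) by exact: fine_ge0.
(* With [N * 2^j] phases the [j]-th step loses at most [n * fine (m setT) / (N * 2^j)], which this
   choice makes at most [e / 2^(j + 1)]. *)
have [N N0 NM] : exists2 N : nat, (0 < N)%N & n%:R * fine (m setT) * 2 <= e * N%:R.
  pose x := n%:R * fine (m setT) * 2 / e; have x0 : 0 <= x by rewrite !mulr_ge0 ?invr_ge0// ltW.
  exists (Num.bound x).+1 => //; rewrite -ler_pdivrMl// mulrC -/x; apply: ltW.
  by apply: (lt_trans (archi_boundP x0)); rewrite ltr_nat.
pose C1 := 4097 / cos 1 ^+ 2 * N%:R ^+ 2 : R.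
have C10 : 0 < C1 by rewrite !mulr_gt0 ?invr_gt0 ?exprn_gt0 ?cos1_gt0 ?ltr0n.
exists (2 * C1); first by rewrite mulr_gt0.
move=> K F a cK cF a0 Fa.
pose T := (set V * (V -> V))%type.
pose hyp (j : nat) (p : T) := [/\ compact p.1,
  forall i, {within p.1, continuous (fun x => p.2 x 0 i)} &
  forall x i, p.1 x -> `|p.2 x 0 i| <= a * (16^-1) ^+ j].
have a16 j : 0 < a * (16^-1) ^+ j by rewrite mulr_gt0// exprn_gt0.
(* The data are chosen for all pairs at once, with dummy values where [hyp] fails, so that the
   recursion below is an ordinary function. *)
have step (jp : nat * T) : exists r : (V -> R) * (V -> V) * set V, hyp jp.1 jp.2 ->
  [/\ has_grad r.1.1 r.1.2, forall x, `|r.1.1 x| <= a * a * q ^+ jp.1 /\ forall i, `|r.1.2 x 0 i| <= C1 * a * q ^+ jp.1,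
    compact r.2 /\ r.2 `<=` jp.2.1, (m (jp.2.1 `\` r.2) <= (e / (2 ^ jp.1.+1)%:R)%:E)%E &
    forall x i, r.2 x -> `|jp.2.2 x 0 i - r.1.2 x 0 i| <= a * (16^-1) ^+ jp.1.+1].
  case: jp => j [L f] /=; have [|no] := pselect (hyp j (L, f)); last by exists (fun=> 0, fun=> 0, set0) => /no.
  move=> [/= cL cf fa].
  have Nj : (0 < N * 2 ^ j)%N by rewrite muln_gt0 N0 expn_gt0.
  have [u [G [K' [uG ub [cK' K'L] mK' uF]]]] := alberti_step mT cL cf (a16 j) fa Nj.
  exists (u, G, K') => _ /=; split => //.
  - move=> x; have [b1 b2] := ub x; split.
      apply: (le_trans b1); rewrite mulrACA ler_wpM2l ?mulr_ge0 ?(ltW a0)// -exprMn.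
      by rewrite lerXn2r ?nnegrE// ?mulr_ge0//; lra.
    (* The constant of the step grows like [4^j] and the residual shrinks like [16^(-j)], which
       leaves [q^j] for the gradient. *)
    move=> i; apply: (le_trans (b2 i)).
    rewrite natrM natrX exprMn -exprM mulnC exprM.
    have -> : 4097 / cos 1 ^+ 2 * (N%:R ^+ 2 * (2 ^+ 2) ^+ j) * (a * 16^-1 ^+ j) = C1 * a * ((2 ^+ 2) ^+ j * 16^-1 ^+ j) by rewrite /C1; ring.
    rewrite -exprMn (_ : 2 ^+ 2 / 16 = q)//; lra.
  - have fLK : m (L `\` K') \is a fin_num.
      apply: (finite_measure_fin mT); apply: measurableD; exact: borel_compact.
    rewrite -(fineK fLK) lee_fin; apply: (le_trans mK').
    rewrite natrM !natrX exprS; have p2 : 0 < 2 ^+ j :> R by rewrite exprn_gt0.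
    have NR : 0 < N%:R :> R by rewrite ltr0n.
    rewrite ler_pdivlMr ?mulr_gt0//.
    have -> : n%:R * (fine (m setT) / (N%:R * 2 ^+ j)) * (2 * 2 ^+ j) = n%:R * fine (m setT) * 2 / N%:R.
      by field; rewrite !gt_eqF.
    by rewrite ler_pdivrMr.
  - move=> x i K'x; apply: (le_trans (uF x i K'x)).
    by rewrite exprSr mulrA.
have {step}/choice[st stP] := step.
(* The state is a compact set together with the residual field still to be realized on it. *)
pose next j (p : T) : T := ((st (j, p)).2, fun x => p.2 x - (st (j, p)).1.2 x).
pose fix seqT (j : nat) : T := if j is i.+1 then next i (seqT i) else (K, F).
have hypT j : hyp j (seqT j).
  elim: j => [|j IH].
    by split=> //= x i Kx; rewrite expr0 mulr1; exact: Fa.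
  have [/= rG rb [cr rK] mr rF] := stP (j, seqT j) IH; case: (IH) => /= h1 h2 h3.
  split => //= [i|x i rx]; last by rewrite !mxE; exact: rF.
  rewrite (_ : (fun x => _) = (fun x => (seqT j).2 x 0 i - (st (j, seqT j)).1.2 x 0 i)); last first.
    by apply/funext => x; rewrite !mxE.
  have c1 := continuous_subspaceW rK (h2 i).
  have c2 : {within (st (j, seqT j)).2, continuous (fun x => (st (j, seqT j)).1.2 x 0 i)}.
    by apply: continuous_subspaceT; exact: (proj2 rG i).
  by move=> x; apply: cvgB; [exact: c1|exact: c2].
pose w j := (st (j, seqT j)).1.1; pose H j := (st (j, seqT j)).1.2; pose L j := (seqT j).1.
have stepP j := stP (j, seqT j) (hypT j).
have [u [G [uG Gb GP]]] : exists u G, [/\ has_grad u G, forall x i, `|G x 0 i| <= 2 * (C1 * a) &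
    forall x i k, `|G x 0 i - \sum_(j < k) H j x 0 i| <= 2 * (C1 * a) * q ^+ k].
  apply: (@has_grad_series w H (a * a)) => [k|k x|k x i]; have [/= rG rb _ _ _] := stepP k => //.
    by have [] := rb x.
  by have [_] := rb x.
have cL j : compact (L j) by have [] := hypT j.
have LS j : L j.+1 `<=` L j by have [_ _ [_ +] _ _] := stepP j.
have mL j : measurable (L j : set B) by exact: borel_compact.
have resid k x i : (forall j, L j x) -> F x 0 i - \sum_(j < k) H j x 0 i = (seqT k).2 x 0 i.
  move=> Lx; elim: k => [|k IH]; first by rewrite big_ord0 subr0.
  by rewrite big_ord_recr/= !mxE opprD addrA IH.
exists u, G, (\bigcap_j L j); split => //.
- by move=> x i; rewrite -mulrA; exact: Gb.
- split; last by move=> x /(_ 0%N I).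
  have -> : \bigcap_j L j = L 0%N `&` \bigcap_j L j.
    by apply/seteqP; split => [x h|x []//]; split => //; exact: h.
  apply: compact_closedI => //; apply: closed_bigI => j _.
  by apply: compact_closed => //; exact: norm_hausdorff.
- have -> : K `\` \bigcap_j L j = \bigcup_j (L j `\` L j.+1).
    apply/seteqP; split => x.
      move=> [Kx nL]; apply: contrapT => nU; apply: nL => j _; elim: j => // j IH.
      by apply: contrapT => nx; apply: nU; exists j.
    move=> [j _ [Lx nx]]; split; last by move=> /(_ j.+1 I).
    elim: j {nx} Lx => // j IH /LS; exact: IH.
  apply: bigcup_small; [exact: ltW|by move=> j; exact: measurableD|].
  by move=> j; have [_ _ _ +] := stepP j.
- move=> x Lx; apply/rowP => i; apply/eqP; rewrite -subr_eq0 -normr_le0.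
  apply: (@geometric_le0 (2 * (C1 * a) + a)) => k.
  have h1 := GP x i k; have [_ _ /(_ x i (Lx k I))] := hypT k.
  rewrite -resid; last by move=> j; exact: Lx.
  set s := \sum_(j < k) _ in h1 * => h2.
  have h3 : a * 16^-1 ^+ k <= a * q ^+ k.
    by rewrite ler_wpM2l ?(ltW a0)// lerXn2r ?nnegrE//; lra.
  have -> : G x 0 i - F x 0 i = (G x 0 i - s) - (F x 0 i - s) by ring.
  by apply: (le_trans (ler_normB _ _)); lra.
Qed.

End GradientSeries.

(** * Comparison of all Lebesgue norms at once *)

Section LnormComparison.
Context d (T : measurableType d) {R : realType} (mu : {measure set T -> \bar R}).
Variables (Om P W : set T) (a b : T -> R) (A c k k2 : R).
Hypotheses (mOm : measurable Om) (mP : measurable P) (mW : measurable W)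
  (OmT : (mu Om < +oo)%E) (POm : P `<=` Om) (WOm : W `<=` Om)
  (P0 : (0 < mu P)%E) (Pb : forall x, P x -> c < b x)
  (Wk : fine (mu W) <= k * fine (mu P)) (k2Om : k2 * fine (mu Om) <= k * fine (mu P))
  (k0 : 0 <= k) (k20 : 0 <= k2) (k21 : k2 <= 1) (c0 : 0 < c) (A0 : 0 < A)
  (a0 : forall x, 0 <= a x) (b0 : forall x, 0 <= b x)
  (ma : measurable_fun Om a) (mb : measurable_fun Om b)
  (ab : forall x, Om x -> [\/ a x <= A * b x, W x /\ a x <= A * c | a x <= A * (k2 * c)]).

Let fin_sub X : measurable X -> X `<=` Om -> mu X \is a fin_num.
Proof.
move=> mX XO; rewrite ge0_fin_numE//; apply: le_lt_trans OmT.
by apply: le_measure; rewrite ?inE.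
Qed.

Let restr (u : T -> R) x := \1_Om x * u x.

Let restr_measurable u : measurable_fun Om u -> measurable_fun setT (restr u).
Proof.
move=> mu_; have /(measurable_restrictT _ mOm) : measurable_fun Om u by [].
congr measurable_fun; apply/funext => x; rewrite /restr /patch indicE.
by case: ifP => _; rewrite ?mul1r ?mul0r.
Qed.

(** Each of the three alternatives in [ab] is absorbed by one of the three summands. *)
Let pow_le (r : R) x : 1 <= r -> restr a x `^ r <=
  A `^ r * (restr b x `^ r + (c `^ r * \1_W x + (k2 * c) `^ r * \1_Om x)).
Proof.
move=> r1; have r0 : 0 <= r by exact: le_trans r1.
have p1 : 0 <= restr b x `^ r by exact: powR_ge0.
have p2 : 0 <= c `^ r * \1_W x by rewrite mulr_ge0// powR_ge0.
have p3 : 0 <= (k2 * c) `^ r * \1_Om x by rewrite mulr_ge0// powR_ge0.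
have mono u v : 0 <= u -> 0 <= v -> u <= A * v -> u `^ r <= A `^ r * v `^ r.
  by move=> u0 v0 uv; rewrite -powRM// ?(ltW A0)// ge0_ler_powR// nnegrE ?mulr_ge0// ltW.
have [Ox|Ox] := pselect (Om x); last first.
  rewrite /restr indicE memNset// mul0r powR0 ?gt_eqF ?(lt_le_trans _ r1)//.
  by rewrite mulr_ge0 ?powR_ge0// addr_ge0 ?powR_ge0// addr_ge0// mulr0.
rewrite {1}/restr indicE mem_set// mul1r.
have [h|[Wx h]|h] := ab Ox.
- apply: (@le_trans _ _ (A `^ r * b x `^ r)); first exact: mono.
  rewrite ler_wpM2l ?powR_ge0// {1}/restr indicE mem_set// mul1r lerDl addr_ge0//.
  by rewrite mulr1 powR_ge0.
- apply: (@le_trans _ _ (A `^ r * c `^ r)); first by apply: mono => //; exact: ltW.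
  rewrite ler_wpM2l ?powR_ge0// [\1_W x]indicE mem_set// !mulr1.
  by apply: ler_wpDl => //; rewrite lerDl powR_ge0.
- apply: (@le_trans _ _ (A `^ r * (k2 * c) `^ r)).
    by apply: mono => //; rewrite mulr_ge0// ltW.
  rewrite ler_wpM2l ?powR_ge0// mulr1.
  by apply: ler_wpDl => //; apply: ler_wpDl.
Qed.

(** All errors are measured against the integral of [b^r], which is at least [c^r * mu P]. The set
    [W] has mass at most [k * mu P], and on all of [Om] one has [(k2 c)^r <= k2 * c^r] because
    [r >= 1] and [k2 <= 1]. Finally [1 + 2 k <= (1 + 2 k)^r], so the factor is uniform in [r]. *)
Let integral_pow_le (r : R) : 1 <= r ->
  (\int[mu]_x (restr a x `^ r)%:E <= ((A * (1 + 2 * k)) `^ r)%:E * \int[mu]_x (restr b x `^ r)%:E)%E.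
Proof.
move=> r1; have r0 : 0 <= r by exact: le_trans r1.
have mpow u : measurable_fun Om u -> measurable_fun setT (fun x => (restr u x `^ r)%:E).
  move=> mu_; apply/measurable_EFinP; apply: (@measurableT_comp _ _ _ _ _ _ (fun t => t `^ r)).
    exact: measurable_powR.
  exact: restr_measurable.
have mi (X : set T) (t : R) : measurable X -> measurable_fun setT (fun x => (t * \1_X x)%:E).
  by move=> mX; apply/measurable_EFinP; apply: measurable_funM => //; exact: measurable_indic.
have iI (X : set T) (t : R) : measurable X -> 0 <= t -> (\int[mu]_x (t * \1_X x)%:E = t%:E * mu X)%E.
  move=> mX t0; under eq_integral do rewrite EFinM.
  rewrite ge0_integralZl ?lee_fin//; last by apply/measurable_EFinP; exact: measurable_indic.
  by rewrite integral_indic// setIT.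
have cr0 : 0 <= c `^ r by exact: powR_ge0.
have lower : ((c `^ r)%:E * mu P <= \int[mu]_x (restr b x `^ r)%:E)%E.
  rewrite -iI//; apply: ge0_le_integral => //.
  - by move=> x _; rewrite lee_fin mulr_ge0.
  - exact: mi.
  - exact: mpow.
  - move=> x _; rewrite lee_fin; have [Px|Px] := pselect (P x).
      rewrite indicE mem_set// mulr1 /restr indicE mem_set ?mul1r; last exact: POm.
      by rewrite ge0_ler_powR// ?nnegrE ?(ltW c0)// ltW// Pb.
    by rewrite indicE memNset// mulr0 powR_ge0.
set Ib := (\int[mu]_x _)%E in lower *.
have Ib0 : (0 <= Ib)%E by apply: integral_ge0 => x _; rewrite lee_fin powR_ge0.
have fP := fin_sub mP POm; have fW := fin_sub mW WOm; have fO := fin_sub mOm (@subset_refl _ Om).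
have WI : ((c `^ r)%:E * mu W <= k%:E * Ib)%E.
  apply: (@le_trans _ _ (k%:E * ((c `^ r)%:E * mu P))%E); last by rewrite lee_wpmul2l ?lee_fin.
  by rewrite -(fineK fP) -(fineK fW) -!EFinM lee_fin mulrCA ler_wpM2l.
have OI : (((k2 * c) `^ r)%:E * mu Om <= k%:E * Ib)%E.
  apply: (@le_trans _ _ (k%:E * ((c `^ r)%:E * mu P))%E); last by rewrite lee_wpmul2l ?lee_fin.
  rewrite -(fineK fP) -(fineK fO) -!EFinM lee_fin.
  have kr : (k2 * c) `^ r <= c `^ r * k2.
    rewrite powRM ?(ltW c0)// mulrC ler_wpM2l//.
    move: k20; rewrite le_eqVlt => /predU1P[<-|k2p]; first by rewrite powR0// gt_eqF// (lt_le_trans _ r1).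
    by apply: ge1r_powR => //; rewrite k2p.
  apply: (@le_trans _ _ (c `^ r * k2 * fine (mu Om))); first by rewrite ler_wpM2r// fine_ge0.
  by rewrite -mulrA [leRHS]mulrCA ler_wpM2l.
apply: (@le_trans _ _ ((A `^ r)%:E * (Ib + (k%:E * Ib + k%:E * Ib)))%E).
  apply: (@le_trans _ _ (\int[mu]_x ((A `^ r)%:E * ((restr b x `^ r)%:E + ((c `^ r * \1_W x)%:E + ((k2 * c) `^ r * \1_Om x)%:E))))%E).
    apply: ge0_le_integral => //.
    - by move=> x _; rewrite lee_fin powR_ge0.
    - exact: mpow.
    - apply: measurable_funeM; apply: emeasurable_funD; first exact: mpow.
      by apply: emeasurable_funD; exact: mi.
    - by move=> x _; rewrite -!EFinD -EFinM lee_fin pow_le.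
  have mW' := mi _ (c `^ r) mW; have mO' := mi _ ((k2 * c) `^ r) mOm.
  have q1 x : setT x -> (0 <= (c `^ r * \1_W x)%:E)%E by move=> _; rewrite lee_fin mulr_ge0.
  have q2 x : setT x -> (0 <= ((k2 * c) `^ r * \1_Om x)%:E)%E by move=> _; rewrite lee_fin mulr_ge0// powR_ge0.
  have q3 x : setT x -> (0 <= (restr b x `^ r)%:E)%E by move=> _; rewrite lee_fin powR_ge0.
  rewrite ge0_integralZl ?lee_fin ?powR_ge0//; last 2 first.
  - by apply: emeasurable_funD; [exact: mpow|exact: emeasurable_funD].
  - by move=> x _; rewrite !adde_ge0// ?q1 ?q2 ?q3.
  rewrite ge0_integralD//; [|exact: mpow|by move=> x _; rewrite adde_ge0// ?q1 ?q2|exact: emeasurable_funD].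
  rewrite ge0_integralD// !iI ?powR_ge0//.
  by rewrite lee_wpmul2l ?lee_fin ?powR_ge0// leeD2l// leeD.
have -> : (Ib + (k%:E * Ib + k%:E * Ib) = (1 + 2 * k)%:E * Ib)%E.
  rewrite -ge0_muleDl ?lee_fin// -[X in (X + _)%E]mul1e -ge0_muleDl ?lee_fin ?addr_ge0//.
  by congr (_%:E * _)%E; ring.
rewrite muleA -EFinM lee_wpmul2r// lee_fin powRM ?(ltW A0) ?addr_ge0 ?mulr_ge0//.
by rewrite ler_wpM2l ?powR_ge0// le1r_powR// lerDl mulr_ge0.
Qed.

Lemma Lnorm_compare (p : \bar R) : (1 <= p)%E ->
  (Lnorm mu p (fun x => (\1_Om x * a x)%:E) <=
    (A * (1 + 2 * k))%:E * Lnorm mu p (fun x => (\1_Om x * b x)%:E))%E.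
Proof.
have B0 : 0 < A * (1 + 2 * k) by rewrite mulr_gt0// ltr_wpDr// mulr_ge0.
rewrite unlock; case: p => [r| |//]; last first.
  move=> _; have -> : (0 < mu setT)%E.
    by apply: (lt_le_trans P0); apply: le_measure; rewrite ?inE.
  rewrite -lee_pdivrMl//; apply: le_ereal_inf_tmp => y hy /=.
  rewrite lee_pdivrMl//; apply: ereal_inf_lbound.
  (* For the exponent infinity, any essential bound [y] of [b] is at least [c], since [b > c] on the
     non-null set [P]; then all three alternatives are below [A * y]. *)
  have cy : (c%:E <= y)%E.
    rewrite leNgt; apply/negP => yc; move: hy => [N [mN N0 hN]].
    have : (mu P <= mu N)%E.
      apply: le_measure; rewrite ?inE// => x Px; apply: hN => /= h.
      have := le_lt_trans h yc; rewrite /restr indicE mem_set; last exact: POm.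
      by rewrite mul1r ger0_norm// lte_fin => /lt_trans/(_ (Pb Px)); rewrite ltxx.
    by rewrite N0 leNgt P0.
  have AB : A <= A * (1 + 2 * k) by rewrite ler_peMr ?(ltW A0)// lerDl mulr_ge0.
  have y0 : (0 <= y)%E by apply: le_trans cy; rewrite lee_fin ltW.
  apply: filterS hy => x /= h; rewrite ger0_norm ?mulr_ge0//.
  rewrite ger0_norm ?mulr_ge0// in h.
  have [Ox|Ox] := pselect (Om x); last by rewrite indicE memNset// mul0r mule_ge0// lee_fin ltW.
  move: h; rewrite indicE mem_set// !mul1r => h.
  apply: (@le_trans _ _ (A%:E * y)%E); last by rewrite lee_wpmul2r// lee_fin.
  have le_y t : (t%:E <= y)%E -> a x <= A * t -> ((a x)%:E <= A%:E * y)%E.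
    move=> ty at_; apply: (@le_trans _ _ (A%:E * t%:E)%E); first by rewrite -EFinM lee_fin.
    by rewrite lee_wpmul2l// lee_fin ltW.
  have [h1|[_ h1]|h1] := ab Ox; [exact: le_y h1|exact: le_y h1|apply: le_y h1].
  by apply: le_trans cy; rewrite lee_fin ler_piMl// ltW.
rewrite lee_fin => r1; have r0 : 0 < r by exact: lt_le_trans r1.
have E u : (forall x, 0 <= u x) -> (\int[mu]_x (`|(\1_Om x * u x)%:E| `^ r) = \int[mu]_x (restr u x `^ r)%:E)%E.
  by move=> u0; apply: eq_integral => x _; rewrite /= ger0_norm// mulr_ge0.
rewrite !E//.
have -> : (A * (1 + 2 * k))%:E = (((A * (1 + 2 * k)) `^ r)%:E `^ r^-1)%E.
  by rewrite poweR_EFin -powRrM mulfV ?gt_eqF// powRr1// ltW.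
have Ib0 : (0 <= \int[mu]_x (restr b x `^ r)%:E)%E by apply: integral_ge0 => x _; rewrite lee_fin powR_ge0.
rewrite -poweRM// ?lee_fin ?powR_ge0//; apply: gt0_ler_poweR; last exact: integral_pow_le.
- by rewrite invr_ge0 ltW.
- by rewrite in_itv/= leey andbT; apply: integral_ge0 => x _; rewrite lee_fin powR_ge0.
- by rewrite in_itv/= leey andbT mule_ge0// lee_fin powR_ge0.
Qed.

End LnormComparison.

(** * Choice of the reference level and a Markov inequality *)

Section FinalPreparation.
Context {R : realType} {n : nat}.
Local Notation V := 'rV[R]_n.
Local Notation B := (@Borel R n).

(** Descend along [(1 - t)^j * M0] from a level with small superlevel set and stop at the first one
    whose superlevel set is not null. The level just before it has a null superlevel set and serves
    as [M]. *)
Lemma level_ratio (nu : {measure set B -> \bar R}) (b : B -> R) (e t : R) : (nu setT < +oo)%E ->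
  measurable_fun setT b -> 0 < e -> 0 < t < 1 -> (0 < nu [set x | 0 < b x]%R)%E ->
  exists M, [/\ 0 < M, (nu [set x | (M < b x)%R] < e%:E)%E & (0 < nu [set x | ((1 - t) * M < b x)%R])%E].
Proof.
move=> nuT mb e0 /andP[t0 t1] pos; pose S (y : R) : set B := [set x | y < b x].
have mS y : measurable (S y).
  have -> : S y = setT `&` b @^-1` `]y, +oo[%classic.
    by rewrite setTI; apply/seteqP; split => x; rewrite /S /preimage/= in_itv/= andbT.
  exact: mb.
have [|||k nk] := @nonincreasing_small _ _ _ nu (fun k => S k.+1%:R) e nuT e0.
- by move=> k; exact: mS.
- move=> i j ij; apply/subsetPset => x; rewrite /S/=; apply: le_lt_trans.
  by rewrite ler_nat.
- apply/seteqP; split => // x h; have := h (Num.bound (b x)) I; rewrite /S/= ltNge => /negP; apply.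
  have [bx|bx] := leP 0 (b x); last by rewrite ltW// (lt_le_trans bx).
  by rewrite ltW// (lt_trans (archi_boundP bx))// ltr_nat.
pose M0 : R := k.+1%:R; pose Mj j : R := (1 - t) ^+ j * M0.
have u0 : 0 < 1 - t by rewrite subr_gt0.
have Mj0 j : 0 < Mj j by rewrite mulr_gt0// exprn_gt0.
have [j Sj] : exists j, (0 < nu (S (Mj j)))%E.
  apply: contrapT => /forallNP no; move: pos; apply/negP; rewrite -leNgt.
  have -> : [set x | 0 < b x] = \bigcup_j S (Mj j).
    apply/seteqP; split => [x /= bx|x [j _]]; last by apply: lt_trans; exact: Mj0.
    have bM : 0 < b x / M0 by rewrite divr_gt0.
    have : geometric 1 (1 - t) @ \oo --> 0.
      by apply: cvg_geometric; rewrite ger0_norm ?(ltW u0)// ltrBlDr ltrDl.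
    move=> /cvgrPdist_lt/(_ _ bM)[j _ /(_ j (leqnn j))] /=; rewrite sub0r normrN mul1r => h.
    exists j => //; rewrite /S/= /Mj -ltr_pdivlMr//; exact: le_lt_trans (ler_norm _) h.
  have -> : nu (\bigcup_j S (Mj j)) = 0%E; last by [].
  apply/eqP; rewrite eq_le measure_ge0 andbT.
  apply: (@le_trans _ _ (\sum_(j <oo) nu (S (Mj j)))%E).
    by apply: measure_sigma_subadditive => //; exact: bigcup_measurable.
  rewrite eseries0// => i _ _; apply/eqP; rewrite eq_le measure_ge0 andbT leNgt.
  exact/negP/no.
have exj : exists j, (0 < nu (S (Mj j)))%E by exists j.
have [i Si imin] := ex_minnP exj.
(* If the initial level already has a non-null superlevel set, it serves as [M] itself, its
   superlevel set being small by choice. *)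
case: i => [|i] in Si imin *.
  exists M0; split => //.
  apply: (lt_le_trans Si); apply: le_measure; rewrite ?inE; [exact: mS|exact: mS|].
  move=> x; rewrite /S /Mj expr0 mul1r /=; apply: le_lt_trans; rewrite ger_pMl; last exact: ltr0Sn.
  by rewrite lerBlDr lerDl ltW.
exists (Mj i); split => //.
  have -> : nu (S (Mj i)) = 0%E; last by rewrite lte_fin.
  by apply/eqP; rewrite eq_le measure_ge0 andbT leNgt; apply/negP => /imin; rewrite ltnn.
by move: Si; rewrite /Mj exprS -mulrA.
Qed.

Lemma bounded_field_markov (m : {measure set B -> \bar R}) (w : V -> V) (al : R) : (m setT < +oo)%E ->
  bounded_field w -> 0 < al -> al * fine (m [set x | al < enorm (w x)]%R) <= L1norm m w.
Proof.
move=> mT bw al0; have iw := bounded_field_integrable mT bw.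
have mw : measurable_fun setT (fun x : B => enorm (w x)) by apply: measurable_enorm; have [] := bw.
set S : set B := [set x | _].
have mS : measurable S.
  have -> : S = setT `&` (fun x : B => enorm (w x)) @^-1` `]al, +oo[%classic.
    by rewrite setTI; apply/seteqP; split => x; rewrite /S /preimage/= in_itv/= andbT.
  exact: mw.
have iS : m.-integrable setT (EFin \o (fun x : B => al * \1_S x)).
  apply: (bounded_integrable mT (M := al)) => //.
    by apply: measurable_funM => //; exact: measurable_indic.
  by move=> x _; rewrite normrM !ger0_norm ?(ltW al0)// ler_piMr ?(ltW al0)// indicE; case: (_ \in _).
have i1 : m.-integrable setT (EFin \o (\1_S : B -> R)).
  by apply: (bounded_integrable mT (M := 1)) => // x _; rewrite indicE; case: (_ \in _); rewrite ?normr1 ?normr0.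
have -> : al * fine (m S) = \int[m]_x (al * \1_S x).
  by rewrite RintegralZl// /Rintegral integral_indic// setIT.
apply: le_Rintegral => // x _; rewrite indicE.
have [xS|xS] := pselect (S x); first by rewrite mem_set// mulr1 ltW.
by rewrite memNset// mulr0 enorm_ge0.
Qed.

End FinalPreparation.

(** * Conclusion *)

Lemma has_grad_measurable (R : realType) (n : nat) (u : 'rV[R]_n -> R) (G : 'rV[R]_n -> 'rV[R]_n) :
  has_grad u G -> measurable_fun setT (G : @Borel R n -> @Borel R n).
Proof. by move=> [_ cG]; apply: measurable_row => i; exact: continuous_borel. Qed.

Lemma restr_field_measurable (R : realType) (n : nat) (D : set 'rV[R]_n) (f : 'rV[R]_n -> 'rV[R]_n) :
  measurable (D : set (@Borel R n)) ->
  measurable_fun (D : set (@Borel R n)) (f : @Borel R n -> @Borel R n) ->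
  measurable_fun setT ((fun x => \1_D x *: f x) : @Borel R n -> @Borel R n).
Proof.
move=> mD mf; apply: measurable_row => i.
have /(measurable_restrictT _ mD) := measurable_coord i mf.
congr measurable_fun; apply/funext => x; rewrite /patch !mxE indicE.
by case: ifP => _; rewrite ?mul1r ?mul0r.
Qed.

Theorem theorem3p1 (R : realType) (n : nat)
  (mu : {measure set (@Borel R n) -> \bar R}) (Omega : set 'rV[R]_n)
  (f : 'rV[R]_n -> 'rV[R]_n) :
  radon mu -> open Omega -> (mu Omega < +oo)%E ->
  measurable_fun (Omega : set (@Borel R n)) (f : @Borel R n -> @Borel R n) ->
  {ae mu, forall x : @Borel R n, Omega x ->
     forall v : 'rV[R]_n, in_decomp mu x v -> dotp (f x) v = 0} ->
  forall eps : R, 0 < eps ->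
  exists (K : set 'rV[R]_n) (g : 'rV[R]_n -> R),
    [/\ compact K /\ K `<=` Omega, C1_on Omega g,
        (mu (Omega `\` K) < eps%:E)%E,
        (forall x, K x -> grad g x = f x) &
        forall p : \bar R, (1 <= p)%E ->
          (Lnorm mu p (fun x : @Borel R n => (\1_Omega x * enorm (grad g x))%:E)
           <= (1 + eps)%:E * Lnorm mu p (fun x : @Borel R n => (\1_Omega x * enorm (f x))%:E))%E].
Proof.
move=> _ oO muO mf fperp eps eps0; have mO := borel_open oO.
pose m : {measure set (@Borel R n) -> \bar R} := mrestr mu mO.
have mE A : m A = mu (A `&` Omega) by [].
have mT : (m setT < +oo)%E by rewrite mE setTI.
have mEO A : A `<=` Omega -> m A = mu A by move=> AO; rewrite mE setIidl.
pose fO x := \1_Omega x *: f x; pose b x := enorm (fO x).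
have fOE x : Omega x -> fO x = f x by move=> Ox; rewrite /fO indicE mem_set// scale1r.
have fO0 x : ~ Omega x -> fO x = 0 by move=> Ox; rewrite /fO indicE memNset// scale0r.
have mfO : measurable_fun setT (fO : @Borel R n -> @Borel R n) by exact: restr_field_measurable.
have mb : measurable_fun setT (b : @Borel R n -> R) by exact: measurable_enorm.
have mS (y : R) : measurable ([set x | y < b x] : set (@Borel R n)).
  have -> : [set x | y < b x] = setT `&` b @^-1` `]y, +oo[%classic.
    by rewrite setTI; apply/seteqP; split => x; rewrite /preimage/= in_itv/= andbT.
  exact: mb.
(* If [f] vanishes almost everywhere there is no reference level, but the zero function is a
   solution. *)
have [pos|npos] := ltP 0%E (m [set x | 0 < b x]); last first.
  have b0 : m [set x | 0 < b x] = 0%E by apply/eqP; rewrite eq_le npos measure_ge0.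
  have mA : measurable (Omega `\` [set x | 0 < b x] : set (@Borel R n)) by exact: measurableD.
  have [K [cK KA mK]] := inner_compact mT mA eps0.
  have g0 := has_grad0 (R := R) (n := n).
  exists K, (fun=> 0); split.
  - by split => // x /KA[].
  - exact: has_grad_C1 g0.
  - rewrite -mEO; last exact: subDsetl.
    have mK' := borel_compact cK.
    apply: (@le_lt_trans _ _ (m ((Omega `\` [set x | 0 < b x] `\` K) `|` [set x | 0 < b x]))).
      apply: le_measure; rewrite ?inE; [exact: measurableD|by apply: measurableU => //; exact: measurableD|].
      by move=> x [Ox nK]; have [bx|bx] := pselect (0 < b x); [right|left].
    apply: (le_lt_trans (measureU2 _ _ _)) => //; first exact: measurableD.
    by rewrite [X in (_ + X)%E]b0 adde0.
  - move=> x /KA[Ox /negP]; rewrite (has_gradE g0) -leNgt /b fOE// => h.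
    by apply/esym/enorm_eq0/eqP; rewrite eq_le h enorm_ge0.
  - move=> p p1; rewrite (has_gradE g0) (_ : (fun x => _) = cst 0%E); last first.
      by apply/funext => x; rewrite enorm0 mulr0.
    rewrite Lnorm0; last by rewrite gt_eqF// (lt_le_trans _ p1).
    by apply: mule_ge0; [rewrite lee_fin; lra|exact: Lnorm_ge0].
(* All relative errors are powers of [1 + t] and [1 - t]: the final factor
   [(1 + t)^2 / (1 - t) * (1 + 2 t)] is at most [1 + 8 t] for [t <= 1 / 8]. *)
pose t := Num.min (1 / 8) (eps / 8).
have t0 : 0 < t by rewrite lt_min !divr_gt0.
have t8 : t <= 1 / 8 by rewrite ge_min lexx.
have teps : 8 * t <= eps by rewrite mulrC -ler_pdivlMr// ge_min lexx orbT.
clearbody t.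
have e4 : 0 < eps / 4 by rewrite divr_gt0.
have t01 : 0 < t < 1 by rewrite t0/=; lra.
have [M [M0 mM mP]] := level_ratio mT mb e4 t01 pos.
pose c := (1 - t) * M; pose P := [set x | c < b x].
have c0 : 0 < c by rewrite mulr_gt0//; lra.
have PO : P `<=` Omega.
  by move=> x; apply: contraPP => Ox; rewrite /P/= /b fO0// enorm0; apply/negP; rewrite -leNgt ltW.
have mPE := mEO _ PO.
have fP : m P \is a fin_num by apply: (finite_measure_fin mT); exact: mS.
pose m0 := fine (mu P).
have m00 : 0 < m0 by rewrite /m0 -mPE fine_gt0// mP/= ltey_eq fP.
pose T := fine (mu Omega).
have m0T : m0 <= T.
  rewrite /m0 /T -mPE -(setTI Omega) -mE; apply: fine_le => //; first exact: (finite_measure_fin mT).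
  by apply: le_measure; rewrite ?inE//; exact: mS.
pose D := Omega `\` [set x | M < b x].
have mD : measurable (D : set (@Borel R n)) by exact: measurableD.
have [K0 [cK0 K0D mK0 cf]] := lusin_borel mT mD (measurable_funTS mfO) e4.
have K0O : K0 `<=` Omega by move=> x /K0D[].
have bK0 x : K0 x -> b x <= M by move=> /K0D[_ /negP]; rewrite -leNgt.
have mK0' := borel_compact cK0.
have tm0 : 0 < t * m0 by exact: mulr_gt0.
(* On [U] outside [K0] the gradient may be as large as about [M], so this set gets measure at most
   [t * mu P]. *)
have [C [U [cC oU CK KU mUC]]] := borel_regular mT mK0' tm0.
pose W := (U `\` K0) `&` Omega.
have mW : measurable (W : set (@Borel R n)).
  by apply: measurableI => //; apply: measurableD => //; exact: borel_open.
have Wm0 : fine (mu W) <= t * m0.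
  rewrite -mEO; last exact: subIsetr.
  rewrite -lee_fin fineK; last exact: (finite_measure_fin mT).
  apply: le_trans (ltW mUC); apply: le_measure; rewrite ?inE//.
    by apply: measurableD; [exact: borel_open|exact: borel_closed].
  by move=> x [[Ux nK] _]; split => // /CK.
have [chi [[cchi _] chi01 chi1 chi0]] := cutoff cK0 oU KU.
have cbK0 : {within K0, continuous b}.
  move=> x; apply: (continuous_comp (cf x)); exact: enorm_continuous.
have [w [[cw _] wE wM]] : exists w, [/\ Cc w, forall x, K0 x -> w x = b x & forall x, `|w x| <= M].
  by apply: extend_Cc => // x Kx; rewrite ger0_norm ?bK0// enorm_ge0.
(* Where the gradient is at most [k2 * c], its [p]-th power integrates to at most
   [k2 * c^p * mu Omega <= t * c^p * mu P]. *)
pose k2 := t * m0 / (T + 1).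
have T1 : 0 < T + 1 by clear - m00 m0T; lra.
have k20 : 0 < k2 by rewrite divr_gt0.
have k21 : k2 <= 1 by rewrite ler_pdivrMr// mul1r; clear - t0 t8 m00 m0T; nra.
have k2T : k2 * T <= t * m0.
  by rewrite /k2 mulrAC ler_pdivrMr// ler_wpM2l ?(ltW tm0)// lerDl.
(* [s0] is the total additive error, shared equally between the floor [tau0] of the weight and
   Alberti's correction. The factor [t / (1 + t)] is what the case of small [|f|] on [K0]
   requires. *)
pose s0 := k2 * c * (t / (1 + t)).
have t1p : 0 < 1 + t by clear - t0; lra.
have s00 : 0 < s0 by apply: mulr_gt0; [exact: mulr_gt0|exact: divr_gt0].
have s0E : s0 * (1 + t) = k2 * c * t by rewrite /s0 mulrA divfK// gt_eqF.
clearbody k2 s0.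
pose tau0 := s0 / 4; have tau00 : 0 < tau0 by rewrite divr_gt0.
(* The positive floor [tau0] is needed to divide by the weight; beyond it, the weight is [|f|] on
   [K0], at most [M] on [U] and zero outside [U]. *)
pose phi x := tau0 + `|w x| * chi x.
have cphi : continuous phi.
  move=> x; apply: (@continuousD R R^o 'rV[R]_n (fun=> tau0) (fun x => `|w x| * chi x)); first exact: cst_continuous.
  apply: (@continuousM R 'rV[R]_n (fun x => `|w x|)); last exact: cchi.
  by apply: (@continuous_comp _ _ _ w); [exact: cw|exact: norm_continuous].
have wchi0 x : 0 <= `|w x| * chi x by rewrite mulr_ge0//; case/andP: (chi01 x).
have phi0 x : tau0 <= phi x by rewrite lerDl.
pose f0 x := \1_K0 x *: fO x.
have f0E x : K0 x -> f0 x = fO x by move=> Kx; rewrite /f0 indicE mem_set// scale1r.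
have f00 x : ~ K0 x -> f0 x = 0 by move=> Kx; rewrite /f0 indicE memNset// scale0r.
have f0M x : enorm (f0 x) <= M.
  by have [Kx|Kx] := pselect (K0 x); [rewrite f0E// bK0|rewrite f00// enorm0 ltW].
have bf0 : bounded_field f0.
  by split; [apply: restr_field_measurable => //; exact: measurable_funTS|exists M].
have f0perp : {ae m, forall x, Omega x -> forall v, in_decomp mu x v -> dotp (f0 x) v = 0}.
  have [N [mN N0 hN]] := fperp; exists N; split => //.
    apply/eqP; rewrite eq_le measure_ge0 andbT mE -N0; apply: le_measure; rewrite ?inE//.
    exact: measurableI.
  move=> x /= h; apply: hN => /= h'; apply: h => Ox v vx.
  have [Kx|Kx] := pselect (K0 x); last by rewrite f00// dotp0l.
  by rewrite f0E// fOE// h'.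
have f0phi x : enorm (f0 x) <= phi x.
  have [Kx|Kx] := pselect (K0 x); last by rewrite f00// enorm0 (le_trans (ltW tau00)).
  rewrite f0E// /phi chi1// mulr1 wE// ger0_norm ?enorm_ge0// /b.
  by rewrite lerDr ltW.
have [CA CA0 alb] := alberti_lusin mT e4.
(* [CA] does not depend on the field, so the size allowed for the residual can be fixed after it:
   the correction then has gradient at most [n * CA * al <= s0 / 2]. *)
pose al := s0 / (2 * (n%:R * CA + 1)).
have nCA : 0 <= n%:R * CA by rewrite mulr_ge0// ltW.
have nCA1 : 0 < 2 * (n%:R * CA + 1) by rewrite mulr_gt0// ltr_wpDl.
have al0 : 0 < al by rewrite divr_gt0.
have alE : n%:R * CA * al <= s0 / 2.
  have -> : s0 / 2 = (n%:R * CA + 1) * al by rewrite /al; field; rewrite gt_eqF// ltr_wpDl.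
  by rewrite ler_wpM2r ?(ltW al0)// lerDl.
clearbody al.
(* The first entry keeps the gradient below [(1 + t) * phi]; the second makes the residual exceed
   [al] only on measure [eps / 8], by Markov's inequality. *)
pose d1 := Num.min t (al * (eps / 8)).
have d10 : 0 < d1 by rewrite lt_min t0 mulr_gt0// divr_gt0.
have [g1 [tg1 g1phi g1L]] := gradient_approximation oO mT bf0 f0perp cphi tau00 phi0 f0phi d10.
have cg1 := test_fun_has_grad tg1.
pose w1 x := grad g1 x - f0 x.
have bw1 : bounded_field w1.
  rewrite (_ : w1 = (-1) *: f0 + grad g1); last by apply/funext => x; rewrite /w1 !fctE scaleN1r addrC.
  by apply: bounded_field_comb => //; apply: Ccv_bounded_field; exact: test_fun_grad.
pose S := [set x | al < enorm (w1 x)].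
have mS1 : measurable (S : set (@Borel R n)).
  have -> : S = setT `&` (fun x => enorm (w1 x)) @^-1` `]al, +oo[%classic.
    by rewrite setTI; apply/seteqP; split => x; rewrite /S /preimage/= in_itv/= andbT.
  by apply: (measurable_enorm (proj1 bw1)) => //; exact: measurable_itv.
have mS8 : fine (m S) <= eps / 8.
  rewrite -(ler_pM2l al0); apply: (le_trans (bounded_field_markov mT bw1 al0)).
  by apply: (le_trans g1L); rewrite ge_min lexx orbT.
have e8 : 0 < eps / 8 by rewrite divr_gt0.
have mKS : measurable (K0 `\` S : set (@Borel R n)) by exact: measurableD.
have [K1 [cK1 K1S mK1]] := inner_compact mT mKS e8.
pose F x := fO x - grad g1 x.
have Fb x i : K1 x -> `|F x 0 i| <= al.
  move=> /K1S[Kx /negP]; rewrite -leNgt => h; apply: (le_trans (enorm_coord _ _)).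
  by rewrite enormB /F -f0E.
have cF i : {within K1, continuous (fun x => F x 0 i)}.
  rewrite (_ : (fun x => _) = (fun x => fO x 0 i - grad g1 x 0 i)); last by apply/funext => x; rewrite !mxE.
  have K10 : K1 `<=` K0 by move=> x /K1S[].
  have h1 : {within K1, continuous (fun x => fO x 0 i)}.
    apply: (continuous_subspaceW K10) => x; apply: (cvg_comp _ (fun v : 'rV[R]_n => v 0 i) (cf x)); exact: coord_continuous.
  have h2 : {within K1, continuous (fun x => grad g1 x 0 i)}.
    by apply: continuous_subspaceT; exact: (proj2 cg1 i).
  by move=> x; apply: cvgB; [exact: h1|exact: h2].
have [u [G [K [uG Gb [cK KK1] mK GF]]]] := alb K1 F al cK1 cF al0 Fb.
have gG := has_grad_add cg1 uG.
exists K, (fun x => g1 x + u x); split.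
- by split => // x /KK1/K1S[/K0O].
- exact: has_grad_C1 gG.
- rewrite -mEO; last exact: subDsetl.
  have mK' := borel_compact cK; have mK1' := borel_compact cK1.
  pose X1 := [set x | M < b x]; pose X2 := D `\` K0; pose X4 := K0 `\` S `\` K1; pose X5 := K1 `\` K.
  have mX1 : measurable (X1 : set (@Borel R n)) by exact: mS.
  have mX2 : measurable (X2 : set (@Borel R n)) by exact: measurableD.
  have mX4 : measurable (X4 : set (@Borel R n)) by exact: measurableD.
  have mX5 : measurable (X5 : set (@Borel R n)) by exact: measurableD.
  have mX45 : measurable (X4 `|` X5 : set (@Borel R n)) by exact: measurableU.
  have mX345 : measurable (S `|` (X4 `|` X5) : set (@Borel R n)) by exact: measurableU.
  have mX25 : measurable (X2 `|` (S `|` (X4 `|` X5)) : set (@Borel R n)) by exact: measurableU.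
  (* Five losses: [|f| > M], Lusin, large residual, inner compactness and Alberti, worth [eps / 4],
     [eps / 4], [eps / 8], [eps / 8] and [eps / 4]; strictness comes from the first two and the
     fourth. *)
  apply: (@le_lt_trans _ _ (m (X1 `|` (X2 `|` (S `|` (X4 `|` X5)))))).
    apply: le_measure; rewrite ?inE; [exact: measurableD|exact: measurableU|].
    move=> x [Ox nK]; have [?|x1] := pselect (X1 x); first by left.
    right; have [Kx|?] := pselect (K0 x); last by left.
    right; have [?|xS] := pselect (S x); first by left.
    by right; have [K1x|?] := pselect (K1 x); [right|left].
  have f1 := finite_measure_fin mT mX1; have f2 := finite_measure_fin mT mX2.
  have f3 := finite_measure_fin mT mS1; have f4 := finite_measure_fin mT mX4.
  have f5 := finite_measure_fin mT mX5.
  apply: (@le_lt_trans _ _ (m X1 + (m X2 + (m S + (m X4 + m X5))))%E).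
    apply: (le_trans (measureU2 _ mX1 mX25)); rewrite leeD2l//.
    apply: (le_trans (measureU2 _ mX2 mX345)); rewrite leeD2l//.
    apply: (le_trans (measureU2 _ mS1 mX45)); rewrite leeD2l//.
    exact: measureU2.
  move: mM mK0 mS8 mK1 mK; rewrite -/X1 -/X2 -/X4 -/X5 -(fineK f1) -(fineK f2) -(fineK f3) -(fineK f4) -(fineK f5).
  by rewrite -!EFinD !lte_fin lee_fin/=; clear; lra.
- move=> x Kx; rewrite (has_gradE gG) GF// /F addrC subrK fOE//.
  by have /KK1/K1S[/K0O] := Kx.
pose A := (1 + t) ^+ 2 / (1 - t).
have t1m : 0 < 1 - t by clear - t8; lra.
have A1 : 1 <= A by rewrite ler_pdivlMr// mul1r; clear - t0; nra.
have A0 : 0 < A by exact: lt_le_trans A1.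
have AE : A * (1 - t) = (1 + t) ^+ 2 by rewrite divfK// gt_eqF.
have A2 : A * (1 + 2 * t) <= 1 + eps.
  apply: (@le_trans _ _ (1 + 8 * t)); last by rewrite lerD2l.
  by rewrite /A mulrAC ler_pdivrMr//; clear - t0 t8; nra.
move=> p p1; rewrite (has_gradE gG).
apply: (@le_trans _ _ ((A * (1 + 2 * t))%:E * Lnorm mu p (fun x : @Borel R n => (\1_Omega x * enorm (f x))%:E))%E); last first.
  by rewrite lee_wpmul2r ?Lnorm_ge0// lee_fin.
apply: (@Lnorm_compare _ _ _ mu Omega P W (fun x => enorm (grad g1 x + G x)) (fun x => enorm (f x)) A c t k2) => //.
- exact: mS.
- exact: subIsetr.
- by rewrite -mPE.
- by move=> x Px; rewrite -fOE//; exact: PO.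
- exact: ltW.
- exact: ltW.
- by move=> x; exact: enorm_ge0.
- by move=> x; exact: enorm_ge0.
- apply: measurable_enorm; apply: measurable_funTS; exact: has_grad_measurable gG.
- exact: measurable_enorm.
move=> x Ox; set a := enorm _.
have aphi : a <= (1 + t) * (`|w x| * chi x) + s0.
  apply: (le_trans (enormD _ _)).
  have h1 : enorm (grad g1 x) <= (1 + t) * phi x.
    apply: (le_trans (g1phi x)); rewrite ler_wpM2r ?(le_trans (ltW tau00))//.
    by rewrite lerD2l ge_min lexx.
  have h2 : enorm (G x) <= n%:R * CA * al.
    apply: (le_trans (enorm_le_sum _)).
    rewrite -mulrA -[X in _ <= X%:R * _](card_ord n) mulr_natl -sumr_const.
    by apply: ler_sum => i _; exact: Gb.
  have h3 : (1 + t) * tau0 <= s0 / 2 by rewrite /tau0; clear - t8 s00; nra.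
  by move: h1; rewrite /phi mulrDr; clear - h2 h3 alE; lra.
have cM : c <= M by rewrite /c; clear - t0 M0; nra.
have s0t : s0 <= k2 * c * t by clear - s0E s00 t0; nra.
have k2c : 0 < k2 * c by exact: mulr_gt0.
have [Kx|nKx] := pselect (K0 x).
  move: aphi; rewrite chi1// mulr1 wE// /b fOE// ger0_norm ?enorm_ge0// => aphi.
  have bx := enorm_ge0 (f x).
  (* Either [s0] is a small fraction of [|f x|] and is absorbed into the factor [(1 + t)^2], or
     [|f x|] is itself so small that the whole bound is below [k2 * c]. *)
  have [h|h] := leP s0 (t * ((1 + t) * enorm (f x))).
    constructor 1; apply: (@le_trans _ _ ((1 + t) ^+ 2 * enorm (f x))); first by clear - aphi h; nra.
    by rewrite ler_wpM2r// -AE ler_piMr ?(ltW A0)//; clear - t0; lra.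
  constructor 3; apply: (@le_trans _ _ (k2 * c)); last by rewrite ler_peMl ?(ltW k2c).
  by rewrite -(ler_pM2l t0); clear - aphi h s0E t0; nra.
have [Ux|nUx] := pselect (U x).
  (* On [U] outside [K0] the bound is [(1 + t) * M + s0 <= (1 + t)^2 * M], which is exactly
     [A * c]. *)
  constructor 2; split => //.
  have -> : A * c = (1 + t) ^+ 2 * M by rewrite /c mulrA AE.
  have wM' : (1 + t) * (`|w x| * chi x) <= (1 + t) * M.
    rewrite ler_wpM2l ?(ltW t1p)// -[leRHS]mulr1.
    by apply: ler_pM => //; case/andP: (chi01 x).
  have s0M : s0 <= M * t.
    apply: (le_trans s0t); rewrite ler_wpM2r ?(ltW t0)//.
    by apply: le_trans cM; rewrite ler_piMl// ltW.
  have ttM : 0 <= t ^+ 2 * M by rewrite mulr_ge0 ?sqr_ge0// ltW.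
  by clear - aphi wM' s0M ttM; lra.
(* Outside [U] only the additive error [s0] is left. *)
constructor 3; apply: (@le_trans _ _ (k2 * c)); last by rewrite ler_peMl ?(ltW k2c).
move: aphi; rewrite chi0// !mulr0 add0r => /le_trans; apply; apply: (le_trans s0t).
by rewrite ler_piMr ?(ltW k2c)//; clear - t8; lra.
Qed.
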